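(* Let $\mathfrak{M_p}$ be the space of parametric b-measures on $\mathbb{R}^N$ with respect to the moduli of continuity $\omega_j=\mathrm{id}$, $j\ge1$. Let $\bar\nu_0=(\nu_0^1,\dots,\nu_0^N)\in\mathfrak{M_p}^{N}$ have equicontinuous $m$-bounds $\{m_j\}_{j\ge1}$ (common to all components, with $m_j\le m_i$ whenever $j\le i$). Let $\Theta=\{\theta_j^I\}$ be the suitable set of moduli of continuity associated with the family of measures $\{m_j{\cdot}t\mid t\in\mathbb{R}\}$, i.e. $$\theta_j^I(s)=\sup_{t\in I,\ \tau\in\mathbb{R}}(m_j{\cdot}\tau)[t,t+s],\qquad s\ge0,\ j\in\mathbb{N},\ I=[q_1,q_2],\ q_1<q_2\ \text{rational},$$ and let $\mathrm{Hull}(\bar\nu_0)$ be the closure of $\{\bar\nu_0{\cdot}t\mid t\in\mathbb{R}\}$ in $(\mathfrak{M_p}^{N},\bar\sigma_\Theta)$, with the topology $\bar\sigma_\Theta$. Then the set $$\mathcal{U}_1=\bigcup_{\bar\nu\in\mathrm{Hull}(\bar\nu_0),\ y\in\mathbb{R}^N}\{(t,\bar\nu,y)\mid t\in I_{\bar\nu,y}\}$$ is open in $\mathbb{R}\times\mathrm{Hull}(\bar\nu_0)\times\mathbb{R}^N$, and the map $$\Pi\colon\mathcal{U}_1\to\mathrm{Hull}(\bar\nu_0)\times\mathbb{R}^N,\qquad (t,\bar\nu,y_0)\mapsto(\bar\nu{\cdot}t,\ y(t,\bar\nu,y_0))$$ defines a local continuous skew-product flow on $\mathrm{Hull}(\bar\nu_0)\times\mathbb{R}^N$.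 If in addition $\bar\nu_0$ has bounded $l$-bounds, then, for any dense and countable $D\subset\mathbb{R}^N$, the hull can be equivalently built for the product topology $\bar\sigma_D$ on $\mathfrak{M_p}^{N}$ given by $(\mathfrak{M_p},\sigma_D)$ in each component, and the hull is compact.
   Context: $\mathcal{B}$ is the ring of bounded Borel subsets of $\mathbb{R}$. $\mathcal{M}_c(\mathcal{B})$ is the set of b-measures: maps $\mu\colon\mathcal{B}\to\mathbb{R}$ with $\mu(\emptyset)=0$, $\mu(\{t\})=0$ for all $t\in\mathbb{R}$, and $\mu(\bigcup_n A_n)=\sum_n\mu(A_n)$ for every countable family of pairwise disjoint $A_n\in\mathcal{B}$ with $\bigcup_nA_n\in\mathcal{B}$. The total variation is $|\mu|(A)=\sup\{\sum_{i=1}^n|\mu(A_i)|\}$ over finite partitions $\{A_1,\dots,A_n\}\subset\mathcal{B}$ of $A\in\mathcal{B}$. $\mathcal{M}_c^+$ is the set of locally finite regular Borel positive measures on $\mathbb{R}$ without purely discontinuous part. $\mathfrak{M_p}$ (with $\omega_j=\mathrm{id}$) is the space of maps $\nu\colon\mathbb{R}^N\to\mathcal{M}_c(\mathcal{B})$, $y\mapsto\nu_y$, such that for each integer $j\ge1$ there are $m_j,l_j\in\mathcal{M}_c^+$ (an $m$-bound and an $l$-bound of $\nu$ on the closed ball $B_j=\{|y|\le j\}$) with $|\nu_y|(A)\le m_j(A)$ for $A\in\mathcal{B}$, $y\in B_j$, and $|\nu_{y_1}-\nu_{y_2}|(A)\le l_j(A)\,|y_1-y_2|$ for $A\in\mathcal{B}$,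 $y_1,y_2\in B_j$. For $\bar\nu=(\nu^1,\dots,\nu^N)\in\mathfrak{M_p}^N$, $m_j$ and $l_j$ denote bounds valid for all components. Translations: $(\nu{\cdot}t)_y(A)=\nu_y(A+t)$, $\bar\nu{\cdot}t=(\nu^1{\cdot}t,\dots,\nu^N{\cdot}t)$, and $(\mu{\cdot}t)(A)=\mu(A+t)$ for a measure $\mu$. Integral: for $y\colon[a,b]\to\mathbb{R}^N$ continuous, $\int_a^b d\nu_{y(s)}$ is the limit as $\delta\to0$ of the Riemann sums $\sum_{i=1}^{k-1}\nu_{y(\tau_i)}[t_i,t_{i+1}]$ over tagged $\delta$-partitions of $[a,b]$ ($a=t_1<\dots<t_k=b$, $\tau_i\in[t_i,t_{i+1}]$, $t_{i+1}-t_i<\delta$); it always exists; $\int_b^a=-\int_a^b$; for $\bar\nu$ it is taken componentwise. $\bar\nu_0$ has equicontinuous $m$-bounds $\{m_j\}$ if for each $j$ the family $\{m_j{\cdot}t\mid t\in\mathbb{R}\}$ is equicontinuous: for each $\varepsilon>0$ there is $\delta>0$ with $(m_j{\cdot}t)[s,r]<\varepsilon$ whenever $0\le r-s<\delta$, $t\in\mathbb{R}$. It has bounded $l$-bounds if it has $l$-bounds $\{l_j\}$ such that for each $j$ there is $c>0$ with $(l_j{\cdot}t)[s,s+1]\le c$ for all $s,t\in\mathbb{R}$. Topologies: given $\Theta=\{\theta_j^I\}$, $\mathcal{K}^I_j$ is the set of $y\in C(I,B_j)$ with $|y(t_1)-y(t_2)|\le\theta_j^I(|t_1-t_2|)$ for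 all $t_1,t_2\in I$; $\sigma_\Theta$ is the topology on $\mathfrak{M_p}$ generated by the seminorms $\nu\mapsto\sup_{y\in\mathcal{K}^I_j}|\int_I d\nu_{y(s)}|$ ($j\in\mathbb{N}$, $I$ compact interval with rational endpoints), and $\sigma_D$ the one generated by $\nu\mapsto|\nu_y(I)|$ ($y\in D$, $I$ compact interval with rational endpoints). $\bar\sigma_\Theta,\bar\sigma_D$ are the product topologies on $\mathfrak{M_p}^N$. For $\bar\nu\in\mathfrak{M_p}^N$ and $y_0\in\mathbb{R}^N$, $y(\cdot,\bar\nu,y_0)$ is the unique maximal solution of $y'(t)=\bar\nu_{y(t)}$, $y(0)=y_0$ (i.e. the continuous function with $y(t)=y_0+\int_0^t d\bar\nu_{y(s)}$), defined on its maximal open interval of existence $I_{\bar\nu,y_0}\ni0$. $\Pi$ being a local continuous skew-product flow means: $(t,\bar\nu)\mapsto\bar\nu{\cdot}t$ is a continuous flow on $\mathrm{Hull}(\bar\nu_0)$, $\Pi$ is continuous on $\mathcal{U}_1$, $\Pi(0,\cdot)$ is the identity, and $y(t+s,\bar\nu,y_0)=y(t,\bar\nu{\cdot}s,y(s,\bar\nu,y_0))$ whenever the terms are defined. *)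

(* Defs.v *)
From HB Require Import structures.
From mathcomp Require Import all_boot all_order all_algebra.
From mathcomp Require Import all_classical all_reals all_analysis.
From mathcomp Require Import measurable_realfun.
Set Implicit Arguments.
Unset Strict Implicit.
Unset Printing Implicit Defensive.
Import Order.TTheory GRing.Theory Num.Theory.
Import numFieldNormedType.Exports.
Local Open Scope classical_set_scope.
Local Open Scope ring_scope.

Section Measures.
Variable R : realType.

Definition bounded_borel : set (set R) :=
  [set A | measurable (A : set (measurableTypeR R)) /\ bounded_set A].

Definition translate_set (A : set R) (t : R) : set R := [set x + t | x in A].

(* A b-measure is a function on bounded_borel.  It is represented by a total
   function on [set R] with value 0 off bounded_borel, so that Leibniz equality
   is equality of b-measures. *)
Definition is_bmeasure (mu : set R -> R) : Prop :=
  [/\ forall A, ~ bounded_borel A -> mu A = 0,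
      mu set0 = 0,
      forall t, mu [set t] = 0
    & forall A : nat -> set R, (forall n, bounded_borel (A n)) ->
        trivIset setT A -> bounded_borel (\bigcup_n A n) ->
        series (fun n => mu (A n)) n @[n --> \oo] --> mu (\bigcup_n A n)].

Definition finite_partition (A : set R) n (P : 'I_n -> set R) : Prop :=
  [/\ forall i, bounded_borel (P i), trivIset setT P & \bigcup_i P i = A].

Definition total_variation (mu : set R -> R) (A : set R) : \bar R :=
  ereal_sup [set s | exists n (P : 'I_n -> set R),
    finite_partition A P /\ s = (\sum_(i < n) `|mu (P i)|)%:E].

Local Notation measR := {measure set (measurableTypeR R) -> \bar R}.

Definition locally_finite (mu : set R -> \bar R) : Prop :=
  forall x : R, exists2 U, open_nbhs x U & (mu U < +oo)%E.

Definition regular_measure (mu : set R -> \bar R) : Prop :=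
  forall A, measurable (A : set (measurableTypeR R)) ->
    mu A = ereal_inf [set mu U | U in [set U | open U /\ A `<=` U]] /\
    mu A = ereal_sup [set mu K | K in [set K | compact K /\ K `<=` A]].

Definition Mc_plus : set measR :=
  [set mu | [/\ locally_finite mu, regular_measure mu
              & forall t : R, mu [set t] = 0%E]].

Definition translate_measure (mu : set R -> \bar R) (t : R) : set R -> \bar R :=
  fun A => mu (translate_set A t).

End Measures.

Section Parametric.
Variables (R : realType) (N : nat).

Local Notation measR := {measure set (measurableTypeR R) -> \bar R}.

(* The norm of R^N is the maximum norm, the library's norm on 'rV[R]_N.  It is the
   norm compatible with m-bounds that hold for each component separately: a
   solution in the j-th ball then has modulus of continuity theta_j. *)
Definition is_m_bound (nu : 'rV[R]_N -> set R -> R) (j : nat) (m : measR) :=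
  Mc_plus m /\ forall A y, bounded_borel A -> `|y| <= j%:R ->
    (total_variation (nu y) A <= m A)%E.

Definition is_l_bound (nu : 'rV[R]_N -> set R -> R) (j : nat) (l : measR) :=
  Mc_plus l /\ forall A y1 y2, bounded_borel A ->
    `|y1| <= j%:R -> `|y2| <= j%:R ->
    (total_variation (fun B => (nu y1 B - nu y2 B)%R) A
       <= l A * `|y1 - y2|%:E)%E.

Definition is_Mp (nu : 'rV[R]_N -> set R -> R) : Prop :=
  (forall y, is_bmeasure (nu y)) /\
  forall j, (0 < j)%N ->
    (exists m, is_m_bound nu j m) /\ (exists l, is_l_bound nu j l).

Record Mp := MkMp { Mp_fun :> 'rV[R]_N -> set R -> R ; MpP : is_Mp Mp_fun }.

Definition translate_fun (nu : 'rV[R]_N -> set R -> R) (t : R)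
  : 'rV[R]_N -> set R -> R := fun y A => nu y (translate_set A t).

End Parametric.

Section Translate.
Variables (R : realType) (N : nat).

Local Notation measR := {measure set (measurableTypeR R) -> \bar R}.

Let sh (t : R) : measurableTypeR R -> measurableTypeR R := fun x => x - t.

Lemma translate_setE (A : set R) (t : R) :
  translate_set A t = (fun x => x - t) @^-1` A.
Proof.
apply/seteqP; split=> x /=; first by move=> [z Az <-]; rewrite addrK.
by move=> Ax; exists (x - t) => //; rewrite subrK.
Qed.

Lemma translate_setD (A : set R) (s t : R) :
  translate_set (translate_set A s) t = translate_set A (s + t).
Proof.
by rewrite !translate_setE; apply/seteqP; split=> x /=; rewrite opprD addrA addrAC.
Qed.

Lemma translate_set0 (A : set R) : translate_set A 0 = A.
Proof. by rewrite translate_setE; apply/seteqP; split=> x /=; rewrite subr0. Qed.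

Lemma translate_setNK (A : set R) (t : R) :
  translate_set (translate_set A (- t)) t = A.
Proof. by rewrite translate_setD addNr translate_set0. Qed.

Lemma translate_setK (A : set R) (t : R) :
  translate_set (translate_set A t) (- t) = A.
Proof. by rewrite translate_setD addrN translate_set0. Qed.

Lemma translate_set1 (x t : R) : translate_set [set x] t = [set x + t].
Proof. by rewrite /translate_set image_set1. Qed.

Lemma translate_setS (A B : set R) (t : R) :
  A `<=` B -> translate_set A t `<=` translate_set B t.
Proof. by move=> AB; apply: image_subset. Qed.

Let sh_cont t : continuous (fun x : R => x - t).
Proof. by move=> x; apply: cvgB; [exact: cvg_id|exact: cvg_cst]. Qed.

Let sh_measurable t : measurable_fun setT (sh t).
Proof. exact: (continuous_measurable_fun (@sh_cont t)). Qed.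

Lemma translate_measurable (A : set R) t :
  measurable (A : set (measurableTypeR R)) ->
  measurable (translate_set A t : set (measurableTypeR R)).
Proof.
move=> mA; rewrite translate_setE -[X in measurable X]setTI.
exact: (sh_measurable t).
Qed.

Lemma translate_open (A : set R) t : open A -> open (translate_set A t).
Proof.
by move=> oA; rewrite translate_setE; apply: open_comp => // x _; exact: sh_cont.
Qed.

Lemma translate_compact (A : set R) t : compact A -> compact (translate_set A t).
Proof.
move=> cA; apply: continuous_compact => //; apply: continuous_subspaceT => x.
by apply: cvgD; [exact: cvg_id|exact: cvg_cst].
Qed.

Lemma translate_bounded_borel (A : set R) t :
  bounded_borel A -> bounded_borel (translate_set A t).
Proof.
move=> [mA [M [Mr bA]]]; split; first exact: translate_measurable.
exists (M + `|t|); split; first exact: num_real.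
move=> x Mx _ [z Az <-] /=; rewrite (le_trans (ler_normD _ _))//.
by rewrite -lerBrDr bA// ltrBrDr.
Qed.

Lemma translate_bounded_borelE (A : set R) t :
  bounded_borel (translate_set A t) <-> bounded_borel A.
Proof.
split; last exact: translate_bounded_borel.
by move=> /(@translate_bounded_borel _ (- t)); rewrite translate_setK.
Qed.

Lemma translate_trivIset I (P : I -> set R) t :
  trivIset setT P -> trivIset setT (fun i => translate_set (P i) t).
Proof.
move=> tP i j _ _ [x []]; rewrite !translate_setE/= => Pi Pj.
by apply: tP => //; exists (x - t).
Qed.

Lemma translate_bigcup I (P : I -> set R) t :
  translate_set (\bigcup_i P i) t = \bigcup_i translate_set (P i) t.
Proof. by rewrite /translate_set image_bigcup. Qed.

Lemma translate_bmeasure (mu : set R -> R) t :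
  is_bmeasure mu -> is_bmeasure (fun A => mu (translate_set A t)).
Proof.
move=> [mu_out mu0 mu1 muU]; split.
- by move=> A nA; apply: mu_out => /translate_bounded_borelE.
- by rewrite /translate_set image_set0.
- by move=> x; rewrite translate_set1.
- move=> A bA tA bUA; rewrite translate_bigcup; apply: muU.
  + by move=> n; exact: translate_bounded_borel.
  + exact: translate_trivIset.
  + by rewrite -translate_bigcup; exact: translate_bounded_borel.
Qed.

Lemma translate_total_variation (mu : set R -> R) A t :
  (total_variation (fun B => mu (translate_set B t)) A
     <= total_variation mu (translate_set A t))%E.
Proof.
apply: ereal_sup_le => _ [n [P [[bP tP UP] ->]]].
exists n, (fun i => translate_set (P i) t); split => //; split.
- by move=> i; exact: translate_bounded_borel.
- exact: translate_trivIset.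
- by rewrite -translate_bigcup UP.
Qed.

Lemma translate_Mc_plus (m : measR) t : Mc_plus m ->
  exists m' : measR, Mc_plus m' /\
    forall A : set R, m' A = translate_measure m t A.
Proof.
move=> [lm rm m0]; pose m' : measR := measure_function_pushforward__canonical__measure_function_Measure
  m (sh_measurable t).
exists m'.
have mE (A : set R) : pushforward m (sh t) A = m (translate_set A t).
  by rewrite /pushforward translate_setE.
split; last exact: mE.
split.
- move=> x; have [U [oU Ux] mU] := lm (x + t).
  exists (translate_set U (- t)); last by rewrite /= mE translate_setNK.
  split; first exact: translate_open.
  by rewrite translate_setE /= opprK.
- move=> A mA /=; rewrite mE.
  have [r1 r2] := rm _ (translate_measurable t mA); split.
  + rewrite r1; congr (ereal_inf _); apply/seteqP; split=> _ [U [oU AU] <-].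
      exists (translate_set U (- t)); last by rewrite mE translate_setNK.
      split; first exact: translate_open.
      by rewrite -[A](translate_setK _ t); exact: translate_setS.
    exists (translate_set U t); last by rewrite mE.
    by split; [exact: translate_open|exact: translate_setS].
  + rewrite r2; congr (ereal_sup _); apply/seteqP; split=> _ [U [oU AU] <-].
      exists (translate_set U (- t)); last by rewrite mE translate_setNK.
      split; first exact: translate_compact.
      by rewrite -[A](translate_setK _ t); exact: translate_setS.
    exists (translate_set U t); last by rewrite mE.
    by split; [exact: translate_compact|exact: translate_setS].
- by move=> x; rewrite /= mE translate_set1.
Qed.

Lemma translate_is_Mp (nu : 'rV[R]_N -> set R -> R) t :
  is_Mp nu -> is_Mp (translate_fun nu t).
Proof.
move=> [bnu mlnu]; split; first by move=> y; exact: translate_bmeasure.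
move=> j j0; have [[m [Mm mP]] [l [Ml lP]]] := mlnu j j0; split.
- have [m' [Mm' m'E]] := translate_Mc_plus t Mm.
  exists m'; split=> // A y bA yj; rewrite m'E.
  apply: (le_trans (translate_total_variation _ _ _)).
  by apply: mP => //; exact: translate_bounded_borel.
- have [l' [Ml' l'E]] := translate_Mc_plus t Ml.
  exists l'; split=> // A y1 y2 bA y1j y2j; rewrite l'E.
  apply: (le_trans (translate_total_variation (fun B => nu y1 B - nu y2 B) _ _)).
  by apply: lP => //; exact: translate_bounded_borel.
Qed.

Definition translate (nu : Mp R N) (t : R) : Mp R N :=
  MkMp (translate_is_Mp t (MpP nu)).

End Translate.

Section Integral.
Variables (R : realType) (N : nat).
Implicit Types (nu : 'rV[R]_N -> set R -> R) (y : R -> 'rV[R]_N).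

Definition tagged_partition (a b d : R) (k : nat) (t tau : nat -> R) : Prop :=
  [/\ t 0%N = a, t k = b
    & forall i, (i < k)%N ->
        [/\ t i < t i.+1, t i.+1 - t i < d & t i <= tau i <= t i.+1]].

Definition riemann_sum nu y k (t tau : nat -> R) : R :=
  \sum_(0 <= i < k) nu (y (tau i)) `[t i, t i.+1]%classic.

Definition is_integral nu y (a b L : R) : Prop :=
  forall e, 0 < e -> exists2 d, 0 < d &
    forall k t tau, tagged_partition a b d k t tau ->
      `|riemann_sum nu y k t tau - L| < e.

Definition integral_Mp nu y (a b : R) : R :=
  if a <= b then xget 0 [set L | is_integral nu y a b L]
  else - xget 0 [set L | is_integral nu y b a L].

End Integral.

Section Topologies.
Variables (R : realType) (N : nat).

Local Notation raw := ('rV[R]_N -> set R -> R).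
Local Notation measR := {measure set (measurableTypeR R) -> \bar R}.

(* Mp equipped with the topology generated by the seminorms in P: the balls
   {nu | p (nu - nu1) < e}, with p in P, nu1 in Mp, e > 0, form a subbase. *)
Definition Mp_top (P : set (raw -> \bar R)) : Type := Mp R N.

Section instances.
Variable P : set (raw -> \bar R).

HB.instance Definition _ := gen_eqMixin (Mp_top P).
HB.instance Definition _ := gen_choiceMixin (Mp_top P).

Definition seminorm_ball (i : (raw -> \bar R) * raw * R) : set (Mp_top P) :=
  [set nu : Mp R N | (i.1.1 (fun y A => (nu y A - i.1.2 y A)%R) < i.2%:E)%E].

Definition seminorm_ball_dom : set ((raw -> \bar R) * raw * R) :=
  [set i | [/\ P i.1.1, is_Mp i.1.2 & 0 < i.2]].

HB.instance Definition _ := isSubBaseTopological.Build (Mp_top P)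
  seminorm_ball_dom seminorm_ball.

End instances.

Definition MpN := 'I_N -> Mp R N.

Definition MpN_top (P : set (raw -> \bar R)) : topologicalType :=
  prod_topology (fun _ : 'I_N => Mp_top P).

(* theta j q1 q2 s stands for theta_j^I(s) with I = [q1, q2]. *)
Definition moduli := nat -> rat -> rat -> R -> R.

Definition Kset (theta : moduli) (j : nat) (q1 q2 : rat) : set (R -> 'rV[R]_N) :=
  let I : set R := `[ratr q1, ratr q2]%classic in
  [set y : R -> 'rV[R]_N | [/\ {within I, continuous y}, forall t, I t -> `|y t| <= j%:R
             & forall t1 t2, I t1 -> I t2 ->
                 `|y t1 - y t2| <= theta j q1 q2 `|t1 - t2|]].

Definition sigma_Theta_seminorm (theta : moduli) j (q1 q2 : rat) : raw -> \bar R :=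
  fun nu => ereal_sup [set `|integral_Mp nu y (ratr q1) (ratr q2)|%:E
                      | y in Kset theta j q1 q2].

Definition sigma_Theta (theta : moduli) : set (raw -> \bar R) :=
  [set p | exists j q1 q2, [/\ (0 < j)%N, q1 < q2
                             & p = sigma_Theta_seminorm theta j q1 q2]].

Definition sigma_D_seminorm (y : 'rV[R]_N) (q1 q2 : rat) : raw -> \bar R :=
  fun nu => `|nu y `[ratr q1, ratr q2]%classic|%:E.

Definition sigma_D (D : set 'rV[R]_N) : set (raw -> \bar R) :=
  [set p | exists y q1 q2, [/\ D y, q1 < q2 & p = sigma_D_seminorm y q1 q2]].

Definition translateN (nu : MpN) (t : R) : MpN := fun i => translate (nu i) t.

Definition Hull (P : set (raw -> \bar R)) (nu0 : MpN) : set (MpN_top P) :=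
  closure (range (translateN nu0) : set (MpN_top P)).

(* The supremum is finite when the family m has equicontinuous translates. *)
Definition associated_moduli (m : nat -> measR) : moduli :=
  fun j q1 q2 s => fine (ereal_sup
    [set x | exists t tau : R, `[ratr q1, ratr q2]%classic t /\
       x = translate_measure (m j) tau `[t, t + s]%classic]).

Definition common_m_bounds (nu : MpN) (m : nat -> measR) : Prop :=
  forall j, (0 < j)%N -> forall i, is_m_bound (nu i) j (m j).

Definition common_l_bounds (nu : MpN) (l : nat -> measR) : Prop :=
  forall j, (0 < j)%N -> forall i, is_l_bound (nu i) j (l j).

Definition equicontinuous_translates (m : nat -> measR) : Prop :=
  forall j, (0 < j)%N -> forall e, 0 < e -> exists2 d, 0 < d &
    forall t s r, 0 <= r - s < d ->
      (translate_measure (m j) t `[s, r]%classic < e%:E)%E.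

Definition has_equicontinuous_m_bounds (nu : MpN) (m : nat -> measR) : Prop :=
  common_m_bounds nu m /\ equicontinuous_translates m.

Definition has_bounded_l_bounds (nu : MpN) : Prop :=
  exists2 l, common_l_bounds nu l &
    forall j, (0 < j)%N -> exists2 c, 0 < c &
      forall s t, (translate_measure (l j) t `[s, (s + 1)%R]%classic <= c%:E)%E.

End Topologies.

Arguments Hull {R N} P nu0.
Arguments sigma_Theta {R N} theta.
Arguments sigma_D {R N} D.

Section Flow.
Variables (R : realType) (N : nat).

Local Notation raw := ('rV[R]_N -> set R -> R).

Definition integral_MpN (nu : MpN R N) (y : R -> 'rV[R]_N) (a b : R) : 'rV[R]_N :=
  \row_i integral_Mp (nu i) y a b.

Definition is_solution (nu : MpN R N) (y0 : 'rV[R]_N)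
    (p : set R * (R -> 'rV[R]_N)) : Prop :=
  [/\ is_interval p.1, open p.1, p.1 0, {within p.1, continuous p.2}
    & forall t, p.1 t -> p.2 t = y0 + integral_MpN nu p.2 0 t].

Definition is_maximal_solution (nu : MpN R N) (y0 : 'rV[R]_N)
    (p : set R * (R -> 'rV[R]_N)) : Prop :=
  is_solution nu y0 p /\
  forall q, is_solution nu y0 q -> p.1 `<=` q.1 ->
    (forall t, p.1 t -> q.2 t = p.2 t) -> q.1 = p.1.

Definition maximal_solution (nu : MpN R N) (y0 : 'rV[R]_N)
    : set R * (R -> 'rV[R]_N) :=
  xget (set0, fun=> 0) [set p | is_maximal_solution nu y0 p].

Definition existence_interval nu y0 : set R := (maximal_solution nu y0).1.

Definition solution (t : R) nu y0 : 'rV[R]_N := (maximal_solution nu y0).2 t.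

Variables (P : set (raw -> \bar R)) (H : set (MpN_top P)).

Definition U1 : set (R * MpN_top P * 'rV[R]_N) :=
  [set p | H p.1.2 /\ existence_interval p.1.2 p.2 p.1.1].

Definition Pi (p : R * MpN_top P * 'rV[R]_N) : MpN_top P * 'rV[R]_N :=
  (translateN p.1.2 p.1.1 : MpN_top P, solution p.1.1 p.1.2 p.2).

Definition translation_map (p : R * MpN_top P) : MpN_top P := translateN p.2 p.1.

Definition continuous_translation_flow : Prop :=
  [/\ forall t nu, H nu -> H (translateN nu t),
      forall nu, H nu -> translateN nu 0 = nu,
      forall s t nu, H nu -> translateN (translateN nu s) t = translateN nu (s + t)
    & {within setT `*` H, continuous translation_map}].

Definition local_continuous_skew_product_flow : Prop :=
  [/\ continuous_translation_flow,
      {within U1, continuous Pi},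
      forall nu y0, H nu -> U1 (0, nu, y0) /\ Pi (0, nu, y0) = (nu, y0)
    & forall s t nu y0, H nu ->
        existence_interval nu y0 s ->
        existence_interval nu y0 (t + s) ->
        existence_interval (translateN nu s) (solution s nu y0) t ->
        solution (t + s) nu y0 =
          solution t (translateN nu s) (solution s nu y0)].

End Flow.

(* The relative topologies induced on H by P and by Q have the same open sets. *)
Definition same_subspace_topology (R : realType) (N : nat)
    (P Q : set (('rV[R]_N -> set R -> R) -> \bar R)) (H : set (MpN R N)) : Prop :=
  forall V : set (MpN R N), V `<=` H ->
    open (V : set (subspace (H : set (MpN_top P)))) <->
    open (V : set (subspace (H : set (MpN_top Q)))).

(* Main.v *)
(* Integrals against a parametric b-measure are handled through the increments
   of its cumulative functions, summed along tagged subdivisions.  Replacing the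
   m-bounds by "all such sums over a subdivision of [a, b] with tags in B_j are
   at most theta_j(b - a)", and similarly the l-bounds, turns them into
   conditions that survive pointwise limits, hence hold on the whole hull.
   Gronwall's inequality with the weight exp(2 |l(t) - l(0)|) gives uniqueness,
   existence by Picard iteration for the field composed with the retraction on
   a ball, and continuous dependence: the solution of a nearby equation is
   compared with the integral curve of the limit equation, and clipped solutions
   lie in K_j.  Under bounded l-bounds, convergence on a dense set of parameters
   is equivalent to sigma_Theta convergence, since fine step functions
   approximate K_j uniformly.  Compactness: the increments of an ultrafilter on
   the hull converge, and the limit increments are those of b-measures obtained
   from Lebesgue-Stieltjes measures of continuous monotone majorants. *)
From HB Require Import structures.
Require Import Defs.
From mathcomp Require Import all_boot all_order all_algebra.
From mathcomp Require Import all_classical all_reals all_analysis.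
From mathcomp Require Import finmap measurable_realfun.
From mathcomp Require Import ring lra.
Set Implicit Arguments.
Unset Strict Implicit.
Unset Printing Implicit Defensive.
Import Order.TTheory GRing.Theory Num.Theory.
Import numFieldNormedType.Exports.
Local Open Scope classical_set_scope.
Local Open Scope ring_scope.

(** * Sums along tagged subdivisions *)

(** The obstacle is the lack of uniformity along the hull. Every field of [MpN] has its own
    l-bounds, and before bounded l-bounds are assumed nothing controls those of a far translate by
    those of a limit field. Nearby fields may therefore enter only through the modulus [th], common
    to the whole hull, and every Lipschitz estimate is made with the [l] of the limit field. This
    dictates the asymmetric comparison in [cvg_solution]: the nearby equation only supplies a curve,
    and closeness of the two fields on that curve is what the seminorms measure. A second obstacle
    is that pointwise limits see values on intervals, never total variations. Letting the tag change
    from step to step repairs this: the supremum of such sums is an additive interval function that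
    majorizes all tags at once, which is what an m-bound or an l-bound has to do. Limits are taken
    along filters, so that the same lemmas serve closures, neighbourhoods in a subspace, and
    ultrafilters. *)

Section Chains.
Variables (R : realType) (T : Type).
Implicit Types (w : T -> R -> R -> R) (P Q : T -> R -> R -> Prop).
Implicit Types (a b c x z : R) (s : seq (R * T)).

(* A list [:: (t1, v1); ...; (tn, vn)] read from a is the subdivision
   a <= t1 <= ... <= tn with tag vk on [t(k-1), tk]. *)
Fixpoint csum w a s : R :=
  if s is p :: s' then w p.2 a p.1 + csum w p.1 s' else 0.

Fixpoint chain P a s c : Prop :=
  if s is p :: s' then [/\ a <= p.1, P p.2 a p.1 & chain P p.1 s' c] else a = c.

Lemma chain_le P a s c : chain P a s c -> a <= c.
Proof.
elim: s a => [a /= ->//|p s IH a /= [ap _ /IH]]; exact: le_trans.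
Qed.

Lemma chain_sub P Q a s c :
  (forall v x z, a <= x -> x <= z -> z <= c -> P v x z -> Q v x z) ->
  chain P a s c -> chain Q a s c.
Proof.
elim: s a => [//|p s IH a PQ /= [ap Pp Ps]].
have pc := chain_le Ps; split => //; first exact: PQ.
apply: IH Ps => v x z px; apply: PQ; exact: le_trans px.
Qed.

Lemma chain_cat P a s b s' c :
  chain P a s b -> chain P b s' c -> chain P a (s ++ s') c.
Proof.
by elim: s a => [a /= ->//|p s IH a /= [ap Pp Ps] Ps']; split => //; exact: IH.
Qed.

Lemma csum_cat w P a s b s' : chain P a s b ->
  csum w a (s ++ s') = csum w a s + csum w b s'.
Proof.
by elim: s a => [a /= ->|p s IH a /= [_ _ /IH ->]]; rewrite ?add0r ?addrA.
Qed.

Lemma csum_le w w' P a s c :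
  (forall v x z, a <= x -> x <= z -> z <= c -> P v x z -> w v x z <= w' v x z) ->
  chain P a s c -> csum w a s <= csum w' a s.
Proof.
elim: s a => [//|p s IH a ww' /= [ap Pp Ps]].
have pc := chain_le Ps; apply: lerD; first exact: ww'.
apply: IH Ps => v x z px; apply: ww'; exact: le_trans px.
Qed.

Lemma csum_telescope (g : R -> R) P a s c : chain P a s c ->
  csum (fun _ x z => g z - g x) a s = g c - g a.
Proof.
by elim: s a => [a /= ->|p s IH a /= [_ _ /IH ->]]; rewrite ?subrr// addrC subrKA.
Qed.

Lemma csum_le_telescope w (g : R -> R) P a s c :
  (forall v x z, a <= x -> x <= z -> z <= c -> P v x z -> w v x z <= g z - g x) ->
  chain P a s c -> csum w a s <= g c - g a.
Proof. by move=> wg Ps; rewrite -(csum_telescope g Ps); exact: csum_le wg Ps. Qed.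

Lemma ler_norm_csum w a s : `|csum w a s| <= csum (fun v x z => `|w v x z|) a s.
Proof.
elim: s a => [a /=|p s IH a /=]; first by rewrite normr0.
by rewrite (le_trans (ler_normD _ _))// lerD2l.
Qed.

Lemma csumB w w' a s :
  csum (fun v x z => w v x z - w' v x z) a s = csum w a s - csum w' a s.
Proof.
by elim: s a => [a /=|p s IH a /=]; rewrite ?subrr// IH opprD addrACA.
Qed.

Lemma mesh_chain P (d a b : R) : 0 < d -> a <= b ->
  (forall x z, a <= x -> x <= z -> z <= b -> z - x <= d -> exists v, P v x z) ->
  exists s, chain P a s b.
Proof.
move=> d0 ab HP.
have [n] : exists n : nat, b - a <= n%:R * d.
  exists (Num.truncn ((b - a) / d)).+1; rewrite -ler_pdivrMr//.
  by rewrite ltW// truncnS_gt.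
elim: n a ab HP => [|n IH] a ab HP.
  rewrite mul0r subr_le0 => ba; exists [::]; apply/eqP.
  by rewrite eq_le ab.
rewrite -natr1 mulrDl mul1r => nb.
have [bad|adb] := leP b (a + d).
  have [|v Pv] := HP a b (lexx _) ab (lexx _); first by rewrite lerBlDl.
  by exists [:: (b, v)]; split.
have [|x z x1 xz zb zd||s Ps] := IH (a + d).
- exact: ltW.
- by apply: HP => //; apply: le_trans x1; rewrite lerDl ltW.
- by lra.
have [||||v Pv] := HP a (a + d) => //; try lra.
exists ((a + d, v) :: s); split => //=; lra.
Qed.

Lemma chain_const w P a s : (forall v x, w v x x = 0) -> chain P a s a ->
  csum w a s = 0.
Proof.
move=> w0; elim: s a => [//|p s IH a /= [ap _ Ps]].
have pa : p.1 = a by apply/eqP; rewrite eq_le ap (chain_le Ps).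
by move: Ps; rewrite pa => /IH ->; rewrite w0 addr0.
Qed.

(* Peeling off the shorter of the two first steps walks along the common
   refinement of the two subdivisions. *)
Lemma csum_compare (F : T -> R -> R) P Q (l : R -> R) :
  (forall v x y z, x <= y -> y <= z -> P v x z -> P v x y /\ P v y z) ->
  (forall v x y z, x <= y -> y <= z -> Q v x z -> Q v x y /\ Q v y z) ->
  (forall v v' x z, x <= z -> P v x z -> Q v' x z ->
     `|(F v z - F v x) - (F v' z - F v' x)| <= l z - l x) ->
  forall a c s s', chain P a s c -> chain Q a s' c ->
  `|csum (fun v x z => F v z - F v x) a s
    - csum (fun v x z => F v z - F v x) a s'| <= l c - l a.
Proof.
move=> HP HQ PQ a c s s'.
have [n] := ubnP (size s + size s')%N.
elim: n a s s' => // n IH a [|p s] [|q s'] /= sn.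
- by move=> -> _; rewrite !subrr normr0.
- move=> -> [cq Qq Qs'].
  have cs : chain Q c (q :: s') c by [].
  rewrite -[X in `|0 - X|]/(csum (fun v x z => F v z - F v x) c (q :: s')).
  by rewrite (chain_const _ cs) ?subrr ?normr0// => v x; rewrite subrr.
- move=> [cq Qq Qs'] ac; rewrite -{}ac in Qs' *.
  have cs : chain P a (p :: s) a by [].
  rewrite -[X in `|X - _|]/(csum (fun v x z => F v z - F v x) a (p :: s)).
  by rewrite (chain_const _ cs) ?subrr ?normr0// => v x; rewrite subrr.
move=> [ap Pp Ps] [aq Qq Qs'].
have [pq|/ltW qp] := leP p.1 q.1.
- have [Q1 Q2] := HQ _ _ _ _ ap pq Qq.
  have := IH p.1 s (q :: s') _ Ps; move=> /(_ _)/= /[!addnS] H.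
  have {H} := H _ _; move=> /(_ _)/=.
  move: sn; rewrite addSn addnS !ltnS => sn /(_ sn) /(_ (And3 pq Q2 Qs')) h1.
  have h2 := PQ _ _ _ _ ap Pp Q1.
  apply: le_trans (_ : (l p.1 - l a) + (l c - l p.1) <= _); last by lra.
  apply: le_trans (lerD h2 h1).
  apply: le_trans (ler_normD _ _); rewrite le_eqVlt; apply/orP; left.
  by apply/eqP; congr (`|_|); ring.
- have [Q1 Q2] := HP _ _ _ _ aq qp Pp.
  have := IH q.1 (p :: s) s'.
  move: sn; rewrite /= addSn addnS addSn !ltnS => sn /(_ sn).
  move=> /(_ (And3 qp Q2 Ps) Qs') h1.
  have h2 := PQ _ _ _ _ aq Q1 Qq.
  apply: le_trans (_ : (l q.1 - l a) + (l c - l q.1) <= _); last by lra.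
  apply: le_trans (lerD h2 h1).
  apply: le_trans (ler_normD _ _); rewrite le_eqVlt; apply/orP; left.
  by apply/eqP; congr (`|_|); ring.
Qed.

End Chains.

(** * Integrals along a curve *)

Section Integrals.
Variables (R : realType) (N : nat).
Local Notation V := 'rV[R]_N.
Implicit Types (F : V -> R -> R) (l : R -> R) (y : R -> V) (a b c J : R).
Implicit Types (nu : V -> set R -> R).

Definition inc F (v : V) (x z : R) : R := F v z - F v x.

Definition ucont y a b := forall e, 0 < e -> exists2 d, 0 < d &
  forall s t, a <= s <= b -> a <= t <= b -> `|s - t| < d -> `|y s - y t| <= e.

Definition bounded_on y a b J := forall t, a <= t <= b -> `|y t| <= J.

Definition lip_inc F J l := forall v v' x z, `|v| <= J -> `|v'| <= J -> x <= z ->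
  `|inc F v x z - inc F v' x z| <= (l z - l x) * `|v - v'|.

(** The tag need not be a value of the curve. This freedom admits tags from a net in a dense set,
    and one-step chains with a constant tag. *)
Definition fine_tag y J eta (v : V) x z :=
  `|v| <= J /\ forall s, x <= s <= z -> `|v - y s| <= eta.

(** An error estimate by the oscillation [eta] replaces the limit over the mesh. It holds for each
    single chain, so statements about integrals reduce to statements about finite sums. *)
Definition int_approx F y a b J l L := forall eta s,
  chain (fine_tag y J eta) a s b ->
  `|csum (inc F) a s - L| <= eta * (l b - l a).

Lemma ucont_sub y a b a' b' : a <= a' -> b' <= b -> ucont y a b -> ucont y a' b'.
Proof.
move=> aa bb yu e /yu[d d0 yd]; exists d => // s t /andP[s1 s2] /andP[t1 t2].
by apply: yd; apply/andP; split; lra.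
Qed.

Lemma bounded_on_sub y a b a' b' J :
  a <= a' -> b' <= b -> bounded_on y a b J -> bounded_on y a' b' J.
Proof. by move=> aa bb yJ t /andP[t1 t2]; apply: yJ; apply/andP; split; lra. Qed.

Lemma exists_fine_chain y a b J eta (tau : R -> R -> R) : a <= b ->
  (forall x z, x <= z -> x <= tau x z <= z) ->
  ucont y a b -> bounded_on y a b J -> 0 < eta ->
  exists s, chain (fun v x z => fine_tag y J eta v x z /\ v = y (tau x z)) a s b.
Proof.
move=> ab tauP yu yJ /yu[d d0 yd].
apply: (@mesh_chain _ _ _ (d / 2)) => //; first by lra.
move=> x z ax xz zb zx; exists (y (tau x z)).
have /andP[t1 t2] := tauP _ _ xz.
split=> //; split=> [|s /andP[s1 s2]]; first by apply: yJ; apply/andP; split; lra.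
apply: yd; try by apply/andP; split; lra.
by rewrite ltr_norml; apply/andP; split; lra.
Qed.

Lemma fine_chain_compare F y a b J l eta eta' s s' :
  {homo l : x z / x <= z} -> lip_inc F J l ->
  chain (fine_tag y J eta) a s b -> chain (fine_tag y J eta') a s' b ->
  `|csum (inc F) a s - csum (inc F) a s'| <= (eta + eta') * (l b - l a).
Proof.
move=> ndl lipF Ps Ps'; rewrite mulrBr.
have sub e v x u z : x <= u -> u <= z -> fine_tag y J e v x z ->
    fine_tag y J e v x u /\ fine_tag y J e v u z.
  move=> xu uz [vJ vy]; split; split=> // t /andP[t1 t2]; apply: vy;
  by apply/andP; split; lra.
apply: (csum_compare (l := fun x => (eta + eta') * l x) _ _ _ Ps Ps').
- by move=> v x u z; exact: sub.
- by move=> v x u z; exact: sub.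
move=> v v' x z xz [vJ vy] [v'J v'y].
apply: (le_trans (lipF _ _ _ _ vJ v'J xz)).
rewrite -mulrBr mulrC ler_wpM2r ?subr_ge0 ?ndl//.
have xx : x <= x <= z by rewrite lexx.
have := lerD (vy x xx) (v'y x xx); apply: le_trans.
by rewrite -(subrKA (y x)) [ `|v' - _|]distrC ler_normD.
Qed.

Lemma exists_int_approx F y a b J l : a <= b ->
  {homo l : x z / x <= z} -> lip_inc F J l ->
  ucont y a b -> bounded_on y a b J -> exists L, int_approx F y a b J l L.
Proof.
move=> ab ndl lipF yu yJ.
pose C := l b - l a; have C0 : 0 <= C by rewrite subr_ge0 ndl.
(* The integral is a cut: every lower estimate [csum - eta * C] lies below every upper estimate
   [csum + eta * C], by [fine_chain_compare]. *)
pose S := [set x | exists eta s, chain (fine_tag y J eta) a s b /\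
                   x = csum (inc F) a s - eta * C].
have ubS eta s : chain (fine_tag y J eta) a s b ->
    ubound S (csum (inc F) a s + eta * C).
  move=> Ps _ [eta' [s' [Ps' ->]]].
  have := fine_chain_compare ndl lipF Ps' Ps.
  by rewrite ler_norml mulrDl -/C => /andP[_]; lra.
have [s1 Ps1] : exists s, chain (fine_tag y J 1) a s b.
  have [|s Ps] := @exists_fine_chain y a b J 1 (fun x _ => x) ab _ yu yJ ltr01.
    by move=> x z xz; rewrite lexx.
  by exists s; apply: chain_sub Ps => v x z _ _ _ [].
have S0 : S !=set0 by exists (csum (inc F) a s1 - 1 * C); exists 1, s1.
exists (sup S) => eta s Ps; rewrite -/C ler_norml; apply/andP; split.
- have : sup S <= csum (inc F) a s + eta * C by apply: ge_sup => //; exact: ubS.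
  by lra.
- have : csum (inc F) a s - eta * C <= sup S.
    by apply: ub_le_sup; [exists (csum (inc F) a s1 + 1 * C); exact: ubS|exists eta, s].
  by lra.
Qed.

Definition cum_of nu F := forall v a b, a <= b -> nu v `[a, b]%classic = F v b - F v a.

Lemma riemann_sum_csum nu F y k t tau : cum_of nu F ->
  (forall i, (i < k)%N -> t i <= t i.+1) ->
  riemann_sum nu y k t tau =
  csum (inc F) (t 0%N) [seq (t i.+1, y (tau i)) | i <- iota 0 k].
Proof.
move=> nuF; rewrite /riemann_sum.
suff H n : (forall i, (n <= i < n + k)%N -> t i <= t i.+1) ->
   \sum_(n <= i < n + k) nu (y (tau i)) `[t i, t i.+1]%classic =
   csum (inc F) (t n) [seq (t i.+1, y (tau i)) | i <- iota n k].
  by move=> tk; apply: (H 0%N) => i /andP[_]; rewrite add0n; exact: tk.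
elim: k n => [|k IH] n tn; first by rewrite addn0 big_geq.
rewrite big_ltn ?addnS ?ltnS ?leq_addr//= nuF; last first.
  by apply: tn; rewrite leqnn/= addnS ltnS leq_addr.
by rewrite -IH ?addSn// => i /andP[ni ik]; apply: tn; rewrite (ltnW ni) addnS -addSn.
Qed.

Lemma tagged_partition_chain y J a b eta d k t tau :
  (forall u v, a <= u <= b -> a <= v <= b -> `|u - v| < d -> `|y u - y v| <= eta) ->
  bounded_on y a b J -> tagged_partition a b d k t tau ->
  chain (fine_tag y J eta) a [seq (t i.+1, y (tau i)) | i <- iota 0 k] b.
Proof.
move=> yd yJ [t0 tk tP].
suff H m n : (n + m)%N = k -> a <= t n ->
    chain (fine_tag y J eta) (t n) [seq (t i.+1, y (tau i)) | i <- iota n m] b.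
  by have := H k 0%N; rewrite t0 add0n; exact.
elim: m n => [|m IH] n nk an /=; first by rewrite -tk -nk addn0.
have nlt : (n < k)%N by rewrite -nk addnS ltnS leq_addr.
have [t1 t2 /andP[t3 t4]] := tP _ nlt.
have Hs := IH n.+1; rewrite addSn -addnS in Hs.
have {}Hs := Hs nk (le_trans an (ltW t1)).
have tb := chain_le Hs.
split => //; first exact: ltW.
split=> [|s /andP[s1 s2]]; first by apply: yJ; apply/andP; split; lra.
apply: yd; try by apply/andP; split; lra.
by rewrite ltr_norml; apply/andP; split; lra.
Qed.

Lemma exists_tagged_partition a b d : a <= b -> 0 < d ->
  exists k t tau, tagged_partition a b d k t tau.
Proof.
rewrite le_eqVlt => /predU1P[->|ab] d0.
  (* Steps of a tagged partition are strictly increasing, so a single point only has the partition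
     with [k = 0]. *)
  by exists 0%N, (fun=> b), (fun=> b).
pose k := (Num.truncn ((b - a) / d)).+1.
have k0 : 0 < k%:R :> R by rewrite ltr0n.
pose h := (b - a) / k%:R.
have h0 : 0 < h by rewrite divr_gt0// subr_gt0.
have hd : h < d.
  by rewrite /h ltr_pdivrMr// mulrC -ltr_pdivrMr// truncnS_gt.
exists k, (fun i => a + i%:R * h), (fun i => a + i%:R * h); split.
- by rewrite mul0r addr0.
- by rewrite /h mulrC divfK ?gt_eqF// addrC subrK.
move=> i ik; rewrite -natr1 mulrDl mul1r; split; try lra.
Qed.

Lemma integral_MpP nu F y a b J l : a <= b -> cum_of nu F ->
  {homo l : x z / x <= z} -> lip_inc F J l ->
  ucont y a b -> bounded_on y a b J ->
  int_approx F y a b J l (integral_Mp nu y a b).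
Proof.
move=> ab nuF ndl lipF yu yJ.
have [L HL] := exists_int_approx ab ndl lipF yu yJ.
have isL : is_integral nu y a b L.
  move=> e e0.
  have C0 : 0 <= l b - l a by rewrite subr_ge0 ndl.
  have eta0 : 0 < e / (l b - l a + 1) by rewrite divr_gt0// ltr_pwDr.
  have [d d0 yd] := yu _ eta0; exists d => // k t tau tP.
  have := HL _ _ (tagged_partition_chain yd yJ tP).
  have [t0 _ tI] := tP.
  rewrite (riemann_sum_csum _ _ nuF) => [|i /tI[/ltW]//]; rewrite t0.
  move=> /le_lt_trans; apply; rewrite mulrAC ltr_pdivrMr; last lra.
  by rewrite ltr_pM2l//; lra.
suff -> : integral_Mp nu y a b = L by [].
(* [xget] returns some integral; it equals [L] because one partition fine enough for both brings the
   two values together. *)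
rewrite /integral_Mp ab; case: xgetP => [L' _ isL'|/(_ L)/(_ isL)//].
apply/eqP; rewrite -subr_eq0 -normr_le0; apply/ler_addgt0Pr => e e0.
have e20 : 0 < e / 2 by lra.
have [d1 d10 H1] := isL _ e20; have [d2 d20 H2] := isL' _ e20.
have d0 : 0 < Num.min d1 d2 by rewrite lt_min d10.
have [k [t [tau tP]]] := exists_tagged_partition ab d0.
have tP' d : Num.min d1 d2 <= d -> tagged_partition a b d k t tau.
  case: tP => t0 tk tI dd; split=> // i /tI[u v w]; split => //.
  exact: lt_le_trans dd.
have := H1 _ _ _ (tP' d1 _); rewrite ge_min lexx => /(_ isT) h1.
have := H2 _ _ _ (tP' d2 _); rewrite ge_min lexx orbT => /(_ isT) h2.
rewrite add0r -(subrKA (riemann_sum nu y k t tau)).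
rewrite (le_trans (ler_normD _ _))// distrC; lra.
Qed.
End Integrals.

Section ChainMap.
Variables (R : realType) (T U : Type) (h : T -> U).

Definition retag (s : seq (R * T)) := [seq (p.1, h p.2) | p <- s].

Lemma chain_retag (P : U -> R -> R -> Prop) a s c :
  chain P a (retag s) c <-> chain (fun v => P (h v)) a s c.
Proof.
by elim: s a => [//|p s IH a] /=; split=> -[? ? /IH].
Qed.

Lemma csum_retag (w : U -> R -> R -> R) a s :
  csum w a (retag s) = csum (fun v => w (h v)) a s.
Proof. by elim: s a => [//|p s IH a] /=; rewrite IH. Qed.

End ChainMap.

Lemma split_error (R : realFieldType) (e C : R) : 0 <= C -> 0 < e ->
  2 * (e / (2 * (C + 1))) * C <= e.
Proof.
move=> C0 e0; have C1 : 0 < C + 1 by lra.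
have -> : 2 * (e / (2 * (C + 1))) * C = e * (C / (C + 1)) by field; rewrite gt_eqF.
by rewrite ger_pMr// ler_pdivrMr//; lra.
Qed.

(** * Additivity and comparison estimates for the integral *)

Section IntegralTheory.
Variables (R : realType) (N : nat).
Local Notation V := 'rV[R]_N.
Variables (nu : V -> set R -> R) (F : V -> R -> R) (l : R -> R) (J : R).
Hypotheses (nuF : cum_of nu F) (ndl : {homo l : x z / x <= z}).
Hypothesis lipF : lip_inc F J l.
Implicit Types (y f g : R -> V) (a b c : R).

Definition tame y a b := ucont y a b /\ bounded_on y a b J.

Lemma tame_sub y a b a' b' : a <= a' -> b' <= b -> tame y a b -> tame y a' b'.
Proof. by move=> aa bb [? ?]; split; [exact: (ucont_sub aa bb)|exact: (bounded_on_sub aa bb)]. Qed.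

Lemma tame_int y a b : a <= b -> tame y a b ->
  int_approx F y a b J l (integral_Mp nu y a b).
Proof. by move=> ab [yu yJ]; exact: integral_MpP. Qed.

Lemma int_le_csum y a b B : a <= b -> tame y a b ->
  (forall s, chain (fun v _ _ => `|v| <= J) a s b -> `|csum (inc F) a s| <= B) ->
  `|integral_Mp nu y a b| <= B.
Proof.
move=> ab yt HB; apply/ler_addgt0Pr => e e0.
have C0 : 0 <= l b - l a by rewrite subr_ge0 ndl.
have eta0 : 0 < e / (l b - l a + 1) by rewrite divr_gt0// ltr_pwDr.
have [|s Ps] := @exists_fine_chain _ _ y a b J _ (fun x _ => x) ab _ yt.1 yt.2 eta0.
  by move=> x z xz; rewrite lexx.
have Ps' : chain (fine_tag y J (e / (l b - l a + 1))) a s b.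
  by apply: chain_sub Ps => v x z _ _ _ [].
have := tame_int ab yt Ps'.
have : `|csum (inc F) a s| <= B by apply: HB; apply: chain_sub Ps' => v x z _ _ _ [].
have : e / (l b - l a + 1) * (l b - l a) <= e.
  by rewrite mulrAC ler_pdivrMr; [rewrite ler_pM2l//; lra|lra].
rewrite distrC => h1 h2 h3.
rewrite -(subrK (csum (inc F) a s) (integral_Mp _ _ _ _)).
by rewrite (le_trans (ler_normD _ _))//; lra.
Qed.

Lemma int_refl y a : `|y a| <= J -> integral_Mp nu y a a = 0.
Proof.
move=> yJ; have yt : tame y a a.
  split=> [e e0|t /andP[ta at']]; last by have -> : t = a by lra.
  exists 1 => // s t /andP[s1 s2] /andP[t1 t2] _.
  have -> : s = t by lra.
  by rewrite subrr normr0 ltW.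
have := @tame_int y a a (lexx _) yt 0 [::] erefl.
by rewrite /= mul0r sub0r normrN normr_le0 => /eqP.
Qed.

Lemma int_cat y a b c : a <= b -> b <= c -> tame y a c ->
  integral_Mp nu y a c = integral_Mp nu y a b + integral_Mp nu y b c.
Proof.
move=> ab bc yt; have ac := le_trans ab bc.
have yab := tame_sub (lexx a) bc yt; have ybc := tame_sub ab (lexx c) yt.
apply/eqP; rewrite -subr_eq0 -normr_le0; apply/ler_addgt0Pr => e e0; rewrite add0r.
have C0 : 0 <= l c - l a by rewrite subr_ge0 ndl.
pose eta := e / (2 * (l c - l a + 1)).
have eta0 : 0 < eta by rewrite divr_gt0// mulr_gt0// ltr_pwDr.
have left_tag (x z : R) : x <= z -> x <= (fun x _ => x) x z <= z by move=> ?; rewrite lexx.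
have [s Ps] := exists_fine_chain ab left_tag yab.1 yab.2 eta0.
have {}Ps : chain (fine_tag y J eta) a s b.
  by apply: chain_sub Ps => v x z _ _ _ [].
have [s' Ps'] := exists_fine_chain bc left_tag ybc.1 ybc.2 eta0.
have {}Ps' : chain (fine_tag y J eta) b s' c.
  by apply: chain_sub Ps' => v x z _ _ _ [].
have h1 := tame_int ab yab Ps.
have h2 := tame_int bc ybc Ps'.
have := tame_int ac yt (chain_cat Ps Ps').
rewrite (csum_cat _ _ Ps) => h3.
have : 2 * eta * (l c - l a) <= e by exact: split_error.
move: h1 h2 h3; rewrite !ler_norml.
move=> /andP[h1 h1'] /andP[h2 h2'] /andP[h3 h3'] h4.
by apply/andP; split; lra.
Qed.

Lemma int_near_const y v eta a b : a <= b -> tame y a b -> `|v| <= J ->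
  (forall s, a <= s <= b -> `|v - y s| <= eta) ->
  `|integral_Mp nu y a b - inc F v a b| <= eta * (l b - l a).
Proof.
move=> ab yt vJ vy; rewrite distrC.
have := tame_int ab yt (s := [:: (b, v)]) (And3 ab (conj vJ vy) erefl).
by rewrite /= addr0.
Qed.

(** One chain carries pairs of tags, so both integrals are approximated along the same subdivision,
    and the Lipschitz estimates of its steps telescope to the increment of [W]. The choice [tau] is
    left open because growing and decaying weights require opposite endpoints. *)
Lemma int_diff_le (W : R -> R) (tau : R -> R -> R) f g a b : a <= b ->
  (forall x z, x <= z -> x <= tau x z <= z) ->
  tame f a b -> tame g a b ->
  (forall x z, a <= x -> x <= z -> z <= b ->
    (l z - l x) * `|f (tau x z) - g (tau x z)| <= W z - W x) ->
  `|integral_Mp nu f a b - integral_Mp nu g a b| <= W b - W a.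
Proof.
move=> ab tauP ft gt HW; apply/ler_addgt0Pr => e e0.
have C0 : 0 <= l b - l a by rewrite subr_ge0 ndl.
pose eta := e / (2 * (l b - l a + 1)).
have eta0 : 0 < eta by rewrite divr_gt0// mulr_gt0// ltr_pwDr.
have [d1 d10 fd] := ft.1 _ eta0; have [d2 d20 gd] := gt.1 _ eta0.
pose P (v : V * V) x z := [/\ fine_tag f J eta v.1 x z, fine_tag g J eta v.2 x z,
  v.1 = f (tau x z) & v.2 = g (tau x z)].
have [||s Ps] := @mesh_chain _ _ P (Num.min d1 d2 / 2) a b _ ab.
- by rewrite divr_gt0// lt_min d10.
- move=> x z ax xz zb zx; exists (f (tau x z), g (tau x z)).
  have /andP[t1 t2] := tauP _ _ xz.
  have zx1 : z - x < d1.
    by apply: le_lt_trans zx _; rewrite ltr_pdivrMr// gt_min; apply/orP; left; lra.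
  have zx2 : z - x < d2.
    by apply: le_lt_trans zx _; rewrite ltr_pdivrMr// gt_min; apply/orP; right; lra.
  split=> //=.
  + split=> [|s /andP[s1 s2]]; first by apply: ft.2; apply/andP; split; lra.
    by apply: fd; rewrite ?ltr_norml; apply/andP; split; lra.
  + split=> [|s /andP[s1 s2]]; first by apply: gt.2; apply/andP; split; lra.
    by apply: gd; rewrite ?ltr_norml; apply/andP; split; lra.
have P1 : chain (fine_tag f J eta) a (retag fst s) b.
  by apply/chain_retag; apply: chain_sub Ps => v x z _ _ _ [].
have P2 : chain (fine_tag g J eta) a (retag snd s) b.
  by apply/chain_retag; apply: chain_sub Ps => v x z _ _ _ [].
have h1 := tame_int ab ft P1; have h2 := tame_int ab gt P2.
have h3 : `|csum (inc F) a (retag fst s) - csum (inc F) a (retag snd s)| <= W b - W a.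
  rewrite !csum_retag -csumB (le_trans (ler_norm_csum _ _ _))//.
  apply: csum_le_telescope Ps => -[v v'] x z ax xz zb [/= [vJ _] [v'J _] vE v'E].
  by apply: (le_trans (lipF vJ v'J xz)); rewrite vE v'E; exact: HW.
have : 2 * eta * (l b - l a) <= e by exact: split_error.
move: h1 h2 h3; rewrite !ler_norml.
move=> /andP[h1 h1'] /andP[h2 h2'] /andP[h3 h3'] h4.
by apply/andP; split; lra.
Qed.

Lemma int_diff_unif f g eta a b : a <= b -> tame f a b -> tame g a b ->
  (forall s, a <= s <= b -> `|f s - g s| <= eta) ->
  `|integral_Mp nu f a b - integral_Mp nu g a b| <= eta * (l b - l a).
Proof.
move=> ab ft gt fg; rewrite mulrBr.
apply: (@int_diff_le (fun x => eta * l x) (fun x _ => x)) => //.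
  by move=> x z ->; rewrite lexx.
move=> x z ax xz zb; rewrite -mulrBr mulrC ler_wpM2r ?subr_ge0 ?ndl//.
by apply: fg; rewrite ax (le_trans xz).
Qed.

Lemma int_eq f g a b : a <= b -> tame f a b -> tame g a b ->
  (forall s, a <= s <= b -> f s = g s) ->
  integral_Mp nu f a b = integral_Mp nu g a b.
Proof.
move=> ab ft gt fg; apply/eqP; rewrite -subr_eq0 -normr_le0.
rewrite (le_trans (@int_diff_unif _ _ 0 _ _ ab ft gt _)) ?mul0r//.
by move=> s /fg ->; rewrite subrr normr0.
Qed.

(* With left tags, convexity of exp makes the bound telescope on every single
   subdivision: exp(2 l x) (l z - l x) <= (exp(2 l z) - exp(2 l x)) / 2. *)
Lemma int_diff_exp f g K a b : a <= b -> tame f a b -> tame g a b -> 0 <= K ->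
  (forall s, a <= s <= b -> `|f s - g s| <= K * expR (2 * l s)) ->
  `|integral_Mp nu f a b - integral_Mp nu g a b|
    <= K / 2 * (expR (2 * l b) - expR (2 * l a)).
Proof.
move=> ab ft gt K0 fg; rewrite mulrBr.
apply: (@int_diff_le (fun x => K / 2 * expR (2 * l x)) (fun x _ => x)) => //.
  by move=> x z ->; rewrite lexx.
move=> x z ax xz zb; rewrite -mulrBr.
have lxz : 0 <= l z - l x by rewrite subr_ge0 ndl.
apply: le_trans (_ : (l z - l x) * (K * expR (2 * l x)) <= _).
  by apply: ler_wpM2l => //; apply: fg; rewrite ax (le_trans xz).
have -> : expR (2 * l z) = expR (2 * l x) * expR (2 * (l z - l x)).
  by rewrite -expRD; congr expR; ring.
have : 1 + 2 * (l z - l x) <= expR (2 * (l z - l x)) by exact: expR_ge1Dx.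
have e0 : 0 <= K * expR (2 * l x) by rewrite mulr_ge0// expR_ge0.
move: (expR (2 * (l z - l x))) => e h.
have -> : K / 2 * (expR (2 * l x) * e - expR (2 * l x)) =
   K * expR (2 * l x) * ((e - 1) / 2) by field.
rewrite mulrC; apply: ler_wpM2l => //; lra.
Qed.

(** The mirror image for times before 0. The weight now decreases, so the tag is the right endpoint,
    where the weight on the step is smallest. *)
Lemma int_diff_expN f g K a b : a <= b -> tame f a b -> tame g a b -> 0 <= K ->
  (forall s, a <= s <= b -> `|f s - g s| <= K * expR (- (2 * l s))) ->
  `|integral_Mp nu f a b - integral_Mp nu g a b|
    <= K / 2 * (expR (- (2 * l a)) - expR (- (2 * l b))).
Proof.
move=> ab ft gt K0 fg.
have -> : K / 2 * (expR (- (2 * l a)) - expR (- (2 * l b))) =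
   - (K / 2 * expR (- (2 * l b))) - - (K / 2 * expR (- (2 * l a))) by ring.
apply: (@int_diff_le (fun x => - (K / 2 * expR (- (2 * l x)))) (fun _ z => z)) => //.
  by move=> x z ->; rewrite lexx.
move=> x z ax xz zb.
have lxz : 0 <= l z - l x by rewrite subr_ge0 ndl.
apply: le_trans (_ : (l z - l x) * (K * expR (- (2 * l z))) <= _).
  by apply: ler_wpM2l => //; apply: fg; rewrite zb (le_trans ax).
have -> : expR (- (2 * l x)) = expR (- (2 * l z)) * expR (2 * (l z - l x)).
  by rewrite -expRD; congr expR; ring.
have : 1 + 2 * (l z - l x) <= expR (2 * (l z - l x)) by exact: expR_ge1Dx.
have e0 : 0 <= K * expR (- (2 * l z)) by rewrite mulr_ge0// expR_ge0.
move: (expR (2 * (l z - l x))) => e h.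
have -> : - (K / 2 * expR (- (2 * l z))) - - (K / 2 * (expR (- (2 * l z)) * e)) =
   K * expR (- (2 * l z)) * ((e - 1) / 2) by field.
rewrite mulrC; apply: ler_wpM2l => //; lra.
Qed.

Lemma int_rev y a b : bounded_on y (Num.min a b) (Num.max a b) J ->
  integral_Mp nu y a b = - integral_Mp nu y b a.
Proof.
move=> yJ; rewrite /integral_Mp; case: (ltgtP a b) => [||ab]; rewrite ?opprK//.
have := @int_refl y b; rewrite /integral_Mp ab lexx => ->; rewrite ?oppr0//.
by apply: yJ; rewrite ab /Num.min /Num.max ltxx lexx.
Qed.

End IntegralTheory.

(** * Cumulative functions of measures *)

Section MeasureCumulative.
Variable R : realType.
Local Notation measR := {measure set (measurableTypeR R) -> \bar R}.
Implicit Types (m : measR) (mu : set R -> R) (a b c x : R).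

Lemma measurable_itvR (i : interval R) :
  measurable ([set` i] : set (measurableTypeR R)).
Proof. exact: measurable_itv. Qed.

Lemma open_measurableR (U : set R) : open U ->
  measurable (U : set (measurableTypeR R)).
Proof. exact: open_measurable. Qed.

Lemma bounded_borel0 : bounded_borel (set0 : set R).
Proof.
split; first exact: measurable0.
by exists 0; split; [exact: num_real|move=> x _ y []].
Qed.

Lemma bounded_borelU (A B : set R) :
  bounded_borel A -> bounded_borel B -> bounded_borel (A `|` B).
Proof.
move=> [mA [M [Mr AM]]] [mB [M' [M'r BM]]]; split; first exact: measurableU.
exists (Num.max M M'); split; first exact: num_real.
by move=> x; rewrite gt_max => /andP[h1 h2] y [/AM|/BM]; exact.
Qed.

Lemma bounded_borel_itv (i : interval R) (a b : R) :
  [set` i] `<=` `[a, b]%classic -> bounded_borel [set` i].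
Proof.
move=> iab; split; first exact: measurable_itvR.
exists (Num.max `|a| `|b|); split; first exact: num_real.
move=> x abx t /iab; rewrite /= in_itv/= => /andP[at' tb].
apply: le_trans (ltW abx); rewrite ler_norml le_max; apply/andP; split.
  rewrite lerNl le_max; apply/orP; left; rewrite -normrN.
  by apply: le_trans (ler_norm _); rewrite lerN2.
apply/orP; right; exact: le_trans (ler_norm _).
Qed.

Lemma Mc_plus_itv_fin m a b : locally_finite m -> (m `[a, b]%classic < +oo)%E.
Proof.
move=> lf.
have /choice[f fP] : forall x : R, exists U : set R, open_nbhs x U /\ (m U < +oo)%E.
  by move=> x; have [U ? ?] := lf x; exists U.
have := @segment_compact R a b; rewrite compact_cover.
move=> /(_ R setT f)[|x _|D _ cov].
- by move=> x _; have [[]] := fP x.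
- by exists x => //; have [[]] := fP x.
apply: (@le_lt_trans _ _ (\sum_(i \in [set` D]) m (f i))%E).
  apply: content_sub_fsum.
  - exact: finite_fset.
  - by move=> x _; exact: (open_measurableR (fP x).1.1).
  - exact: measurable_itvR.
  - exact: cov.
rewrite fsbig_finite//=; apply: lte_sum_pinfty => i _; exact: (fP i).2.
Qed.

Lemma bmeasureU mu (A B : set R) : is_bmeasure mu -> bounded_borel A ->
  bounded_borel B -> A `&` B = set0 -> mu (A `|` B) = mu A + mu B.
Proof.
move=> [_ mu0 _ muU] bA bB AB0.
pose C n := bigcup2 A B n.
have CE : \bigcup_n C n = A `|` B by rewrite bigcup2E.
have : series (fun n => mu (C n)) n @[n --> \oo] --> mu (A `|` B).
  rewrite -CE; apply: muU.
  - by case=> [|[|n]] //=; exact: bounded_borel0.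
  - by rewrite -trivIset_bigcup2.
  - by rewrite CE; exact: bounded_borelU.
move=> /(cvg_lim (@Rhausdorff R)) <-; apply: cvg_lim; first exact: Rhausdorff.
rewrite -(cvg_shiftn 2); apply: cvg_near_cst; near=> n.
rewrite /series/= addn2 2?big_nat_recl//= big1 ?addr0// => i _.
Unshelve. all: by end_near. Qed.

Lemma bmeasure_itv_split mu a b c : is_bmeasure mu -> a <= b -> b <= c ->
  mu `[a, c]%classic = mu `[a, b]%classic + mu `[b, c]%classic.
Proof.
move=> bmu ab bc.
have s1 : `]b, c]%classic `<=` `[b, c]%classic.
  by move=> x/=; rewrite !in_itv/= => /andP[/ltW -> ->].
have -> : `[a, c]%classic = `[a, b]%classic `|` `]b, c]%classic.
  apply/seteqP; split=> x/=; rewrite !in_itv/=.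
    by move=> /andP[ax xc]; case: (leP x b) => xb; [left|right]; rewrite ?ax ?xb.
  by move=> [/andP[-> /le_trans]->//|/andP[/ltW/(le_trans ab)->]].
have -> : `[b, c]%classic = [set b] `|` `]b, c]%classic.
  apply/seteqP; split=> x/=; rewrite !in_itv/=.
    by rewrite le_eqVlt => /andP[/predU1P[->|bx ->]]; [left|right; rewrite bx].
  by move=> [->|/andP[/ltW -> ->//]]; rewrite lexx bc.
rewrite !bmeasureU//.
- by case: bmu => _ _ -> _; rewrite add0r.
- exact: (bounded_borel_itv (fun=> id)).
- exact: bounded_borel_itv s1.
- apply/seteqP; split=> x//= []; rewrite !in_itv/= => /andP[_ xb] /andP[bx _].
  by have := lt_le_trans bx xb; rewrite ltxx.
- by rewrite -set_itv1; exact: (bounded_borel_itv (fun=> id)).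
- exact: bounded_borel_itv s1.
- by apply/seteqP; split=> x//= [->]; rewrite in_itv/= ltxx.
Qed.

(** The primitive of an additive interval function, based at 0. It serves b-measures, measures and
    variations alike. *)
Definition cum (h : R -> R -> R) x : R := if 0 <= x then h 0 x else - h x 0.

Lemma cumE (h : R -> R -> R) a b : a <= b ->
  (forall a b c, a <= b -> b <= c -> h a c = h a b + h b c) ->
  h a b = cum h b - cum h a.
Proof.
move=> ab hD; rewrite /cum; have [a0|a0] := leP 0 a.
  by rewrite (le_trans a0 ab) (hD 0 a b)//; ring.
have [b0|b0] := leP 0 b; first by rewrite opprK (hD a 0 b) 1?addrC// ltW.
by rewrite (hD a b 0)// ?(ltW b0)//; ring.
Qed.

Lemma measure_itv_split m a b c : (forall t : R, m ([set t] : set R) = 0%E) -> a <= b -> b <= c ->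
  m `[a, c]%classic = (m `[a, b]%classic + m `[b, c]%classic)%E.
Proof.
move=> m0 ab bc.
have -> : `[a, c]%classic = `[a, b]%classic `|` `]b, c]%classic.
  apply/seteqP; split=> x/=; rewrite !in_itv/=.
    by move=> /andP[ax xc]; case: (leP x b) => xb; [left|right]; rewrite ?ax ?xb.
  by move=> [/andP[-> /le_trans]->//|/andP[/ltW/(le_trans ab)->]].
have -> : `[b, c]%classic = [set b] `|` `]b, c]%classic.
  apply/seteqP; split=> x/=; rewrite !in_itv/=.
    by rewrite le_eqVlt => /andP[/predU1P[->|bx ->]]; [left|right; rewrite bx].
  by move=> [->|/andP[/ltW -> ->//]]; rewrite lexx bc.
rewrite !measureU//.
- by have /= -> := m0 b; rewrite add0e.
- by apply/seteqP; split=> x//= [->]; rewrite in_itv/= ltxx.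
- apply/seteqP; split=> x//= []; rewrite !in_itv/= => /andP[_ xb] /andP[bx _].
  by have := lt_le_trans bx xb; rewrite ltxx.
Qed.

Lemma Mc_plus_cum m : Mc_plus m -> exists c : R -> R,
  [/\ continuous c, {homo c : x z / x <= z} &
      forall a b, a <= b -> m `[a, b]%classic = (c b - c a)%:E].
Proof.
move=> [lf _ m0].
have mfin a b : m `[a, b]%classic \is a fin_num.
  by rewrite ge0_fin_numE// Mc_plus_itv_fin.
pose c := cum (fun x z => fine (m `[x, z]%classic)).
have mE a b : a <= b -> m `[a, b]%classic = (c b - c a)%:E.
  move=> ab; rewrite -(cumE (h := fun x z => fine (m `[x, z]%classic)) ab) ?fineK//.
  by move=> a' b' c' ab' bc'; rewrite -fineD//= (measure_itv_split m0 ab' bc').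
have ndc : {homo c : x z / x <= z}.
  by move=> x z xz; rewrite -subr_ge0 -lee_fin -mE.
exists c; split => //.
suff H (x e : R) : 0 < e -> \forall t \near x, `|c x - c t| <= e.
  by move=> x; apply/cvgrPdist_le => e; exact: H.
(* Continuity from above along closed intervals shrinking to [x]: the absence of atoms is the
   continuity of the primitive. *)
move=> e0; pose A n : set R := `[x - n.+1%:R^-1, x + n.+1%:R^-1]%classic.
have Acap : \bigcap_n A n = [set x].
  apply/seteqP; split=> [t At/=|t -> n _]; last first.
    by rewrite /A/= in_itv/=; apply/andP; split; rewrite ?gerBl ?lerDl.
  apply/eqP; rewrite -subr_eq0 -normr_le0; apply/ler_addgt0Pr => r r0; rewrite add0r.
  have := At (Num.truncn r^-1) I; rewrite /A/= in_itv/= -ler_distl.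
  move=> /le_trans; apply; rewrite -[leRHS]invrK lef_pV2 ?posrE ?invr_gt0//.
  exact/ltW/truncnS_gt.
have : m \o A @ \oo --> m (\bigcap_n A n).
  apply: nonincreasing_cvg_mu.
  - exact: Mc_plus_itv_fin.
  - by move=> i; exact: measurable_itvR.
  - by rewrite Acap -set_itv1; exact: measurable_itvR.
  - move=> i j ij.
    suff h (t : R) : A j t -> A i t by apply/subsetPset => t; exact: h.
    rewrite /A/= !in_itv/=.
    have : j.+1%:R^-1 <= i.+1%:R^-1 :> R by rewrite lef_pV2 ?posrE// ler_nat.
    move: (j.+1%:R^-1) (i.+1%:R^-1) => p q pq /andP[h1 h2].
    by apply/andP; split; lra.
rewrite Acap m0 => /fine_cvgP[_] /cvgrPdist_le/(_ _ e0)[n _ /(_ n (leqnn n))].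
rewrite /= sub0r normrN => An.
have [p p0 pE] : exists2 p : R, 0 < p & p = n.+1%:R^-1 by exists n.+1%:R^-1.
rewrite /A -pE in An.
suff H (t : R) : `|x - t| <= p -> `|c x - c t| <= e.
  by apply/nbhs_normP; exists p => // t /= /ltW; exact: H.
rewrite ler_distl => /andP[h1 h2].
have := An; rewrite mE/=; last lra.
rewrite ler_norml => /andP[_ h].
have c1 : c t <= c (x + p) by apply: ndc; lra.
have c2 : c x <= c (x + p) by apply: ndc; lra.
have c3 : c (x - p) <= c t by apply: ndc; lra.
have c4 : c (x - p) <= c x by apply: ndc; lra.
rewrite ler_norml; apply/andP; split; lra.
Qed.

Lemma le_total_variation mu (A : set R) : bounded_borel A ->
  ((`|mu A|%R)%:E <= Defs.total_variation mu A)%E.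
Proof.
move=> bA; apply: ereal_sup_ubound; exists 1%N, (fun=> A); split.
  split=> //; first by move=> i j _ _ _; rewrite [i]ord1 [j]ord1.
  by apply/seteqP; split=> x => [[]//|Ax]; exists ord0.
by rewrite big_ord1.
Qed.

End MeasureCumulative.

(** * Gronwall estimates and solutions *)

Section RowVectors.
Variables (R : realType) (N : nat).
Local Notation V := 'rV[R]_N.
Implicit Types (v w : V) (J e : R).

Lemma rV_norm_le v e : 0 <= e -> (forall i, `|v 0 i| <= e) -> `|v| <= e.
Proof.
move=> e0 ve; rewrite [leLHS]/Num.Def.normr/= mx_normrE.
by apply: bigmax_le => // -[i j] _ /=; rewrite [i]ord1.
Qed.

Lemma rV_coord_le v i : `|v 0 i| <= `|v|.
Proof.
rewrite [leRHS]/Num.Def.normr/= mx_normrE.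
exact: (le_bigmax _ (fun ij => `|v ij.1 ij.2|) (0, i)).
Qed.

Definition clip J v : V := \row_i Num.max (- J) (Num.min J (v 0 i)).

Lemma clip_norm J v : 0 <= J -> `|clip J v| <= J.
Proof.
move=> J0; apply: rV_norm_le => // i; rewrite mxE ler_norml.
by rewrite le_max lexx /= ge_max ge_min lexx andbT; lra.
Qed.

Lemma clip_id J v : `|v| <= J -> clip J v = v.
Proof.
move=> vJ; apply/rowP => i; rewrite mxE.
have := le_trans (rV_coord_le v i) vJ; rewrite ler_norml => /andP[h1 h2].
by rewrite min_r// max_r.
Qed.

(** The ball of the maximum norm is a cube, so the retraction acts on each coordinate separately.
    The constant 1 matters: it keeps a clipped curve within the same modulus [th], hence in
    [Kset]. *)
Lemma clip_lip J v w : `|clip J v - clip J w| <= `|v - w|.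
Proof.
apply: rV_norm_le => // i; rewrite !mxE.
apply: le_trans (rV_coord_le (v - w) i); rewrite !mxE.
move: (v 0 i) (w 0 i) => a b.
have H x y : x <= y -> 0 <= Num.max (- J) (Num.min J y) - Num.max (- J) (Num.min J x) <= y - x.
  move=> xy; case: (leP J x) => ?; case: (leP J y) => ?.
  - by apply/andP; split; lra.
  - by apply/andP; split; lra.
  - by case: (leP (- J) J) => ?; case: (leP (- J) x) => ?; apply/andP; split; lra.
  - by case: (leP (- J) y) => ?; case: (leP (- J) x) => ?; apply/andP; split; lra.
have [ab|/ltW ba] := leP a b.
  by have /andP[h1 h2] := H _ _ ab; rewrite distrC ger0_norm// distrC ger0_norm// subr_ge0.
by have /andP[h1 h2] := H _ _ ba; rewrite ger0_norm// ger0_norm// subr_ge0.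
Qed.

Lemma within_ucont (y : R -> V) (a b : R) :
  {within `[a, b], continuous y} -> ucont y a b.
Proof.
move=> yc e e0; have e20 : 0 < e / 2 by lra.
have /compact_near_coveringP := @segment_compact R a b.
pose P (d s : R) := forall t, a <= s <= b -> a <= t <= b -> `|s - t| < d ->
  `|y s - y t| <= e.
move=> cov; have H : \forall d \near 0^'+, `[a, b]%classic `<=` P d.
  apply: cov => x xab.
  have xc := (subspace_continuousP _ _).1 yc x xab.
  have /cvgrPdist_le/(_ _ e20) := xc.
  rewrite near_withinE => /nbhs_normP[d /= d0 xd].
  have d20 : 0 < d / 2 by lra.
  exists ([set x' | `|x - x'| < d / 2], [set r | r < d / 2]); first split => /=.
  - by apply/nbhs_normP; exists (d / 2).
  - exact: nbhs_right_lt.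
  move=> [x' r] /= [xx' rd] t x'ab tab x't.
  have h1 : `|y x - y x'| <= e / 2 by apply: xd => //=; lra.
  have h2 : `|y x - y t| <= e / 2.
    apply: xd => //=; rewrite -(subrKA x'); apply: le_lt_trans (ler_normD _ _) _; lra.
  rewrite -(subrKA (y x)); apply: le_trans (ler_normD _ _) _; rewrite distrC; lra.
have [d [d0 dP]] := filter_ex (filterI (nbhs_right_gt (0 : R)) H).
by exists d => // s t sab tab; exact: dP.
Qed.

Lemma ucont_within (y : R -> V) (a b : R) :
  ucont y a b -> {within `[a, b], continuous y}.
Proof.
move=> yu; apply/subspace_continuousP => x xab.
apply/cvgrPdist_le => e e0; have [d d0 yd] := yu e e0.
rewrite near_withinE; apply/nbhs_normP; exists d => // t xt tab.
by apply: yd.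
Qed.

Lemma within_bounded (y : R -> V) (a b : R) :
  {within `[a, b], continuous y} -> exists j : nat, (0 < j)%N /\ bounded_on y a b j%:R.
Proof.
move=> yc; have [ab|ba] := leP a b; last first.
  by exists 1%N; split => // t /andP[h1 h2]; have := le_trans h1 h2; rewrite leNgt ba.
have := continuous_compact yc (@segment_compact R a b).
move=> /compact_bounded[M [Mr yM]].
exists (Num.truncn (Num.max M 0)).+1; split => // t tab.
apply: (yM _ _ (y t)); last by exists t.
by apply: le_lt_trans (truncnS_gt _); rewrite le_max lexx.
Qed.

End RowVectors.

(** * The bounds of a field on a ball, as functions of time *)

Section FieldBounds.
Variables (R : realType) (N : nat).
Local Notation V := 'rV[R]_N.

Definition Mp_cum (nu : Mp R N) : V -> R -> R := fun v => cum (fun a b => nu v `[a, b]%classic).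

Lemma cum_of_Mp (nu : Mp R N) : cum_of nu (Mp_cum nu).
Proof.
move=> v a b ab; rewrite /Mp_cum.
rewrite -(cumE (h := fun a b => nu v `[a, b]%classic))// => a' b' c' ab' bc'.
by apply: bmeasure_itv_split => //; have [] := MpP nu.
Qed.

Lemma inc_Mp (nu : Mp R N) v a b : a <= b ->
  inc (Mp_cum nu) v a b = nu v `[a, b]%classic.
Proof. by move=> ab; rewrite /inc -cum_of_Mp. Qed.

(** Only increments of the bounding measures enter the analysis, so they are kept as primitives. [m]
    and [l] belong to one field and one ball; [Mp_field] provides them without uniformity between
    fields. *)
Record field_bounds (nu : MpN R N) (J : R) (m l : R -> R) : Prop := FieldBounds {
  fb_cont : continuous m ;
  fb_ndm : {homo m : x z / x <= z} ;
  fb_ndl : {homo l : x z / x <= z} ;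
  fb_m : forall i v a b, `|v| <= J -> a <= b ->
           `|inc (Mp_cum (nu i)) v a b| <= m b - m a ;
  fb_l : forall i, lip_inc (Mp_cum (nu i)) J l }.

Lemma m_bound_inc (nu : Mp R N) j (m : {measure set (measurableTypeR R) -> \bar R}) v a b :
  is_m_bound nu j m -> `|v| <= j%:R -> a <= b ->
  (`|inc (Mp_cum nu) v a b|%:E <= m `[a, b]%classic)%E.
Proof.
move=> [_ mP] vj ab; rewrite inc_Mp//.
have bab := bounded_borel_itv (fun x (h : `[a, b]%classic x) => h).
exact: le_trans (le_total_variation _ bab) (mP _ _ bab vj).
Qed.

Lemma l_bound_inc (nu : Mp R N) j (l : {measure set (measurableTypeR R) -> \bar R}) v w a b :
  is_l_bound nu j l -> `|v| <= j%:R -> `|w| <= j%:R -> a <= b ->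
  (`|inc (Mp_cum nu) v a b - inc (Mp_cum nu) w a b|%:E
     <= l `[a, b]%classic * `|v - w|%:E)%E.
Proof.
move=> [_ lP] vj wj ab; rewrite !inc_Mp//.
have bab := bounded_borel_itv (fun x (h : `[a, b]%classic x) => h).
by apply: le_trans (lP _ _ _ bab vj wj); exact: (le_total_variation (fun B => nu v B - nu w B)).
Qed.

Lemma Mp_field1 (nu : Mp R N) (j : nat) : (0 < j)%N -> exists ml : (R -> R) * (R -> R),
  [/\ continuous ml.1, {homo ml.1 : x z / x <= z}, {homo ml.2 : x z / x <= z},
   forall v a b, `|v| <= j%:R -> a <= b ->
         `|inc (Mp_cum nu) v a b| <= ml.1 b - ml.1 a &
   lip_inc (Mp_cum nu) j%:R ml.2].
Proof.
move=> j0; have [_ /(_ j j0)[[m mP] [l lP]]] := MpP nu.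
have [cm [cm1 cm2 cm3]] := Mc_plus_cum mP.1.
have [cl [_ cl2 cl3]] := Mc_plus_cum lP.1.
exists (cm, cl); split => //=.
  by move=> v a b vj ab; rewrite -lee_fin -cm3//; exact: m_bound_inc mP _ _.
by move=> v w a b vj wj ab; rewrite -lee_fin EFinM -cl3//; exact: l_bound_inc lP _ _ _.
Qed.

Lemma Mp_field (nu : MpN R N) (j : nat) : (0 < j)%N ->
  exists m l, field_bounds nu j%:R m l.
Proof.
move=> j0; have /choice[ml mlP] := fun i => Mp_field1 (nu i) j0.
exists (fun x => \sum_i (ml i).1 x), (fun x => \sum_i (ml i).2 x); split.
- move=> x; apply: cvg_big => // [|i _]; last by have [+ _ _ _ _] := mlP i; exact.
  by move=> /= p; exact: add_continuous.
- by move=> x z xz; apply: ler_sum => i _; have [_ + _ _ _] := mlP i; exact.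
- by move=> x z xz; apply: ler_sum => i _; have [_ _ + _ _] := mlP i; exact.
- move=> i v a b vj ab; rewrite -sumrB (bigD1 i)//=.
  have [_ _ _ /(_ v a b vj ab) h _] := mlP i.
  rewrite (le_trans h)// lerDl sumr_ge0// => k _.
  by rewrite subr_ge0; have [_ + _ _ _] := mlP k; exact.
- move=> i v w a b vj wj ab; rewrite -sumrB (bigD1 i)//=.
  have [_ _ _ _ /(_ v w a b vj wj ab) h] := mlP i.
  rewrite (le_trans h)// ler_wpM2r// lerDl sumr_ge0// => k _.
  by rewrite subr_ge0; have [_ _ + _ _] := mlP k; exact.
Qed.

End FieldBounds.

(** * Vector integrals and Gronwall's inequality *)

Section VectorIntegral.
Variables (R : realType) (N : nat).
Local Notation V := 'rV[R]_N.
Variables (nu : MpN R N) (J : R) (m l : R -> R).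
Hypothesis fb : field_bounds nu J m l.
Implicit Types (f g y : R -> V) (K p q s t a b c : R).
Local Notation vint := (integral_MpN nu).

Let nuF i := cum_of_Mp (nu i).
Let ndl := fb_ndl fb.
Let lipF i := fb_l fb i.

Lemma vint_refl y a : `|y a| <= J -> vint y a a = 0.
Proof. by move=> yJ; apply/rowP => i; rewrite !mxE; exact: int_refl (nuF i) ndl (lipF i) _ _ yJ. Qed.

Lemma vint_rev y p q a b : tame J y p q -> p <= a <= q -> p <= b <= q ->
  vint y a b = - vint y b a.
Proof.
move=> [_ yJ] pa pb; apply/rowP => i; rewrite !mxE.
apply: (int_rev (nuF i) ndl (lipF i)); apply: bounded_on_sub yJ.
  by rewrite le_min; case/andP: pa => ->; case/andP: pb => ->.
by rewrite ge_max; case/andP: pa => _ ->; case/andP: pb => _ ->.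
Qed.

Lemma vint_cat y p q a b c : tame J y p q ->
  p <= a <= q -> p <= b <= q -> p <= c <= q ->
  vint y a c = vint y a b + vint y b c.
Proof.
move=> yt a1 b1 c1; apply/rowP => i.
have rev x z (x1 : p <= x <= q) (z1 : p <= z <= q) :
    integral_Mp (nu i) y x z = - integral_Mp (nu i) y z x.
  by have := vint_rev yt x1 z1; move/rowP/(_ i); rewrite !mxE.
have ra := rev a _ a1; have rb := rev b _ b1; have rc := rev c _ c1.
case/andP: (a1) => pa aq; case/andP: (b1) => pb bq; case/andP: (c1) => pc cq.
have C x z t : p <= x -> x <= z -> z <= t -> t <= q ->
    integral_Mp (nu i) y x t = integral_Mp (nu i) y x z + integral_Mp (nu i) y z t.
  move=> px xz zt tq.
  by apply: (int_cat (nuF i) ndl (lipF i)) => //; exact: tame_sub yt.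
rewrite !mxE.
have [ab|/ltW ba] := leP a b; have [bc|/ltW cb] := leP b c.
- exact: C.
- have [ac|/ltW ca] := leP a c.
  + by rewrite (rb c)// (C a c b)//; ring.
  + by rewrite (ra c)// (rb c)// (C c a b)//; ring.
- have [ac|/ltW ca] := leP a c.
  + by rewrite (ra b)// (C b a c)//; ring.
  + by rewrite (ra c)// (ra b)// (C b c a)//; ring.
- by rewrite (ra c)// (ra b)// (rb c)// (C c b a)//; ring.
Qed.

Lemma vint_norm_le y a b : a <= b -> tame J y a b ->
  `|vint y a b| <= m b - m a.
Proof.
move=> ab yt; apply: rV_norm_le => [|i]; first by rewrite subr_ge0; exact: fb_ndm fb _ _ ab.
rewrite mxE; apply: (int_le_csum (nuF i) ndl (lipF i) ab yt) => s Ps.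
rewrite (le_trans (ler_norm_csum _ _ _))//.
apply: csum_le_telescope Ps => v x z _ xz _ vJ; exact: fb_m fb _ _ _ _ vJ xz.
Qed.

Lemma vint_cat0 y p q s t : tame J y p q -> p <= 0 <= q -> p <= s -> s <= t -> t <= q ->
  vint y 0 t - vint y 0 s = vint y s t.
Proof.
move=> yt p0 ps st tq; rewrite (@vint_cat y p q 0 s t) ?ps//= ?(le_trans st)//.
- by rewrite addrC addKr.
- by rewrite (le_trans ps).
Qed.

(* The absolute value lets one weight serve on both sides of the initial time. *)
Definition gweight t := expR (2 * `|l t - l 0|).

Lemma gweight_ge1 t : 1 <= gweight t.
Proof. by rewrite -expR0 ler_expR mulr_ge0. Qed.

(** The 2 in the exponent of [gweight] produces the factor 1/2 here, so integration is a contraction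
    for the weighted norm on every time interval, however long. *)
Lemma vint_diff_weight f g K t : 0 <= K ->
  tame J f (Num.min 0 t) (Num.max 0 t) -> tame J g (Num.min 0 t) (Num.max 0 t) ->
  (forall s, Num.min 0 t <= s <= Num.max 0 t -> `|f s - g s| <= K * gweight s) ->
  `|vint f 0 t - vint g 0 t| <= K / 2 * (gweight t - 1).
Proof.
move=> K0; have [t0|/ltW t0] := leP 0 t => ft gt fg; apply: rV_norm_le.
- by rewrite mulr_ge0 ?subr_ge0 ?gweight_ge1// divr_ge0.
- move=> i; rewrite !mxE.
  have w s : 0 <= s -> gweight s = expR (- (2 * l 0)) * expR (2 * l s).
    move=> s0; rewrite /gweight ger0_norm ?subr_ge0 ?ndl// -expRD.
    by congr expR; ring.
  have := int_diff_exp (nuF i) ndl (lipF i) t0 ft gt (K := K * expR (- (2 * l 0))).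
  rewrite mulr_ge0 ?expR_ge0// => /(_ isT) H.
  apply: le_trans (H _) _ => [s /[dup] /andP[s0 _] /fg|].
    by rewrite w// mulrA.
  rewrite w// le_eqVlt; apply/orP; left; apply/eqP.
  have e0 : expR (- (2 * l 0)) * expR (2 * l 0) = 1 by rewrite -expRD addNr expR0.
  transitivity (K / 2 * (expR (- (2 * l 0)) * expR (2 * l t) -
    expR (- (2 * l 0)) * expR (2 * l 0))); last by rewrite e0.
  by field.
- by rewrite mulr_ge0 ?subr_ge0 ?gweight_ge1// divr_ge0.
- move=> i; rewrite !mxE.
  have w s : s <= 0 -> gweight s = expR (2 * l 0) * expR (- (2 * l s)).
    move=> s0; rewrite /gweight distrC ger0_norm ?subr_ge0 ?ndl// -expRD.
    by congr expR; ring.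
  have := int_diff_expN (nuF i) ndl (lipF i) t0 ft gt (K := K * expR (2 * l 0)).
  rewrite mulr_ge0 ?expR_ge0// => /(_ isT) H.
  have tt : t <= t <= 0 by rewrite lexx t0.
  have zz : t <= 0 <= (0 : R) by apply/andP; split.
  have := vint_rev ft zz tt; move/rowP/(_ i); rewrite !mxE => ->.
  have := vint_rev gt zz tt; move/rowP/(_ i); rewrite !mxE => ->.
  rewrite -opprD normrN.
  apply: le_trans (H _) _ => [s /[dup] /andP[_ s0] /fg|].
    by rewrite w// mulrA.
  rewrite w// le_eqVlt; apply/orP; left; apply/eqP.
  have e0 : expR (2 * l 0) * expR (- (2 * l 0)) = 1 by rewrite -expRD addrN expR0.
  transitivity (K / 2 * (expR (2 * l 0) * expR (- (2 * l t)) -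
    expR (2 * l 0) * expR (- (2 * l 0)))); last by rewrite e0.
  by field.
Qed.

(** The supremum [S] of the difference divided by the weight is finite and satisfies
    [S <= K + S / 2], whence [S <= 2 * K]. *)
Lemma vint_gronwall f g K p q : p <= 0 <= q -> 0 <= J -> 0 <= K ->
  tame J f p q -> tame J g p q ->
  (forall t, p <= t <= q -> `|f t - g t| <= K + `|vint f 0 t - vint g 0 t|) ->
  forall t, p <= t <= q -> `|f t - g t| <= 2 * K * gweight t.
Proof.
move=> p0q J0 K0 ft gt fg.
have w0 t : 0 < gweight t by exact: lt_le_trans (gweight_ge1 t).
pose S : set R := [set `|f t - g t| / gweight t | t in `[p, q]%classic].
have S0 : S !=set0 by exists (`|f 0 - g 0| / gweight 0), 0.
have ubS : has_ubound S.
  exists (2 * J) => _ [t tpq <-]; rewrite ler_pdivrMr//.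
  apply: le_trans (_ : 2 * J <= _); last by rewrite ler_peMr ?gweight_ge1// mulr_ge0.
  rewrite (le_trans (ler_normB _ _))//.
  by have := ft.2 _ tpq; have := gt.2 _ tpq; lra.
have fgS t : p <= t <= q -> `|f t - g t| <= sup S * gweight t.
  by move=> tpq; rewrite -ler_pdivrMr//; apply: ub_le_sup => //; exists t.
have supS0 : 0 <= sup S.
  apply: le_trans (_ : `|f 0 - g 0| / gweight 0 <= _); first by rewrite divr_ge0// ltW.
  by apply: ub_le_sup => //; exists 0.
have : sup S <= K + sup S / 2.
  apply: ge_sup => // _ [t /= tpq <-]; rewrite ler_pdivrMr//.
  move: (tpq); rewrite in_itv/= => tpq'.
  have /andP[pt tq] := tpq'; have /andP[p0 q0] := p0q.
  have pm : p <= Num.min 0 t by rewrite le_min p0 pt.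
  have qM : Num.max 0 t <= q by rewrite ge_max q0 tq.
  apply: le_trans (fg _ tpq') _.
  have := @vint_diff_weight f g (sup S) t supS0 (tame_sub pm qM ft) (tame_sub pm qM gt).
  move=> /(_ _) h; have {}h := h _.
  apply: (@le_trans _ _ (K + sup S / 2 * (gweight t - 1))).
    rewrite lerD2l; apply: h => s /andP[s1 s2]; apply: fgS.
    by rewrite (le_trans pm s1) (le_trans s2 qM).
  have := gweight_ge1 t; move: (gweight t) => w w1.
  have : K <= K * w by rewrite ler_peMr.
  by rewrite mulrDl; lra.
move=> SK t tpq; apply: le_trans (fgS t tpq) _.
by apply: ler_wpM2r; [exact: ltW|lra].
Qed.

End VectorIntegral.

(** The limit is the common point of the nested intervals of radius [2 * c / 2 ^+ n] about [x n]. *)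
Lemma geometric_limit (R : realType) (x : nat -> R) (c : R) : 0 <= c ->
  (forall n, `|x n.+1 - x n| <= c / 2 ^+ n) ->
  exists L, forall n, `|x n - L| <= 2 * c / 2 ^+ n.
Proof.
move=> c0 xc.
have p0 n : 0 < 2 ^+ n :> R by exact: exprn_gt0.
pose lo n := x n - 2 * c / 2 ^+ n; pose hi n := x n + 2 * c / 2 ^+ n.
have cS n : c / 2 ^+ n.+1 = c / 2 ^+ n / 2.
  by rewrite exprS; field; rewrite gt_eqF.
have loS n : lo n <= lo n.+1.
  have := xc n; rewrite /lo ler_norml => /andP[h _].
  by rewrite -!mulrA cS; lra.
have hiS n : hi n.+1 <= hi n.
  have := xc n; rewrite /hi ler_norml => /andP[_ h].
  by rewrite -!mulrA cS; lra.
have lo_nd : {homo lo : n k / (n <= k)%N >-> n <= k} by exact: homo_leq le_trans loS.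
have hi_ni : {homo hi : n k / (n <= k)%N >-> k <= n}.
  by apply: homo_leq => // a b d h1 h2; exact: le_trans h2 h1.
have lohi n k : lo n <= hi k.
  have e0 i : 0 <= 2 * c / 2 ^+ i by rewrite divr_ge0 ?mulr_ge0// ltW.
  have := lo_nd n (maxn n k) (leq_maxl _ _); have := hi_ni k (maxn n k) (leq_maxr _ _).
  by rewrite /lo /hi; have := e0 (maxn n k); lra.
have hs : has_sup (range lo).
  by split; [exists (lo 0%N), 0%N|exists (hi 0%N) => _ [n _ <-]].
exists (sup (range lo)) => n.
have h1 : lo n <= sup (range lo) by apply: ub_le_sup; [case: hs|exists n].
have h2 : sup (range lo) <= hi n by apply: ge_sup; [case: hs|move=> _ [k _ <-]].
by move: h1 h2; rewrite /lo /hi ler_norml => h1 h2; apply/andP; split; lra.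
Qed.

Lemma geometric_small (R : realType) (x c : R) :
  (forall n, x <= c / 2 ^+ n) -> x <= 0.
Proof.
move=> xc; apply/ler_addgt0Pr => e e0; rewrite add0r.
pose n := Num.truncn (c / e).
apply: le_trans (xc n) _; rewrite ler_pdivrMr ?exprn_gt0// -ler_pdivrMl// mulrC.
apply: le_trans (ltW (truncnS_gt _)) _; rewrite -/n -natrX ler_nat.
exact: ltn_expl.
Qed.

(** * Picard iteration for the clipped equation *)

Section Picard.
Variables (R : realType) (N : nat).
Local Notation V := 'rV[R]_N.
Variables (nu : MpN R N) (J : R) (m l : R -> R).
Hypotheses (fb : field_bounds nu J m l) (J0 : 0 <= J).
Variable y0 : V.
Implicit Types (f g y : R -> V) (K p q s t a b c : R).
Local Notation vint := (integral_MpN nu).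

Definition modulus_le y := forall s t, s <= t -> `|y t - y s| <= m t - m s.

Lemma modulus_ucont y a b : modulus_le y -> ucont y a b.
Proof.
move=> ym; apply: within_ucont; apply: continuous_subspaceT => x.
apply/cvgrPdist_le => e e0.
have /cvgrPdist_le/(_ _ e0) := fb_cont fb (x := x).
apply: filterS => t; apply: le_trans.
have [xt|/ltW tx] := leP x t.
  by rewrite distrC (le_trans (ym _ _ xt))// distrC ler_norm.
by rewrite (le_trans (ym _ _ tx))// ler_norm.
Qed.

Lemma clip_tame y a b : ucont y a b -> tame J (clip J \o y) a b.
Proof.
move=> yu; split=> [e e0|t _]; last exact: clip_norm.
have [d d0 yd] := yu e e0; exists d => // s t sab tab st.
by rewrite (le_trans (clip_lip _ _ _))// yd.
Qed.

Definition picard y t := y0 + vint (clip J \o y) 0 t.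

Lemma picard_modulus y : (forall a b, ucont y a b) -> modulus_le (picard y).
Proof.
move=> yu s t st; rewrite /picard opprD addrACA subrr add0r.
have yt := clip_tame (yu (Num.min 0 s) (Num.max 0 t)).
rewrite (vint_cat0 fb yt) ?ge_min ?le_max ?lexx ?orbT//.
by apply: (vint_norm_le fb) => //; exact: clip_tame.
Qed.

Lemma picard_contract f g K t : 0 <= K ->
  (forall a b, ucont f a b) -> (forall a b, ucont g a b) ->
  (forall s, `|s| <= `|t| -> `|f s - g s| <= K * gweight l s) ->
  `|picard f t - picard g t| <= K / 2 * gweight l t.
Proof.
move=> K0 fu gu fg; rewrite /picard opprD addrACA subrr add0r.
have := vint_diff_weight fb (f := clip J \o f) (g := clip J \o g) (t := t) K0
  (clip_tame (fu _ _)) (clip_tame (gu _ _)).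
move=> H; apply: le_trans (H _) _ => [s st|]; last first.
  by rewrite ler_wpM2l ?divr_ge0// gerBl.
rewrite (le_trans (clip_lip _ _ _))// fg//.
move: st; have [t0|t0] := leP 0 t => /andP[s0 s1].
  by rewrite !ger0_norm.
by rewrite !ler0_norm ?lerN2// ltW.
Qed.

Definition picard_iter n := iter n picard (fun=> y0).

Lemma picard_iter_ucont n a b : ucont (picard_iter n) a b.
Proof.
elim: n a b => [|n IH] a b.
  by move=> e e0; exists 1 => // s t _ _ _; rewrite /picard_iter/= subrr normr0 ltW.
by apply: modulus_ucont; exact: picard_modulus.
Qed.

(** A bound for the first iteration step. Being nondecreasing in [|t|], it can be treated as a
    constant for all [s] with [|s| <= |t|], so the iteration converges on the whole line without a
    global bound on [m]. *)
Let C t := m `|t| - m (- `|t|).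

Let C_ge0 t : 0 <= C t.
Proof. by rewrite subr_ge0; apply: (fb_ndm fb); rewrite ge0_cp. Qed.

Let C_le s t : `|s| <= `|t| -> C s <= C t.
Proof. by move=> st; apply: lerB; apply: (fb_ndm fb) => //; rewrite lerN2. Qed.

Lemma picard_iter_step n t :
  `|picard_iter n.+1 t - picard_iter n t| <= C t / 2 ^+ n * gweight l t.
Proof.
elim: n t => [|n IH] t.
  rewrite expr0 divr1 /picard_iter/= /picard addrC addKr.
  apply: (@le_trans _ _ (C t)); last by rewrite ler_peMr ?gweight_ge1.
  have yt a b : tame J (clip J \o (fun=> y0)) a b by apply: clip_tame; exact: (picard_iter_ucont 0).
  have [t0|/ltW t0] := leP 0 t.
    apply: le_trans (vint_norm_le fb t0 (yt _ _)) _.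
    by rewrite /C ger0_norm// lerB//; apply: (fb_ndm fb); rewrite oppr_le0.
  rewrite (vint_rev fb (yt t 0)) ?lexx ?t0// normrN.
  apply: le_trans (vint_norm_le fb t0 (yt _ _)) _.
  by rewrite /C ler0_norm// opprK lerB//; apply: (fb_ndm fb); rewrite oppr_ge0.
have -> : C t / 2 ^+ n.+1 = C t / 2 ^+ n / 2.
  by rewrite exprS; field; rewrite gt_eqF// exprn_gt0.
apply: (@picard_contract (picard_iter n.+1) (picard_iter n)).
- by rewrite divr_ge0// exprn_ge0.
- exact: picard_iter_ucont.
- exact: picard_iter_ucont.
- move=> s st; apply: le_trans (IH s) _; apply: ler_wpM2r.
    by rewrite (le_trans _ (gweight_ge1 _ _)).
  by rewrite ler_pM2r ?invr_gt0 ?exprn_gt0// C_le.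
Qed.

(** Clipping makes the bounds of one ball valid for all arguments, and the weight absorbs the length
    of time; hence the solution is global. *)
Lemma exists_clipped_solution : exists y : R -> V, [/\ modulus_le y, y 0 = y0 &
  forall t, y t = y0 + vint (clip J \o y) 0 t].
Proof.
have w0 t : 0 <= gweight l t by exact: le_trans (gweight_ge1 l t).
have /choice[y yP] : forall t, exists v : V, forall n,
    `|picard_iter n t - v| <= 2 * C t / 2 ^+ n * gweight l t.
  move=> t.
  have /choice[v vP] : forall i, exists L : R, forall n,
      `|picard_iter n t 0 i - L| <= 2 * (C t * gweight l t) / 2 ^+ n.
    move=> i; apply: geometric_limit; first by rewrite mulr_ge0.
    move=> n; have := rV_coord_le (picard_iter n.+1 t - picard_iter n t) i.
    rewrite !mxE => /le_trans; apply; apply: le_trans (picard_iter_step n t) _.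
    by rewrite mulrAC.
  exists (\row_i v i) => n; apply: rV_norm_le.
    by rewrite mulr_ge0// divr_ge0 ?exprn_ge0// mulr_ge0.
  move=> i; rewrite !mxE; apply: le_trans (vP i n) _.
  by rewrite mulrA mulrAC.
(* The modulus has to come first: it makes [y] uniformly continuous, which [picard_contract] demands
   of its arguments. *)
have ym : modulus_le y.
  move=> s t st; rewrite -subr_le0.
  apply: (@geometric_small _ _ (C t * gweight l t + C s * gweight l s)) => n.
  rewrite lerBlDl.
  have h1 := yP t n.+1; have h2 := yP s n.+1.
  have h3 : `|picard_iter n.+1 t - picard_iter n.+1 s| <= m t - m s.
    exact: (picard_modulus (picard_iter_ucont n)).
  have -> : y t - y s = (picard_iter n.+1 t - picard_iter n.+1 s)
      - (picard_iter n.+1 t - y t) + (picard_iter n.+1 s - y s).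
    by rewrite opprB (addrC (_ - _) (y t - _)) !subrKA.
  have e2 (x w : R) : 2 * x / 2 ^+ n.+1 * w = x * w / 2 ^+ n.
    by rewrite exprS; field; rewrite gt_eqF// exprn_gt0.
  move: h1 h2; rewrite !e2 mulrDl => h1 h2.
  rewrite (le_trans (ler_normD _ _))//.
  have := ler_normB (picard_iter n.+1 t - picard_iter n.+1 s) (picard_iter n.+1 t - y t).
  lra.
have yu a b : ucont y a b by exact: modulus_ucont.
have yE t : y t = picard y t.
  apply/eqP; rewrite -subr_eq0 -normr_le0.
  apply: (@geometric_small _ _ (2 * C t * gweight l t)) => n.
  rewrite -(subrKA (picard_iter n.+1 t)).
  rewrite (le_trans (ler_normD _ _))// distrC.
  have h1 := yP t n.+1.
  have h2 : `|picard_iter n.+1 t - picard y t| <= 2 * C t / 2 ^+ n / 2 * gweight l t.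
    apply: (@picard_contract (picard_iter n) y) => //.
    - by rewrite divr_ge0 ?exprn_ge0// mulr_ge0.
    - exact: picard_iter_ucont.
    - move=> s st; apply: le_trans (yP s n) _; apply: ler_wpM2r => //.
      rewrite ler_pM2r ?invr_gt0 ?exprn_gt0//.
      by rewrite ler_pM2l// C_le.
  have e1 : 2 * C t / 2 ^+ n.+1 * gweight l t = C t * gweight l t / 2 ^+ n.
    by rewrite exprS; field; rewrite gt_eqF// exprn_gt0.
  have e2 : 2 * C t / 2 ^+ n / 2 * gweight l t = C t * gweight l t / 2 ^+ n.
    by field; rewrite gt_eqF// exprn_gt0.
  have e3 : 2 * C t * gweight l t / 2 ^+ n = 2 * (C t * gweight l t / 2 ^+ n).
    by rewrite !mulrA.
  by move: h1 h2; rewrite e1 e2 e3; lra.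
exists y; split => //.
rewrite yE /picard (vint_refl fb) ?addr0//; exact: clip_norm.
Qed.

End Picard.

Lemma tameS (R : realType) (N : nat) (J J' : R) (y : R -> 'rV[R]_N) a b :
  J <= J' -> tame J y a b -> tame J' y a b.
Proof. by move=> JJ [yu yJ]; split=> // t /yJ /le_trans; exact. Qed.

(** * Uniqueness, continuation and maximal solutions *)

Section Solutions.
Variables (R : realType) (N : nat).
Local Notation V := 'rV[R]_N.
Implicit Types (nu : MpN R N) (f g y : R -> V) (a b c s t J : R).
Implicit Types (p q : set R * (R -> V)).

Lemma vint_eq nu j f g t : (0 < j)%N ->
  tame j%:R f (Num.min 0 t) (Num.max 0 t) -> tame j%:R g (Num.min 0 t) (Num.max 0 t) ->
  (forall s, Num.min 0 t <= s <= Num.max 0 t -> f s = g s) ->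
  integral_MpN nu f 0 t = integral_MpN nu g 0 t.
Proof.
move=> j0 ft gt fg; have [m [l fb]] := Mp_field nu j0.
apply/eqP; rewrite -subr_eq0 -normr_le0.
have := vint_diff_weight fb (lexx 0) ft gt; rewrite !mul0r; apply.
by move=> s /fg ->; rewrite subrr normr0 mul0r.
Qed.

Lemma minmax_in (I : set R) t s : is_interval I -> I 0 -> I t ->
  Num.min 0 t <= s <= Num.max 0 t -> I s.
Proof.
move=> iI I0 It; have [t0|/ltW t0] := leP 0 t; [exact: iI|exact: iI].
Qed.

Lemma sol_tame nu (y0 : V) p a b : is_solution nu y0 p -> p.1 a -> p.1 b ->
  exists j, (0 < j)%N /\ tame j%:R p.2 a b.
Proof.
move=> [ip op p0 cp _] pa pb.
have cab : {within `[a, b], continuous p.2}.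
  by apply: continuous_subspaceW cp => s /=; rewrite in_itv/=; exact: ip.
have [j [j0 jP]] := within_bounded cab.
by exists j; split => //; split => //; exact: within_ucont.
Qed.

Lemma sol_tame0 nu (y0 : V) p t : is_solution nu y0 p -> p.1 t ->
  exists j, (0 < j)%N /\ tame j%:R p.2 (Num.min 0 t) (Num.max 0 t).
Proof.
move=> sp pt; have [ip _ p0 _ _] := sp; apply: sol_tame sp _ _; apply: (minmax_in ip p0 pt).
- by rewrite lexx/= ge_min le_max lexx.
- by rewrite lexx andbT ge_min le_max lexx.
Qed.

(** Both solutions stay in a common ball between 0 and [t], and Gronwall's inequality applies with
    [K = 0]. *)
Lemma sol_unique nu (y0 : V) p q t : is_solution nu y0 p -> is_solution nu y0 q ->
  p.1 t -> q.1 t -> p.2 t = q.2 t.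
Proof.
move=> sp sq pt qt.
have [j1 [j10 pj]] := sol_tame0 sp pt; have [j2 [j20 qj]] := sol_tame0 sq qt.
pose j := maxn j1 j2; have j0 : (0 < j)%N by rewrite leq_max j10.
have {}pj : tame j%:R p.2 (Num.min 0 t) (Num.max 0 t).
  by apply: tameS pj; rewrite ler_nat leq_maxl.
have {}qj : tame j%:R q.2 (Num.min 0 t) (Num.max 0 t).
  by apply: tameS qj; rewrite ler_nat leq_maxr.
have [m [l fb]] := Mp_field nu j0.
apply/eqP; rewrite -subr_eq0 -normr_le0.
have z0 : Num.min 0 t <= 0 <= Num.max 0 t by rewrite ge_min le_max lexx.
have := vint_gronwall fb z0 (ler0n _ _) (lexx 0) pj qj.
move=> H; have := H _ t; rewrite mulr0 mul0r; apply; last first.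
  by rewrite ge_min le_max lexx !orbT.
have [ip _ p0 _ pE] := sp; have [iq _ q0 _ qE] := sq.
move=> s st; rewrite add0r pE; last exact: minmax_in st.
rewrite qE; last exact: minmax_in st.
by rewrite opprD addrACA subrr add0r.
Qed.

(** Where the curve is strictly inside the ball the clip is inactive. Strictness persists on a
    slightly larger open interval, which is needed because solutions live on open intervals. The
    equation is available only on [[a - 1, b + 1]], so [d] is kept at most 1. *)
Lemma clipped_is_solution nu J m l (y0 : V) y a b : field_bounds nu J m l -> 0 <= J ->
  (forall c d, ucont y c d) ->
  a <= 0 <= b -> (forall t, a <= t <= b -> `|y t| < J) ->
  (forall t, a - 1 <= t <= b + 1 -> y t = y0 + integral_MpN nu (clip J \o y) 0 t) ->
  exists2 d, 0 < d & is_solution nu y0 (`]a - d, b + d[%classic, y).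
Proof.
move=> fb J0 yu /andP[a0 b0] yJ yE.
have ab := le_trans a0 b0.
have yc : continuous y.
  move=> x; apply/cvgrPdist_le => e e0.
  have [d d0 yd] := yu (x - 1) (x + 1) e e0.
  apply/nbhs_normP; exists (Num.min d 1); first by rewrite /= lt_min d0/=.
  move=> t /=; rewrite lt_min => /andP[td].
  by rewrite ltr_distl => /andP[t1 t2]; apply: yd => //; apply/andP; split; lra.
have near_lt x : `|y x| < J -> exists2 d, 0 < d & forall t, `|x - t| < d -> `|y t| < J.
  move=> yx; have : `|y t| @[t --> x] --> `|y x| by apply: cvg_norm; exact: yc.
  by move=> /cvgr_lt/(_ _ yx)/nbhs_normP[d d0 dP]; exists d => // t /dP.
have [|d1 d10 h1] := near_lt a; first by apply: yJ; rewrite lexx.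
have [|d2 d20 h2] := near_lt b; first by apply: yJ; rewrite lexx andbT.
pose d := Num.min 1 (Num.min d1 d2).
have dd1 : d <= d1 by rewrite /d !ge_min lexx orbT.
have dd2 : d <= d2 by rewrite /d !ge_min lexx !orbT.
have dd3 : d <= 1 by rewrite /d !ge_min lexx.
have d0 : 0 < d by rewrite /d !lt_min ltr01 d10.
have yJd t : a - d < t < b + d -> `|y t| < J.
  move=> /andP[t1 t2]; have [ta|at'] := ltP t a.
    by apply: h1; rewrite ltr_norml; apply/andP; split; lra.
  have [tb|bt] := leP t b; first by apply: yJ; rewrite at'.
  by apply: h2; rewrite ltr_norml; apply/andP; split; lra.
exists d => //; split => /=.
- exact: interval_is_interval.
- exact: interval_open.
- by rewrite in_itv/=; apply/andP; split; lra.
- exact: continuous_subspaceT.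
move=> t; rewrite in_itv/= => td; rewrite yE; last by case/andP: td => *; apply/andP; split; lra.
congr (_ + _); apply/eqP; rewrite -subr_eq0 -normr_le0.
have yjs s : Num.min 0 t <= s <= Num.max 0 t -> `|y s| <= J.
  move=> st; apply/ltW/yJd.
  by case/andP: td st; case: (leP 0 t) => t0 t1 t2 /andP[s1 s2]; apply/andP; split; lra.
have := vint_diff_weight fb (lexx 0) (f := clip J \o y) (g := y) (t := t).
rewrite !mul0r; apply.
- by apply: clip_tame.
- by split.
- by move=> s st; rewrite /= clip_id ?subrr ?normr0 ?mul0r//; exact: yjs.
Qed.

Lemma exists_solution nu (y0 : V) : exists p, is_solution nu y0 p.
Proof.
pose j := (Num.truncn `|y0|).+1.
have yj : `|y0| < j%:R by exact: truncnS_gt.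
have [m [l fb]] := Mp_field nu (isT : (0 < j)%N).
have [y [ym yy0 yE]] := exists_clipped_solution fb (ler0n _ j) y0.
have [|||||d _ sol] := clipped_is_solution (a := 0) (b := 0) (y := y) (y0 := y0) fb.
- exact: ler0n.
- by move=> c d; exact: modulus_ucont fb _ _ _ ym.
- by rewrite lexx.
- by move=> t t0; have -> : t = 0 by [apply/eqP; rewrite eq_le andbC]; rewrite yy0.
- by move=> t _; exact: yE.
by exists (`]0 - d, 0 + d[%classic, y).
Qed.

(** By uniqueness all solutions agree on common times, so they glue; the result extends every other
    solution, and maximality is then automatic. *)
Lemma exists_union_solution nu (y0 : V) :
  exists f, is_solution nu y0 (\bigcup_(q in is_solution nu y0) q.1, f).
Proof.
have /choice[f fP] : forall t, exists v : V,
    forall q, is_solution nu y0 q -> q.1 t -> v = q.2 t.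
  move=> t; have [[q [sq qt]]|nq] := pselect (exists q, is_solution nu y0 q /\ q.1 t).
    by exists (q.2 t) => q' sq' q't; exact: sol_unique sq sq' qt q't.
  by exists 0 => q sq qt; exfalso; apply: nq; exists q.
pose U := \bigcup_(q in is_solution nu y0) q.1.
exists f; split => /=.
- move=> x z [q1 s1 xq1] [q2 s2 zq2] t /andP[xt tz].
  have [i1 _ z1 _ _] := s1; have [i2 _ z2 _ _] := s2.
  have [t0|/ltW t0] := leP 0 t.
    by exists q2 => //; apply: i2 z2 zq2 _ _; rewrite t0.
  by exists q1 => //; apply: i1 xq1 z1 _ _; rewrite xt.
- by apply: bigcup_open => q [].
- by have [q sq] := exists_solution nu y0; exists q => //; case: sq.
- apply/subspace_continuousP => x [q sq qx].
  have [_ oq _ cq _] := sq.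
  have qc : {for x, continuous q.2}.
    by move: cq; rewrite continuous_open_subspace// => /(_ x (mem_set qx)).
  suff : f s @[s --> nbhs x] --> f x by move=> fx; apply: cvg_within_filter.
  rewrite (fP x q sq qx).
  apply: cvg_trans qc; apply: near_eq_cvg.
  have : nbhs x q.1 by apply: open_nbhs_nbhs; split.
  by apply: filterS => s qs; rewrite (fP s q).
- move=> t [q sq qt]; have [iq _ q0 _ qE] := sq.
  rewrite (fP t q sq qt) qE//; congr (_ + _).
  have [j [j0 qj]] := sol_tame0 sq qt.
  have E s : Num.min 0 t <= s <= Num.max 0 t -> q.2 s = f s.
    by move=> st; rewrite (fP s q sq)//; exact: minmax_in st.
  apply: (vint_eq nu j0 qj _ E); split=> [e e0|s st].
    have [d d0 yd] := qj.1 e e0; exists d => // s s' ss ss' ss'd.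
    by rewrite -!E//; exact: yd.
  by rewrite -E//; exact: qj.2.
Qed.

Lemma maximal_solutionP nu (y0 : V) : is_maximal_solution nu y0 (maximal_solution nu y0).
Proof.
have [f solU] := exists_union_solution nu y0.
suff pU : is_maximal_solution nu y0 (\bigcup_(q in is_solution nu y0) q.1, f).
  rewrite /maximal_solution; case: xgetP => [p _ //|np].
  by case: (np _ pU).
split=> // q sq Uq _; apply/seteqP; split=> // t qt; exists q => //.
Qed.

Lemma solutionP nu (y0 : V) :
  is_solution nu y0 (existence_interval nu y0, fun t => solution t nu y0).
Proof.
have [] := maximal_solutionP nu y0; rewrite /existence_interval /solution.
by case: maximal_solution.
Qed.

Lemma existence_interval_sub nu (y0 : V) q : is_solution nu y0 q ->
  q.1 `<=` existence_interval nu y0.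
Proof.
move=> sq t qt; have [f solU] := exists_union_solution nu y0.
have [sp maxp] := maximal_solutionP nu y0.
have pU : (maximal_solution nu y0).1 `<=` \bigcup_(q in is_solution nu y0) q.1.
  by move=> s ps; exists (maximal_solution nu y0).
(* The chosen maximal solution is only known to be maximal; comparing it with the glued one forces
   their intervals to coincide. *)
rewrite /existence_interval -(maxp _ solU pU); first by exists q.
by move=> s ps; apply: (sol_unique solU sp) => //; exact: pU.
Qed.

Lemma solution_eq nu (y0 : V) q t : is_solution nu y0 q -> q.1 t ->
  solution t nu y0 = q.2 t.
Proof.
move=> sq qt; apply: (sol_unique (solutionP nu y0) sq) => //.
exact: existence_interval_sub sq _ qt.
Qed.

End Solutions.

(** * Translations *)

Section Translations.
Variables (R : realType) (N : nat).
Local Notation V := 'rV[R]_N.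
Implicit Types (y : R -> V) (a b c s t : R).

Lemma translate_itv a b t : translate_set `[a, b]%classic t = `[a + t, b + t]%classic.
Proof.
by rewrite translate_setE; apply/seteqP; split=> x /=; rewrite !in_itv/= lerBrDr lerBlDr.
Qed.

Lemma riemann_sum_shift (nu : V -> set R -> R) c y k (t tau : nat -> R) :
  riemann_sum (translate_fun nu c) y k t tau =
  riemann_sum nu (fun s => y (s - c)) k (fun i => t i + c) (fun i => tau i + c).
Proof.
by apply: eq_bigr => i _; rewrite /translate_fun translate_itv addrK.
Qed.

Lemma tagged_partition_shift a b d k (t tau : nat -> R) c :
  tagged_partition a b d k t tau ->
  tagged_partition (a + c) (b + c) d k (fun i => t i + c) (fun i => tau i + c).
Proof.
move=> [<- <- tP]; split=> // i /tP[h1 h2 h3].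
by rewrite !lerD2r ltrD2r; split => //; lra.
Qed.

Lemma is_integral_shift (nu : V -> set R -> R) c y a b L :
  is_integral (translate_fun nu c) y a b L <->
  is_integral nu (fun s => y (s - c)) (a + c) (b + c) L.
Proof.
split=> H e /H[d d0 dP]; exists d => // k t tau tP.
- have := dP k (fun i => t i - c) (fun i => tau i - c).
  rewrite riemann_sum_shift.
  have E (u : nat -> R) : (fun i => u i - c + c) = u by apply/funext => i; rewrite subrK.
  rewrite !E; apply.
  by have := tagged_partition_shift (- c) tP; rewrite !addrK.
- by rewrite riemann_sum_shift; apply: dP; exact: tagged_partition_shift.
Qed.

(** The two predicates are equal, hence [xget] returns the same value whether or not an integral
    exists. *)
Lemma integral_Mp_shift (nu : V -> set R -> R) c y a b :
  integral_Mp (translate_fun nu c) y a b =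
  integral_Mp nu (fun s => y (s - c)) (a + c) (b + c).
Proof.
have E x z : is_integral (translate_fun nu c) y x z =
    is_integral nu (fun s => y (s - c)) (x + c) (z + c).
  by apply/funext => L; apply/propext; exact: is_integral_shift.
by rewrite /integral_Mp lerD2r !E.
Qed.

Lemma integral_MpN_shift (nu : MpN R N) c y a b :
  integral_MpN (translateN nu c) y a b =
  integral_MpN nu (fun s => y (s - c)) (a + c) (b + c).
Proof. by apply/rowP => i; rewrite !mxE -integral_Mp_shift. Qed.

Lemma Mp_eq (nu nu' : Mp R N) : (forall v A, nu v A = nu' v A) -> nu = nu'.
Proof.
case: nu => f fP; case: nu' => g gP /= fg.
have E : f = g by apply/funext => v; apply/funext => A.
by subst g; congr MkMp; exact: Prop_irrelevance.
Qed.

Lemma translateN0 (nu : MpN R N) : translateN nu 0 = nu.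
Proof.
by apply/funext => i; apply: Mp_eq => v A; rewrite /= /translate_fun translate_set0.
Qed.

Lemma translateND (nu : MpN R N) s t :
  translateN (translateN nu s) t = translateN nu (s + t).
Proof.
apply/funext => i; apply: Mp_eq => v A.
by rewrite /= /translate_fun translate_setD addrC.
Qed.

Lemma shift_solution (nu : MpN R N) (y0 : V) p s : is_solution nu y0 p -> p.1 s ->
  is_solution (translateN nu s) (p.2 s) ([set t | p.1 (t + s)], fun t => p.2 (t + s)).
Proof.
move=> sp ps; have [ip op p0 cp pE] := sp.
have shc : continuous (fun t : R => t + s).
  by move=> x; apply: cvgD; [exact: cvg_id|exact: cvg_cst].
have os : open [set t | p.1 (t + s)] by apply: open_comp => // x _; exact: shc.
split => //=.
- move=> x z px pz t /andP[xt tz]; apply: ip px pz _ _.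
  by rewrite !lerD2r xt.
- by rewrite add0r.
- rewrite continuous_open_subspace// => x /set_mem/= px.
  have pc : {for (x + s), continuous p.2}.
    by move: cp; rewrite continuous_open_subspace// => /(_ _ (mem_set px)).
  by apply: (@continuous_comp _ _ _ (fun t => t + s) p.2); [exact: shc|].
move=> t pt; rewrite pE// integral_MpN_shift add0r.
have -> : (fun r => p.2 (r - s + s)) = p.2 by apply/funext => r; rewrite subrK.
rewrite (pE s)// -addrA; congr (_ + _).
pose a := Num.min 0 (Num.min s (t + s)); pose b := Num.max 0 (Num.max s (t + s)).
have pa : p.1 a by rewrite /a; case: (leP s (t + s)) => _; case: (leP 0 _) => _.
have pb : p.1 b by rewrite /b; case: (leP s (t + s)) => _; case: (leP 0 _) => _.
have [j [j0 yt]] := sol_tame sp pa pb.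
have [m [l fb]] := Mp_field nu j0.
by apply: (vint_cat fb yt); rewrite /a /b !(ge_min, le_max, lexx, orbT).
Qed.

Lemma solution_flow (nu : MpN R N) (y0 : V) s t :
  existence_interval nu y0 s -> existence_interval nu y0 (t + s) ->
  solution (t + s) nu y0 = solution t (translateN nu s) (solution s nu y0).
Proof.
move=> ps pts; have sp := shift_solution (solutionP nu y0) ps.
by rewrite (solution_eq sp pts).
Qed.

End Translations.

(** * Variation of interval functions *)

Section Variation.
Variables (R : realType) (T : Type) (P : T -> Prop) (w : T -> R -> R -> R).
Variable B : R -> R.
Hypotheses (w_ge0 : forall v x z, 0 <= w v x z).
Hypothesis w_refl : forall v x, w v x x = 0.
Hypothesis w_sub : forall v x y z, P v -> x <= y -> y <= z ->
  w v x z <= w v x y + w v y z.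
Hypothesis w_bound : forall a s b, chain (fun v _ _ => P v) a s b ->
  csum w a s <= B (b - a).
Implicit Types (a b c e x z : R) (s : seq (R * T)).

Local Notation pchain := (chain (fun v _ _ => P v)).

Definition chain_sums a b : set R := [set x | exists2 s, pchain a s b & x = csum w a s].

Definition variation_on a b := sup (chain_sums a b).

Lemma csum_le_variation a s b : pchain a s b -> csum w a s <= variation_on a b.
Proof.
move=> Ps; apply: ub_le_sup; last by exists s.
by exists (B (b - a)) => _ [s' Ps' ->]; exact: w_bound.
Qed.

Section inhabited.
Variables (t0 : T) (Pt0 : P t0).

Lemma variation_le a b M : a <= b -> (forall s, pchain a s b -> csum w a s <= M) ->
  variation_on a b <= M.
Proof.
move=> ab sM; apply: ge_sup => [|_ [s Ps ->]]; last exact: sM.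
by exists (csum w a [:: (b, t0)]); exists [:: (b, t0)].
Qed.

(** Cutting the step that contains [b] can only increase the sum, by [w_sub]. This is the half of
    additivity that concatenation of chains does not give. *)
Lemma chain_split a s b c : pchain a s c -> a <= b -> b <= c ->
  exists s1 s2, [/\ pchain a s1 b, pchain b s2 c & csum w a s <= csum w a s1 + csum w b s2].
Proof.
elim: s a => [|[z v] s IH] a /=.
  move=> -> cb bc; have -> : b = c by apply/eqP; rewrite eq_le cb bc.
  by exists [::], [::]; split=> //=; rewrite addr0.
move=> [az Pv Ps] ab bc; have [bz|/ltW zb] := leP b z.
  exists [:: (b, v)], ((z, v) :: s); split=> //=.
  by rewrite addr0 addrA lerD2r; exact: w_sub.
have [s1 [s2 [P1 P2 h]]] := IH z Ps zb bc.
exists ((z, v) :: s1), s2; split=> //=.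
by rewrite -addrA lerD2l.
Qed.

Lemma variation_cat a b c : a <= b -> b <= c ->
  variation_on a c = variation_on a b + variation_on b c.
Proof.
move=> ab bc; apply/eqP; rewrite eq_le; apply/andP; split.
  apply: variation_le (le_trans ab bc) _ => s Ps.
  have [s1 [s2 [P1 P2 h]]] := chain_split Ps ab bc.
  by apply: le_trans h _; apply: lerD; exact: csum_le_variation.
rewrite -lerBrDr; apply: variation_le => // s1 P1.
rewrite lerBrDr addrC -lerBrDr; apply: variation_le => // s2 P2.
rewrite lerBrDr addrC -(csum_cat _ _ P1).
by apply: csum_le_variation; exact: chain_cat P2.
Qed.

Lemma variation_ge0 a b : a <= b -> 0 <= variation_on a b.
Proof.
move=> ab; apply: le_trans (_ : csum w a [:: (b, t0)] <= _); first by rewrite /= addr0.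
by apply: csum_le_variation; split.
Qed.

Hypothesis wcont : forall v x e, P v -> 0 < e -> exists2 d, 0 < d &
  forall z, `|z - x| < d -> w v (Num.min x z) (Num.max x z) <= e.

Lemma chain_trim_left a s c e : pchain a s c -> a < c -> 0 < e ->
  exists2 d, 0 < d & forall x, a < x < a + d ->
    exists2 s', pchain x s' c & csum w a s <= csum w x s' + e.
Proof.
move=> + ac e0; elim: s => [/= aE|[z v] s IH /= [az Pv Ps]].
  by move: ac; rewrite aE ltxx.
(* Leading steps of length zero are skipped: they contribute nothing and leave no room for
   trimming. *)
have [za|] := leP z a; last first.
  move=> az'; have [d d0 wd] := wcont a Pv e0.
  exists (Num.min d (z - a)); first by rewrite lt_min d0 subr_gt0.
  move=> x /andP[ax]; rewrite -ltrBlDl lt_min => /andP[xd xz].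
  have xz' : x <= z by lra.
  exists ((z, v) :: s) => //=.
  have := wd x; rewrite ger0_norm ?subr_ge0 ?(ltW ax)// => /(_ xd).
  rewrite min_l ?max_r ?(ltW ax)// => h.
  have := w_sub Pv (ltW ax) xz'; lra.
have zE : z = a by apply/eqP; rewrite eq_le az za.
by subst z; rewrite w_refl add0r; exact: IH.
Qed.

Lemma chain_trim_right a s c e : pchain a s c -> a < c -> 0 < e ->
  exists2 d, 0 < d & forall x, c - d < x < c ->
    exists2 s', pchain a s' x & csum w a s <= csum w a s' + e.
Proof.
move=> + + e0; elim: s a => [a /= -> |[z v] s IH a /= [az Pv Ps] ac].
  by rewrite ltxx.
have zc := chain_le Ps; move: zc; rewrite le_eqVlt => /predU1P[zc|zc]; last first.
  have [d d0 dP] := IH z Ps zc.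
  exists (Num.min d (c - z)); first by rewrite lt_min d0 subr_gt0.
  move=> x /andP[+ xc]; rewrite ltrBlDr -ltrBlDl lt_min => /andP[xd xz].
  have [|s' Ps' h] := dP x; first by rewrite xc andbT; lra.
  by exists ((z, v) :: s') => //=; rewrite -addrA lerD2l.
subst z; rewrite (chain_const w_refl Ps) addr0.
have [d d0 wd] := wcont c Pv e0.
exists (Num.min d (c - a)); first by rewrite lt_min d0 subr_gt0.
move=> x /andP[+ xc]; rewrite ltrBlDr -ltrBlDl lt_min => /andP[xd xa].
have ax : a <= x by lra.
exists [:: (x, v)] => //=; rewrite addr0.
have := wd x; rewrite distrC ger0_norm ?subr_ge0 ?(ltW xc)// => /(_ xd).
rewrite min_r ?max_l ?(ltW xc)// => h.
have := w_sub Pv ax (ltW xc); lra.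
Qed.

(* Trimming the first or last interval of a near-optimal subdivision shows that
   the additive function [variation_on] has no jumps. *)
Lemma variation_continuous : continuous (cum variation_on).
Proof.
suff H (x e : R) : 0 < e -> exists2 d, 0 < d & forall z, `|x - z| < d ->
    `|cum variation_on x - cum variation_on z| <= e.
  move=> x; apply/cvgrPdist_le => e e0; have [d d0 dP] := H x e e0.
  by apply/nbhs_normP; exists d => // z; exact: dP.
move=> e0; have e20 : 0 < e / 2 by lra.
have E a b : a <= b -> cum variation_on b - cum variation_on a = variation_on a b.
  by move=> ab; rewrite -(cumE ab variation_cat).
have right : exists2 d, 0 < d & forall z, x < z < x + d -> variation_on x z <= e.
  have x1 : x < x + 1 by rewrite ltrDl.
  have [_ [s Ps ->] sV] : exists2 y, chain_sums x (x + 1) y & variation_on x (x + 1) - e / 2 < y.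
    apply: sup_adherent => //; split.
      by exists (csum w x [:: (x + 1, t0)]), [:: (x + 1, t0)] => //; split => //; exact: ltW.
    by exists (B (x + 1 - x)) => _ [s Ps ->]; exact: w_bound.
  have [d d0 dP] := chain_trim_left Ps x1 e20.
  exists (Num.min d 1); first by rewrite lt_min d0/=.
  move=> z /andP[xz]; rewrite -ltrBlDl lt_min => /andP[zd z1].
  have [|s' Ps' h] := dP z; first by rewrite xz/=; lra.
  have z2 : z <= x + 1 by lra.
  have := csum_le_variation Ps'; have := variation_cat (ltW xz) z2; lra.
have left : exists2 d, 0 < d & forall z, x - d < z < x -> variation_on z x <= e.
  have x1 : x - 1 < x by rewrite gtrBl.
  have [_ [s Ps ->] sV] : exists2 y, chain_sums (x - 1) x y & variation_on (x - 1) x - e / 2 < y.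
    apply: sup_adherent => //; split.
      by exists (csum w (x - 1) [:: (x, t0)]), [:: (x, t0)] => //; split => //; exact: ltW.
    by exists (B (x - (x - 1))) => _ [s Ps ->]; exact: w_bound.
  have [d d0 dP] := chain_trim_right Ps x1 e20.
  exists (Num.min d 1); first by rewrite lt_min d0/=.
  move=> z /andP[+ xz]; rewrite ltrBlDr -ltrBlDl lt_min => /andP[zd z1].
  have [|s' Ps' h] := dP z; first by rewrite xz andbT; lra.
  have z2 : x - 1 <= z by lra.
  have := csum_le_variation Ps'; have := variation_cat z2 (ltW xz); lra.
have [d1 d10 h1] := right; have [d2 d20 h2] := left.
exists (Num.min d1 d2); first by rewrite lt_min d10.
move=> z; rewrite lt_min => /andP[zd1 zd2].
have [xz|zx|->] := ltgtP x z; last by rewrite subrr normr0 ltW.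
  rewrite distrC E ?(ltW xz)// ger0_norm ?variation_ge0 ?(ltW xz)//.
  by apply: h1; move: zd1; rewrite ltr_norml xz => /andP[]; lra.
rewrite E ?(ltW zx)// ger0_norm ?variation_ge0 ?(ltW zx)//.
by apply: h2; move: zd2; rewrite ltr_norml zx andbT => /andP[]; lra.
Qed.

End inhabited.

Hypothesis B_ge0 : forall x, 0 <= x -> 0 <= B x.

(** This turns a bound on sums back into a bounding function: since tags may change from step to
    step, one [g] dominates all tags simultaneously. The last clause makes the Stieltjes measure of
    [g] free of atoms. *)
Lemma exists_variation : exists g : R -> R,
  [/\ {homo g : x z / x <= z},
      forall v x z, P v -> x <= z -> w v x z <= g z - g x,
      forall x z, x <= z -> g z - g x <= B (z - x)
    & (forall v x e, P v -> 0 < e -> exists2 d, 0 < d &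
         forall z, `|z - x| < d -> w v (Num.min x z) (Num.max x z) <= e) ->
      continuous g].
Proof.
(* Without an admissible tag, as for [N = 0], no chain joins distinct points and the supremum is
   over an empty set; a constant then serves. *)
have [[t0 Pt0]|nP] := pselect (exists t0, P t0); last first.
  exists (fun=> 0); split=> //.
  - by move=> v x z Pv; exfalso; apply: nP; exists v.
  - by move=> x z xz; rewrite subrr B_ge0// subr_ge0.
  - by move=> _ x; exact: cvg_cst.
exists (cum variation_on).
have E a b : a <= b -> cum variation_on b - cum variation_on a = variation_on a b.
  by move=> ab; rewrite -(cumE ab (variation_cat Pt0)).
split.
- by move=> x z xz; rewrite -subr_ge0 E// (variation_ge0 Pt0).
- move=> v x z Pv xz; rewrite E//.
  have : pchain x [:: (z, v)] z by split.
  by move=> /csum_le_variation; rewrite /= addr0.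
- by move=> x z xz; rewrite E//; apply: (variation_le Pt0) => // s; exact: w_bound.
- exact: (variation_continuous Pt0).
Qed.

End Variation.

(** * Bounds along subdivisions *)

Lemma csum_shift (R : realType) (T : Type) (w : T -> R -> R -> R) (c : R) a s :
  csum (fun v x z => w v (x + c) (z + c)) a s =
  csum w (a + c) [seq (p.1 + c, p.2) | p <- s].
Proof. by elim: s a => [//|p s IH] a /=; rewrite IH. Qed.

Lemma chain_shift (R : realType) (T : Type) (P : T -> Prop) (c : R) a s b :
  chain (fun v _ _ => P v) a s b ->
  chain (fun v _ _ => P v) (a + c) [seq (p.1 + c, p.2) | p <- s] (b + c).
Proof.
by elim: s a => [a /= ->//|p s IH] a /= [ap Pp /IH Ps]; split => //; rewrite lerD2r.
Qed.

Lemma csum_eq (R : realType) (T : Type) (w w' : T -> R -> R -> R) P a s b :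
  (forall v x z, x <= z -> w v x z = w' v x z) -> chain P a s b ->
  csum w a s = csum w' a s.
Proof.
move=> ww'; elim: s a => [//|p s IH] a /= [ap _ Ps].
by rewrite ww'// (IH _ Ps).
Qed.

(** A chain has finitely many steps, so convergence of each weight suffices. This is why bounds are
    phrased on chains. *)
Lemma csum_le_lim (R : realType) (T X : Type) (F : set_system X) {FF : ProperFilter F}
    (u : X -> T -> R -> R -> R) (w : T -> R -> R -> R) P a s b (M : R) :
  chain P a s b ->
  (forall v x z, x <= z -> u n v x z @[n --> F] --> w v x z) ->
  (\forall n \near F, csum (u n) a s <= M) -> csum w a s <= M.
Proof.
move=> Ps uw uM.
apply: (@closed_cvg _ _ F FF (fun n => csum (u n) a s) [set y | y <= M] _ uM).
  exact: closed_le.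
elim: s a Ps {uM} => [a _|p s IH a /= [ap _ Ps]]; first exact: cvg_cst.
by apply: cvgD; [exact: uw|exact: IH].
Qed.

Section ChainBounds.
Variables (R : realType) (N : nat).
Local Notation V := 'rV[R]_N.
Implicit Types (mu : MpN R N) (a b c e x z : R) (v : V).

Definition m_weight mu (t : 'I_N * V) x z := `|inc (Mp_cum (mu t.1)) t.2 x z|.

(** The right-hand side depends on [b - a] only, so the condition is invariant under translation,
    unlike domination by a fixed measure. The component index is part of the tag, so one bound
    serves all components. *)
Definition m_chain_bound (th : nat -> R -> R) mu := forall j a s b, (0 < j)%N ->
  chain (fun t _ _ => `|t.2| <= j%:R) a s b -> csum (m_weight mu) a s <= th j (b - a).

(* The value at [t.1.2 = t.2] is [0 / 0 = 0]. *)
Definition l_weight mu (t : 'I_N * V * V) x z :=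
  `|inc (Mp_cum (mu t.1.1)) t.1.2 x z - inc (Mp_cum (mu t.1.1)) t.2 x z|
    / `|t.1.2 - t.2|.

(** [C j] bounds the mass of an l-bound on unit intervals; [b - a + 1] bounds the number of unit
    intervals needed to cover [[a, b]]. *)
Definition l_chain_bound (C : nat -> R) mu := forall j a s b, (0 < j)%N ->
  chain (fun t _ _ => `|t.1.2| <= j%:R /\ `|t.2| <= j%:R) a s b ->
  csum (l_weight mu) a s <= C j * (b - a + 1).

(** The [l] given by [Mp_field] is not controlled along the hull. It is replaced by the variation of
    [l_weight], whose increments are bounded through [C j] alone. *)
Lemma l_chain_field C mu j : l_chain_bound C mu -> (0 < j)%N -> 0 <= C j ->
  exists m l, field_bounds mu j%:R m l /\
    forall a b, a <= b -> l b - l a <= C j * (b - a + 1).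
Proof.
move=> lC j0 Cj0; have [m [l fb]] := Mp_field mu j0.
have [|||||g [gnd wg gC _]] := @exists_variation R _
  (fun t : 'I_N * V * V => `|t.1.2| <= j%:R /\ `|t.2| <= j%:R) (l_weight mu)
  (fun s => C j * (s + 1)).
- by move=> t x z; rewrite divr_ge0.
- by move=> t x; rewrite /l_weight /inc !subrr normr0 mul0r.
- move=> [[i v] w] x y z _ xy yz; rewrite /l_weight/= -mulrDl ler_wpM2r ?invr_ge0//.
  apply: le_trans (ler_normD _ _); rewrite /inc le_eqVlt; apply/orP; left.
  by apply/eqP; congr (`|_|); ring.
- by move=> a s b; exact: lC.
- by move=> x x0; rewrite mulr_ge0// addr_ge0.
exists m, g; split => //; split; rewrite ?(fb_cont fb) ?(fb_ndm fb)//.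
- exact: fb_cont fb.
- exact: fb_ndm fb.
- exact: fb_m fb.
move=> i v w x z vj wj xz; have [->|vw] := eqVneq v w; first by rewrite !subrr !normr0 mulr0.
rewrite -ler_pdivrMr ?normr_gt0 ?subr_eq0//.
exact: (wg (i, v, w)).
Qed.

Lemma inc_translate mu c i v x z : x <= z ->
  inc (Mp_cum (translateN mu c i)) v x z = inc (Mp_cum (mu i)) v (x + c) (z + c).
Proof.
move=> xz; rewrite !inc_Mp ?lerD2r//.
by rewrite /= /translate_fun translate_itv.
Qed.

Lemma m_chain_translate th mu c : m_chain_bound th mu -> m_chain_bound th (translateN mu c).
Proof.
move=> mth j a s b j0 Ps.
rewrite (csum_eq (w' := fun t x z => m_weight mu t (x + c) (z + c)) _ Ps); last first.
  by move=> t x z xz; rewrite /m_weight inc_translate.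
rewrite csum_shift; have -> : b - a = (b + c) - (a + c) by ring.
by apply: mth => //; exact: (chain_shift (P := fun t => `|t.2| <= j%:R)).
Qed.

Lemma l_chain_translate C mu c : l_chain_bound C mu -> l_chain_bound C (translateN mu c).
Proof.
move=> mth j a s b j0 Ps.
rewrite (csum_eq (w' := fun t x z => l_weight mu t (x + c) (z + c)) _ Ps); last first.
  by move=> t x z xz; rewrite /l_weight !inc_translate.
rewrite csum_shift; have -> : b - a = (b + c) - (a + c) by ring.
by apply: mth => //; exact: (chain_shift (P := fun t => `|t.1.2| <= j%:R /\ `|t.2| <= j%:R)).
Qed.

Lemma m_chain_single th mu j i v x z : m_chain_bound th mu -> (0 < j)%N ->
  `|v| <= j%:R -> x <= z -> `|inc (Mp_cum (mu i)) v x z| <= th j (z - x).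
Proof.
move=> mth j0 vj xz.
by have := mth j x [:: (z, (i, v))] z j0; rewrite /= addr0; apply; split.
Qed.

Lemma l_chain_single C mu j i v w x z : l_chain_bound C mu -> (0 < j)%N ->
  `|v| <= j%:R -> `|w| <= j%:R -> x <= z ->
  `|inc (Mp_cum (mu i)) v x z - inc (Mp_cum (mu i)) w x z|
     <= C j * (z - x + 1) * `|v - w|.
Proof.
move=> mth j0 vj wj xz; have [->|vw] := eqVneq v w; first by rewrite !subrr !normr0 mulr0.
rewrite -ler_pdivrMr ?normr_gt0 ?subr_eq0//.
by have := mth j x [:: (z, (i, v, w))] z j0; rewrite /= addr0; apply; split.
Qed.

Lemma m_chain_int th mu j i (y : R -> V) a b : m_chain_bound th mu -> (0 < j)%N ->
  a <= b -> tame j%:R y a b -> `|integral_Mp (mu i) y a b| <= th j (b - a).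
Proof.
move=> mth j0 ab yt; have [m [l fb]] := Mp_field mu j0.
apply: (int_le_csum (cum_of_Mp (mu i)) (fb_ndl fb) (fb_l fb i) ab yt) => s Ps.
apply: le_trans (ler_norm_csum _ _ _) _.
have := mth j a (retag (fun v : V => (i, v)) s) b j0.
by rewrite csum_retag; apply; apply/chain_retag.
Qed.

Definition modulus_family (th : nat -> R -> R) := forall j, (0 < j)%N ->
  [/\ forall s, 0 <= s -> 0 <= th j s,
      forall s t, 0 <= s -> s <= t -> th j s <= th j t &
      forall e, 0 < e -> exists2 d, 0 < d & forall s, 0 <= s < d -> th j s <= e].

Section Limits.
Variables (th : nat -> R -> R) (Hth : modulus_family th).
Variables (F : set_system (MpN R N)) (FF : ProperFilter F).

(** The seminorms see rational intervals only. The interval is enlarged to a rational one, and the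
    two end pieces are small for all fields at once: by [th] for [mu'], by continuity of [m] for the
    limit. This makes four errors besides that of the convergence, hence [e / 5]. *)
Lemma cvg_real_itv mu i v : F (m_chain_bound th) ->
  (forall q1 q2 : rat, q1 < q2 -> inc (Mp_cum (mu' i)) v (ratr q1) (ratr q2) @[mu' --> F]
     --> inc (Mp_cum (mu i)) v (ratr q1) (ratr q2)) ->
  forall x z, x <= z ->
    inc (Mp_cum (mu' i)) v x z @[mu' --> F] --> inc (Mp_cum (mu i)) v x z.
Proof.
move=> Fm Fq x z xz; apply/cvgrPdist_le => e e0.
pose j := (Num.truncn `|v|).+1; have vj : `|v| <= j%:R by exact/ltW/truncnS_gt.
have e50 : 0 < e / 5 by lra.
have [m [l fb]] := Mp_field mu (isT : (0 < j)%N).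
have [_ _ /(_ _ e50)[d d0 dth]] := Hth (isT : (0 < j)%N).
have cm u : exists2 d', 0 < d' & forall t, `|u - t| < d' -> `|m u - m t| <= e / 5.
  have /cvgrPdist_le/(_ _ e50)/nbhs_normP[d' d'0 dP] := fb_cont fb (x := u).
  by exists d'.
have [d1 d10 m1] := cm x; have [d2 d20 m2] := cm z.
have [|q1] := @rat_in_itvoo R (x - Num.min d d1) x.
  by rewrite gtrBl lt_min d0.
rewrite in_itv/= => /andP[q1a q1b].
have [|q2] := @rat_in_itvoo R z (z + Num.min d d2).
  by rewrite ltrDl lt_min d0.
rewrite in_itv/= => /andP[q2a q2b].
move: q1a q2b; rewrite ltrBlDr -ltrBlDl -ltrBlDl !lt_min => /andP[h1 h1'] /andP[h2 h2'].
have q12 : q1 < q2 by rewrite -(ltr_rat R); lra.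
have /cvgrPdist_le/(_ _ e50) := Fq _ _ q12.
apply: filterS2 Fm => mu' mm' h.
have s1 : `|inc (Mp_cum (mu' i)) v (ratr q1) x| <= e / 5.
  apply: le_trans (m_chain_single i mm' (isT : (0 < j)%N) vj (ltW q1b)) _.
  by apply: dth; rewrite subr_ge0 ltW//=; lra.
have s2 : `|inc (Mp_cum (mu' i)) v z (ratr q2)| <= e / 5.
  apply: le_trans (m_chain_single i mm' (isT : (0 < j)%N) vj (ltW q2a)) _.
  by apply: dth; rewrite subr_ge0 ltW//=; lra.
have s3 : `|inc (Mp_cum (mu i)) v (ratr q1) x| <= e / 5.
  apply: le_trans (fb_m fb i vj (ltW q1b)) _.
  apply: le_trans (ler_norm _) (m1 _ _); rewrite ger0_norm ?subr_ge0 ?ltW//; lra.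
have s4 : `|inc (Mp_cum (mu i)) v z (ratr q2)| <= e / 5.
  apply: le_trans (fb_m fb i vj (ltW q2a)) _.
  apply: le_trans (ler_norm _) _; rewrite distrC; apply: m2.
  by rewrite distrC ger0_norm ?subr_ge0 ?ltW//; lra.
move: h s1 s2 s3 s4; rewrite /inc !ler_norml.
move=> /andP[? ?] /andP[? ?] /andP[? ?] /andP[? ?] /andP[? ?].
by apply/andP; split; lra.
Qed.

(** The constants [C j] make the increments Lipschitz in the tag uniformly along the filter, so a
    nearby tag of [D] decides. *)
Lemma cvg_dense_tag (C : nat -> R) mu i (D : set V) x z :
  dense D -> (forall j, 0 <= C j) -> F (l_chain_bound C) -> x <= z ->
  (forall v, D v -> inc (Mp_cum (mu' i)) v x z @[mu' --> F]
     --> inc (Mp_cum (mu i)) v x z) ->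
  forall v, inc (Mp_cum (mu' i)) v x z @[mu' --> F] --> inc (Mp_cum (mu i)) v x z.
Proof.
move=> dD C0 Fl xz FD v; apply/cvgrPdist_le => e e0.
pose j := (Num.truncn (`|v| + 1)).+1.
have vj1 : `|v| + 1 <= j%:R by exact/ltW/truncnS_gt.
have [m [l fb]] := Mp_field mu (isT : (0 < j)%N).
have lxz : 0 <= l z - l x by rewrite subr_ge0 (fb_ndl fb).
have Cxz : 0 <= C j * (z - x + 1) by rewrite mulr_ge0// addr_ge0// subr_ge0.
pose r := Num.min 1 (e / (3 * (l z - l x + C j * (z - x + 1) + 1))).
have K0 : 0 < 3 * (l z - l x + C j * (z - x + 1) + 1) by lra.
have r0 : 0 < r by rewrite lt_min ltr01 divr_gt0.
have [w [Dw vw]] : exists w, D w /\ `|v - w| < r.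
  have [||w [bw Dw]] := dD (ball v r).
  - by exists v; exact: ballxx.
  - exact: ball_open.
  by exists w; split => //; move: bw; rewrite -ball_normE.
have wj : `|w| <= j%:R.
  have : `|v - w| < 1 by apply: lt_le_trans vw _; rewrite ge_min lexx.
  move=> h; rewrite -(subrK v w); apply: le_trans (ler_normD _ _) _.
  by rewrite distrC; lra.
have vj : `|v| <= j%:R by lra.
have small K : 0 <= K -> K <= l z - l x + C j * (z - x + 1) -> K * `|v - w| <= e / 3.
  move=> K1 K2; apply: le_trans (_ : K * r <= _); first by rewrite ler_wpM2l// ltW.
  apply: le_trans (_ : K * (e / (3 * (l z - l x + C j * (z - x + 1) + 1))) <= _).
    by rewrite ler_wpM2l// ge_min lexx orbT.
  rewrite mulrA ler_pdivrMr//.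
  have -> : e / 3 * (3 * (l z - l x + C j * (z - x + 1) + 1)) =
    (l z - l x + C j * (z - x + 1) + 1) * e by field.
  by rewrite ler_pM2r//; lra.
have e30 : 0 < e / 3 by lra.
have /cvgrPdist_le/(_ _ e30) := FD _ Dw.
apply: filterS2 Fl => mu' ll' h.
have s1 : `|inc (Mp_cum (mu' i)) v x z - inc (Mp_cum (mu' i)) w x z| <= e / 3.
  by apply: le_trans (l_chain_single i ll' (isT : (0 < j)%N) vj wj xz) (small _ Cxz _); lra.
have s2 : `|inc (Mp_cum (mu i)) v x z - inc (Mp_cum (mu i)) w x z| <= e / 3.
  by apply: le_trans (fb_l fb i vj wj xz) (small _ lxz _); lra.
move: h s1 s2; rewrite !ler_norml.
move=> /andP[? ?] /andP[? ?] /andP[? ?].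
by apply/andP; split; lra.
Qed.

Variable mu : MpN R N.
Hypothesis Fmu : forall i v x z, x <= z ->
  inc (Mp_cum (mu' i)) v x z @[mu' --> F] --> inc (Mp_cum (mu i)) v x z.

Lemma m_chain_lim : F (m_chain_bound th) -> m_chain_bound th mu.
Proof.
move=> Fm j a s b j0 Ps; apply: (csum_le_lim (F := F) (u := m_weight) Ps).
  by move=> [i v] x z xz; apply: cvg_norm; exact: Fmu.
by apply: filterS Fm => mu' mm'; exact: mm'.
Qed.

Lemma l_chain_lim C : F (l_chain_bound C) -> l_chain_bound C mu.
Proof.
move=> Fm j a s b j0 Ps; apply: (csum_le_lim (F := F) (u := l_weight) Ps).
  move=> [[i v] w] x z xz; apply: cvgMr_tmp.
  by apply: cvg_norm; apply: cvgB; exact: Fmu.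
by apply: filterS Fm => mu' mm'; exact: mm'.
Qed.

End Limits.
End ChainBounds.

(** * The seminorm topologies *)

Section SeminormTopology.
Variables (R : realType) (N : nat).
Local Notation raw := ('rV[R]_N -> set R -> R).
Variable P : set (raw -> \bar R).
Implicit Types (mu nu c : Mp R N).

Definition raw_sub (f g : raw) : raw := fun y A => f y A - g y A.

Lemma cvg_seminorm_ball (F : set_system (Mp_top P)) (mu : Mp_top P) : Filter F ->
  (forall i, seminorm_ball_dom P i -> @seminorm_ball _ _ P i mu ->
     F (@seminorm_ball _ _ P i)) -> F --> mu.
Proof.
move=> FF H A /=; rewrite nbhsE => -[_ [[B sB <-] [C BC Ct] sUBA]].
rewrite nbhs_filterE; apply: filterS sUBA _; apply: (@filterS _ _ _ C).
  by move=> ? ?; exists C.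
have /sB [D sD IDeC] := BC; rewrite -IDeC; apply: filter_bigI => E DE.
apply: H; first exact: set_mem (sD _ DE).
by move: Ct; rewrite -IDeC => /(_ _ DE).
Qed.

Lemma nbhs_seminorm_ball i (mu : Mp_top P) : seminorm_ball_dom P i ->
  @seminorm_ball _ _ P i mu -> nbhs mu (@seminorm_ball _ _ P i).
Proof.
move=> Di bi; rewrite nbhsE.
suff oB : open (@seminorm_ball _ _ P i) by exists (@seminorm_ball _ _ P i).
exists [set @seminorm_ball _ _ P i]; last by rewrite bigcup_set1.
move=> _ ->; exists [fset i]%fset; first by move=> k; rewrite inE => /eqP ->; exact: mem_set.
apply/seteqP; split=> nu; first by move=> /(_ i); apply; rewrite /= inE.
by move=> h k; rewrite /= inE => /eqP ->.
Qed.

Lemma cvg_MpN (F : set_system (MpN_top P)) (mu : MpN_top P) : Filter F ->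
  F --> mu <-> forall k, (fun nu : MpN_top P => nu k : Mp_top P) @ F --> (mu k : Mp_top P).
Proof.
move=> FF; split=> [Fmu k A /= Ak|Fk].
  have := (cvg_sup _ _ _).1 Fmu k; apply.
  exact: (@initial_continuous _ _ (fun nu : MpN_top P => nu k) mu A Ak).
apply/cvg_sup => k A.
have /= -> := @nbhsE (initial_topology (fun nu : MpN_top P => nu k : Mp_top P)) mu.
move=> -[B [[C oC <-] Cmu] sBA].
apply: filterS sBA _; apply: Fk; exact: open_nbhs_nbhs.
Qed.

Hypothesis subP : forall p mu nu c, P p ->
  (p (raw_sub nu c) <= p (raw_sub nu mu) + p (raw_sub mu c))%E.
Hypothesis P0 : forall p mu, P p -> p (raw_sub mu mu) = 0%E.
Hypothesis P_ge0 : forall p f, P p -> (0 <= p f)%E.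

(** Balls with arbitrary centres form the subbase; the triangle inequality reduces them to balls
    centred at [mu]. The distance from [mu] to another centre is finite because it is below the
    radius. The inequality is required on differences of elements of [Mp] only: [integral_Mp] is a
    chosen value and is additive where integrals exist. *)
Lemma cvg_seminorm (F : set_system (MpN_top P)) (mu : MpN_top P) : Filter F ->
  F --> mu <-> forall k p e, P p -> 0 < e ->
    \forall nu \near F, (p (raw_sub (nu k : Mp R N) (mu k : Mp R N)) < e%:E)%E.
Proof.
move=> FF; rewrite cvg_MpN; split=> Fmu k.
  move=> p e Pp e0; have := Fmu k (@seminorm_ball _ _ P (p, Mp_fun (mu k), e)).
  apply; apply: nbhs_seminorm_ball; first by split => //; exact: MpP.
  by rewrite /seminorm_ball/= (P0 (mu k) Pp) lte_fin.
apply: cvg_seminorm_ball => -[[p c] e] [/= Pp cP e0] /= mce.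
pose cc := MkMp cP.
have pfin : p (raw_sub (mu k : Mp R N) cc) \is a fin_num.
  by rewrite ge0_fin_numE ?P_ge0//; apply: lt_trans mce _; rewrite ltry.
have d0 : 0 < e - fine (p (raw_sub (mu k : Mp R N) cc)).
  by rewrite subr_gt0 -lte_fin fineK.
apply: filterS (Fmu k p _ Pp d0) => nu h; rewrite /seminorm_ball/=.
apply: le_lt_trans (subP (mu k : Mp R N) (nu k : Mp R N) cc Pp) _.
by rewrite -lteBrDr// (_ : (_ - _)%E = (e - fine (p (raw_sub (mu k : Mp R N) cc)))%:E)// EFinB fineK.
Qed.

End SeminormTopology.

Lemma chain_iota (R : realType) (T : Type) (P : T -> R -> R -> Prop)
    (g : nat -> R) (v : nat -> T) n :
  (forall i, (i < n)%N -> g i <= g i.+1 /\ P (v i) (g i) (g i.+1)) ->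
  chain P (g 0%N) [seq (g i.+1, v i) | i <- iota 0 n] (g n).
Proof.
move=> H; suff G m k : (k + m)%N = n ->
    chain P (g k) [seq (g i.+1, v i) | i <- iota k m] (g n) by exact: G.
elim: m k => [|m IH] k /=; first by rewrite addn0 => ->.
move=> km; have kn : (k < n)%N by rewrite -km addnS ltnS leq_addr.
by have [h1 h2] := H _ kn; split => //; apply: IH; rewrite addSn -addnS.
Qed.

Lemma csum_le_size (R : realType) (T : Type) (w : T -> R -> R -> R) (r : R) a s b :
  chain (fun v x z => w v x z <= r) a s b -> csum w a s <= (size s)%:R * r.
Proof.
elim: s a => [a _|p s IH a [_ wr /IH h]] /=; first by rewrite mul0r.
by rewrite -natr1 mulrDl mul1r addrC lerD.
Qed.

Section IntegralDifference.
Variables (R : realType) (N : nat).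
Local Notation V := 'rV[R]_N.
Implicit Types (mu c : Mp R N) (y : R -> V) (a b : R).

Lemma int_approx_unique F y a b J l l' L L' : a <= b ->
  {homo l : x z / x <= z} -> {homo l' : x z / x <= z} ->
  tame J y a b -> int_approx F y a b J l L -> int_approx F y a b J l' L' -> L = L'.
Proof.
move=> ab ndl ndl' [yu yJ] HL HL'.
apply/eqP; rewrite -subr_eq0 -normr_le0; apply/ler_addgt0Pr => e e0; rewrite add0r.
have C0 : 0 <= l b - l a by rewrite subr_ge0 ndl.
have C0' : 0 <= l' b - l' a by rewrite subr_ge0 ndl'.
pose eta := e / (2 * ((l b - l a) + (l' b - l' a) + 1)).
have eta0 : 0 < eta by rewrite divr_gt0// mulr_gt0//; lra.
have [|s Ps] := @exists_fine_chain _ _ y a b J eta (fun x _ => x) ab _ yu yJ eta0.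
  by move=> x z xz; rewrite lexx.
have {}Ps : chain (fine_tag y J eta) a s b.
  by apply: chain_sub Ps => v x z _ _ _ [].
have h1 := HL _ _ Ps; have h2 := HL' _ _ Ps.
have h3 : 2 * eta * ((l b - l a) + (l' b - l' a)) <= e.
  by apply: split_error => //; rewrite addr_ge0.
have p1 : 0 <= eta * (l b - l a) by rewrite mulr_ge0// ltW.
have p2 : 0 <= eta * (l' b - l' a) by rewrite mulr_ge0// ltW.
rewrite -(subrKA (csum (inc F) a s)) (le_trans (ler_normD _ _))// distrC.
by rewrite -mulrA !mulrDr in h3; lra.
Qed.

(** [raw_sub] is a bare function without bounds of its own. With the bound [l + l'] the difference
    of the integrals satisfies the estimate that characterizes its integral. *)
Lemma integral_Mp_sub mu c j y a b : (0 < j)%N -> a <= b -> tame j%:R y a b ->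
  integral_Mp (raw_sub mu c) y a b = integral_Mp mu y a b - integral_Mp c y a b.
Proof.
move=> j0 ab yt.
have [[m l] /= [_ _ ndl _ lipl]] := Mp_field1 mu j0.
have [[m' l'] /= [_ _ ndl' _ lipl']] := Mp_field1 c j0.
pose G v x := Mp_cum mu v x - Mp_cum c v x.
have cG : cum_of (raw_sub mu c) G.
  by move=> v x z xz; rewrite /raw_sub !cum_of_Mp// /G; ring.
have incG v x z : inc G v x z = inc (Mp_cum mu) v x z - inc (Mp_cum c) v x z.
  by rewrite /inc /G; ring.
have ndll : {homo (fun x => l x + l' x) : x z / x <= z}.
  by move=> x z xz; rewrite lerD ?ndl ?ndl'.
have lipG : lip_inc G j%:R (fun x => l x + l' x).
  move=> v w x z vj wj xz; rewrite !incG.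
  have h1 := lipl _ _ _ _ vj wj xz; have h2 := lipl' _ _ _ _ vj wj xz.
  have -> : (l z + l' z - (l x + l' x)) * `|v - w| =
    (l z - l x) * `|v - w| + (l' z - l' x) * `|v - w| by ring.
  apply: le_trans (lerD h1 h2); apply: le_trans (ler_normB _ _).
  by rewrite le_eqVlt; apply/orP; left; apply/eqP; congr (`|_|); ring.
apply: (int_approx_unique ab ndll ndll yt).
  exact: (tame_int cG ndll lipG ab yt).
move=> eta s Ps.
have -> : csum (inc G) a s = csum (inc (Mp_cum mu)) a s - csum (inc (Mp_cum c)) a s.
  by rewrite -csumB; apply: csum_eq Ps => v x z _; exact: incG.
have h1 := tame_int (cum_of_Mp mu) ndl lipl ab yt Ps.
have h2 := tame_int (cum_of_Mp c) ndl' lipl' ab yt Ps.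
have -> : eta * (l b + l' b - (l a + l' a)) = eta * (l b - l a) + eta * (l' b - l' a) by ring.
apply: le_trans (lerD h1 h2); apply: le_trans (ler_normB _ _).
by rewrite le_eqVlt; apply/orP; left; apply/eqP; congr (`|_|); ring.
Qed.

Lemma integral_Mp_const mu (v : V) a b : a <= b ->
  integral_Mp mu (fun=> v) a b = inc (Mp_cum mu) v a b.
Proof.
move=> ab; pose j := (Num.truncn `|v|).+1.
have vj : `|v| <= j%:R by exact/ltW/truncnS_gt.
have [[m l] /= [_ _ ndl _ lipl]] := Mp_field1 mu (isT : (0 < j)%N).
have vt : tame j%:R (fun=> v) a b.
  by split=> // e e0; exists 1 => // s t _ _ _; rewrite subrr normr0 ltW.
apply/eqP; rewrite -subr_eq0 -normr_le0.
have := @int_near_const _ _ _ _ _ _ (cum_of_Mp mu) ndl lipl (fun=> v) v 0 _ _ ab vt vj.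
by rewrite mul0r; apply => s _; rewrite subrr normr0.
Qed.

End IntegralDifference.

(** * Convergence in the two families of seminorms *)

Section SigmaTopologies.
Variables (R : realType) (N : nat).
Local Notation V := 'rV[R]_N.
Variables (Theta : moduli R) (th : nat -> R -> R).
Hypothesis Hth : modulus_family th.
Hypothesis ThetaE : forall j q1 q2 s, q1 < q2 -> Theta j q1 q2 s = th j s.
Implicit Types (mu nu : MpN R N) (y : R -> V) (v : V) (q : rat).

Local Notation STh := (@sigma_Theta R N Theta).

Lemma Kset_tame j q1 q2 y : Kset Theta j q1 q2 y -> tame j%:R y (ratr q1) (ratr q2).
Proof. by move=> [yc yj _]; split=> //; exact: within_ucont. Qed.

Lemma tame_Kset j q1 q2 y : q1 < q2 -> tame j%:R y (ratr q1) (ratr q2) ->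
  (forall s t, ratr q1 <= s -> s <= t -> t <= ratr q2 -> `|y t - y s| <= th j (t - s)) ->
  Kset Theta j q1 q2 y.
Proof.
move=> q12 [yu yj] yth; split; [exact: ucont_within|exact: yj|].
move=> s t /=; rewrite !in_itv/= => /andP[s1 s2] /andP[t1 t2]; rewrite ThetaE//.
have [st|/ltW ts] := leP s t.
  by rewrite distrC [X in th j X]distrC [X in th j X]ger0_norm ?subr_ge0// yth.
by rewrite [X in th j X]ger0_norm ?subr_ge0// yth.
Qed.

Lemma Kset_const j q1 q2 v : (0 < j)%N -> q1 < q2 -> `|v| <= j%:R ->
  Kset Theta j q1 q2 (fun=> v).
Proof.
move=> j0 q12 vj; apply: tame_Kset => //; last first.
  move=> s t _ st _; rewrite subrr normr0.
  by have [h _ _] := Hth j0; rewrite h// subr_ge0.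
by split=> // e e0; exists 1 => // s t _ _ _; rewrite subrr normr0 ltW.
Qed.

Let ratr_le (q1 q2 : rat) : q1 < q2 -> ratr q1 <= ratr q2 :> R.
Proof. by move=> q12; rewrite ler_rat ltW. Qed.

Lemma sigma_Theta_lt (mu c : Mp R N) j q1 q2 e : (0 < j)%N -> q1 < q2 ->
  (sigma_Theta_seminorm Theta j q1 q2 (raw_sub mu c) < e%:E)%E ->
  forall y, Kset Theta j q1 q2 y ->
  `|integral_Mp mu y (ratr q1) (ratr q2) - integral_Mp c y (ratr q1) (ratr q2)| < e.
Proof.
move=> j0 q12 + y yK; rewrite -lte_fin; apply: le_lt_trans.
rewrite -(integral_Mp_sub mu c j0 (ratr_le q12) (Kset_tame yK)).
by apply: ereal_sup_ubound; exists y.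
Qed.

Lemma sigma_Theta_le (mu c : Mp R N) j q1 q2 (e : \bar R) : (0 < j)%N -> q1 < q2 ->
  (forall y, Kset Theta j q1 q2 y ->
  (`|integral_Mp mu y (ratr q1) (ratr q2) - integral_Mp c y (ratr q1) (ratr q2)|%:E <= e)%E) ->
  (sigma_Theta_seminorm Theta j q1 q2 (raw_sub mu c) <= e)%E.
Proof.
move=> j0 q12 H; apply: ge_ereal_sup => _ [y yK <-].
by rewrite (integral_Mp_sub mu c j0 (ratr_le q12) (Kset_tame yK)); exact: H.
Qed.

Lemma cvg_sigma_Theta (F : set_system (MpN R N)) (mu : MpN R N) : Filter F ->
  (F : set_system (MpN_top STh)) --> (mu : MpN_top STh) <->
  forall k j q1 q2 e, (0 < j)%N -> q1 < q2 -> 0 < e ->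
    \forall nu \near F, forall y, Kset Theta j q1 q2 y ->
      `|integral_Mp ((nu : MpN R N) k) y (ratr q1) (ratr q2)
        - integral_Mp (mu k) y (ratr q1) (ratr q2)| <= e.
Proof.
move=> FF.
have ge0 p f : STh p -> (0 <= p f)%E.
  move=> [j [q1 [q2 [j0 q12 ->]]]].
  (* The zero curve keeps the supremum from running over an empty set, where it would be [-oo]. *)
  have K0 := @Kset_const j q1 q2 0 j0 q12; rewrite normr0 in K0.
  apply: (@le_trans _ _ `|integral_Mp f (fun=> 0) (ratr q1) (ratr q2)|%:E).
    by rewrite lee_fin.
  by apply: ereal_sup_ubound; exists (fun=> 0) => //; exact: K0.
have sub p (mu' nu c : Mp R N) : STh p ->
    (p (raw_sub nu c) <= p (raw_sub nu mu') + p (raw_sub mu' c))%E.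
  move=> [j [q1 [q2 [j0 q12 ->]]]]; apply: sigma_Theta_le => // y yK.
  have yt := Kset_tame yK; have q12R := ratr_le q12.
  have B (f g : Mp R N) : (`|integral_Mp f y (ratr q1) (ratr q2) -
      integral_Mp g y (ratr q1) (ratr q2)|%:E <=
      sigma_Theta_seminorm Theta j q1 q2 (raw_sub f g))%E.
    rewrite -(integral_Mp_sub f g j0 q12R yt).
    by apply: ereal_sup_ubound; exists y.
  apply: le_trans (leeD (B nu mu') (B mu' c)).
  by rewrite -EFinD lee_fin -(subrKA (integral_Mp mu' y (ratr q1) (ratr q2))) ler_normD.
have z0 p (mu' : Mp R N) : STh p -> p (raw_sub mu' mu') = 0%E.
  move=> Pp; apply/eqP; rewrite eq_le ge0// andbT.
  case: Pp => [j [q1 [q2 [j0 q12 ->]]]]; apply: sigma_Theta_le => // y yK.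
  by rewrite subrr normr0.
rewrite (cvg_seminorm sub z0 ge0); split=> H k.
  move=> j q1 q2 e j0 q12 e0.
  have := H k (sigma_Theta_seminorm Theta j q1 q2) e; move=> /(_ _ e0) h.
  have {}h := h (ex_intro _ j (ex_intro _ q1 (ex_intro _ q2 (And3 j0 q12 erefl)))).
  by apply: filterS h => nu h y yK; apply/ltW; exact: sigma_Theta_lt h y yK.
move=> _ e [j [q1 [q2 [j0 q12 ->]]]] e0.
have e20 : 0 < e / 2 by lra.
apply: filterS (H k j q1 q2 (e / 2) j0 q12 e20) => nu h.
apply: (@le_lt_trans _ _ (e / 2)%:E); last by rewrite lte_fin; lra.
by apply: sigma_Theta_le => // y yK; rewrite lee_fin; exact: h.
Qed.

Lemma cvg_sigma_D (D : set V) (F : set_system (MpN R N)) (mu : MpN R N) : Filter F ->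
  (F : set_system (MpN_top (sigma_D D))) --> (mu : MpN_top (sigma_D D)) <->
  forall k v q1 q2, D v -> q1 < q2 ->
    inc (Mp_cum (nu k)) v (ratr q1) (ratr q2) @[nu --> F] -->
    inc (Mp_cum (mu k)) v (ratr q1) (ratr q2).
Proof.
move=> FF.
have ge0 p f : sigma_D D p -> (0 <= p f)%E.
  by move=> [v [q1 [q2 [Dv q12 ->]]]]; rewrite /sigma_D_seminorm lee_fin.
have sub p (mu' nu c : Mp R N) : sigma_D D p ->
    (p (raw_sub nu c) <= p (raw_sub nu mu') + p (raw_sub mu' c))%E.
  move=> [v [q1 [q2 [Dv q12 ->]]]]; rewrite /sigma_D_seminorm -EFinD lee_fin /raw_sub.
  by rewrite -(subrKA (mu' v `[ratr q1, ratr q2]%classic)) ler_normD.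
have z0 p (mu' : Mp R N) : sigma_D D p -> p (raw_sub mu' mu') = 0%E.
  move=> [v [q1 [q2 [Dv q12 ->]]]]; rewrite /sigma_D_seminorm /raw_sub.
  by rewrite subrr normr0.
rewrite (cvg_seminorm sub z0 ge0); split=> H k.
  move=> v q1 q2 Dv q12; apply/cvgrPdist_lt => e e0.
  have := H k (sigma_D_seminorm v q1 q2) e; move=> /(_ _ e0) h.
  have {}h := h (ex_intro _ v (ex_intro _ q1 (ex_intro _ q2 (And3 Dv q12 erefl)))).
  apply: filterS h => nu; rewrite lte_fin distrC !inc_Mp ?ratr_le//.
move=> _ e [v [q1 [q2 [Dv q12 ->]]]] e0.
have /cvgrPdist_lt/(_ _ e0) := H k v q1 q2 Dv q12.
by apply: filterS => nu; rewrite !inc_Mp ?ratr_le// distrC lte_fin.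
Qed.

(** Constant curves lie in [Kset] as soon as [j] bounds their norm, and their integrals are the
    increments. *)
Lemma cvg_Theta_cvg_inc (F : set_system (MpN R N)) (mu : MpN R N) : Filter F ->
  (F : set_system (MpN_top STh)) --> (mu : MpN_top STh) ->
  forall k v q1 q2, q1 < q2 ->
    inc (Mp_cum (nu k)) v (ratr q1) (ratr q2) @[nu --> F] -->
    inc (Mp_cum (mu k)) v (ratr q1) (ratr q2).
Proof.
move=> FF /(cvg_sigma_Theta mu FF) H k v q1 q2 q12; apply/cvgrPdist_le => e e0.
pose j := (Num.truncn `|v|).+1.
have vj : `|v| <= j%:R by exact/ltW/truncnS_gt.
have := H k j q1 q2 e isT q12 e0; apply: filterS => nu /(_ (fun=> v)).
rewrite !integral_Mp_const ?ratr_le// distrC; apply.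
exact: Kset_const.
Qed.

(** Centres taken from [D] may leave the ball of radius [j], but by less than [eta <= 1]. This is
    why the ball of radius [j.+1] appears in the estimates that use the net. *)
Lemma ball_net (D : set V) j (eta : R) : dense D -> 0 < eta -> eta <= 1 ->
  exists D' : {fset V}, (forall d, d \in D' -> D d /\ `|d| <= j.+1%:R) /\
    forall v, `|v| <= j%:R -> exists2 d, d \in D' & `|d - v| < eta.
Proof.
move=> dD eta0 eta1.
have : compact [set v : V | `|v| <= j%:R].
  apply: bounded_closed_compact.
    exists j%:R; split; first exact: num_real.
    by move=> x jx v /= vj; apply: le_trans vj (ltW jx).
  by apply: (closed_comp (f := fun v : V => `|v|)) (@closed_le _ _) => v _; exact: norm_continuous.
rewrite compact_cover => /(_ V (D `&` [set d | `|d| <= j.+1%:R]) (fun d => ball d eta)).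
case=> [d _|v /= vj|D' D'D cov].
- exact: ball_open.
- have [||w [bw Dw]] := dD (ball v eta).
  + by exists v; exact: ballxx.
  + exact: ball_open.
  exists w; last exact: ball_sym.
  split=> //=; move: bw; rewrite -ball_normE /= => h.
  rewrite -(subrK v w) (le_trans (ler_normD _ _))// distrC -natr1; lra.
exists D'; split=> [d /D'D/set_mem[]//|v vj].
have [d dD' bd] := cov v vj; exists d => //.
by move: bd; rewrite -ball_normE.
Qed.

End SigmaTopologies.

Lemma le_measure_itv (R : realType) (m : {measure set (measurableTypeR R) -> \bar R})
    (a b c : R) : b <= c -> (m `[a, b]%classic <= m `[a, c]%classic)%E.
Proof.
move=> bc; apply: le_measure; rewrite ?inE.
- exact: (mem_set (measurable_itvR `[a, _])).
- exact: (mem_set (measurable_itvR `[a, _])).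
- by move=> z /=; rewrite !in_itv/= => /andP[-> zs]/=; exact: le_trans bc.
Qed.

(** * The moduli theta and the chain bounds of the initial field *)

Section AssociatedModuli.
Variables (R : realType) (N : nat).
Variable m : nat -> {measure set (measurableTypeR R) -> \bar R}.
Hypothesis equi : equicontinuous_translates m.
Implicit Types (a b c e s t : R).

Definition sup_modulus (j : nat) (s : R) : R :=
  fine (ereal_sup [set x | exists t : R, x = m j `[t, t + s]%classic]).

(** The supremum over all translates absorbs the position of [t] in [I], so the modulus is the same
    for every nonempty [I]. Shifted curves can thus be tested on other intervals. *)
Lemma associated_moduliE j q1 q2 s : q1 < q2 ->
  associated_moduli m j q1 q2 s = sup_modulus j s.
Proof.
move=> q12; rewrite /associated_moduli /sup_modulus; congr (fine (ereal_sup _)).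
apply/seteqP; split=> x.
  move=> [t [tau [_ ->]]]; exists (t + tau).
  by rewrite /translate_measure translate_itv addrAC.
move=> [t ->]; exists (ratr q1), (t - ratr q1); split.
  by rewrite /= in_itv/= lexx ler_rat ltW.
rewrite /translate_measure translate_itv.
have -> : ratr q1 + (t - ratr q1) = t by ring.
by have -> : ratr q1 + s + (t - ratr q1) = t + s by ring.
Qed.

Lemma equi_itv j e : (0 < j)%N -> 0 < e -> exists2 d, 0 < d &
  forall a b, 0 <= b - a < d -> (m j `[a, b]%classic < e%:E)%E.
Proof.
move=> j0 e0; have [d d0 dP] := equi j0 e0; exists d => // a b /(dP 0).
by rewrite /translate_measure translate_set0.
Qed.

(** Null points and finite mass are drawn from equicontinuity itself: for [N = 0] there is no
    component through which [common_m_bounds] could say anything about [m]. *)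
Lemma equi_cum j : (0 < j)%N -> exists c : R -> R,
  forall a b, a <= b -> m j `[a, b]%classic = (c b - c a)%:E.
Proof.
move=> j0.
have m0 (t : R) : m j ([set t] : set R) = 0%E.
  apply/eqP; rewrite eq_le measure_ge0 andbT; apply/lee_addgt0Pr => e e0.
  have [d d0 dP] := equi_itv j0 e0; rewrite add0e -set_itv1.
  by apply/ltW/dP; rewrite subrr lexx.
have mfin a b : a <= b -> m j `[a, b]%classic \is a fin_num.
  move=> ab; rewrite ge0_fin_numE//.
  have [d d0 dP] := equi_itv j0 ltr01.
  have d20 : 0 < d / 2 by lra.
  have [x z _ _ _ zx|s Ps] := @mesh_chain R unit (fun _ x z => z - x < d) _ a b d20 ab.
    by exists tt; lra.
  elim: s a {ab} Ps => [a /= <-|p s IH a /= [ap pd Ps]].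
    by rewrite set_itv1 m0.
  rewrite (measure_itv_split m0 ap (chain_le Ps)) lte_add_pinfty ?IH//.
  by apply: lt_trans (dP _ _ _) (ltry 1); rewrite subr_ge0 ap.
exists (cum (fun x z => fine (m j `[x, z]%classic))) => a b ab.
rewrite -(cumE (h := fun x z => fine (m j `[x, z]%classic)) ab) ?fineK ?mfin//.
move=> a' b' c' ab' bc'.
by rewrite -fineD ?mfin//= (measure_itv_split m0 ab' bc').
Qed.

(** The supremum is finite, so [fine] loses nothing: an interval of length [s] splits into [n]
    pieces of length at most [d / 2], each of mass at most 1. *)
Lemma sup_modulusP j s : (0 < j)%N -> 0 <= s ->
  (sup_modulus j s)%:E = ereal_sup [set x | exists t : R, x = m j `[t, t + s]%classic].
Proof.
move=> j0 s0; rewrite fineK// fin_real//; apply/andP; split.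
  apply: (@lt_le_trans _ _ (m j `[0, 0 + s]%classic)).
    by apply: lt_le_trans (measure_ge0 _ _); rewrite ltNy0.
  by apply: ereal_sup_ubound; exists 0.
have [c cE] := equi_cum j0; have [d d0 dP] := equi_itv j0 ltr01.
have d20 : 0 < d / 2 by lra.
have [n sn] : exists n : nat, s <= n%:R * (d / 2).
  exists (Num.truncn (s / (d / 2))).+1; rewrite -ler_pdivrMr//.
  by rewrite ltW// truncnS_gt.
apply: (@le_lt_trans _ _ n%:R%:E); last by rewrite ltry.
apply: ge_ereal_sup => _ [t ->].
rewrite cE ?lerDl// lee_fin.
have step x z : x <= z -> z - x <= d / 2 -> c z - c x <= 1.
  move=> xz zx; rewrite -lee_fin -cE//; apply/ltW/dP; rewrite subr_ge0 xz/=; lra.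
have ndc x z : x <= z -> c x <= c z by move=> xz; rewrite -subr_ge0 -lee_fin -cE.
elim: n s s0 t sn => [|n IH] s s0 t.
  by rewrite mul0r => sn; have -> : s = 0 by [lra]; rewrite addr0 subrr.
rewrite -natr1 mulrDl mul1r => sn; have [sd|ds] := leP s (d / 2).
  have := step t (t + s); rewrite lerDl addrC addKr => /(_ s0 sd) h.
  by apply: le_trans h _; rewrite lerDr.
have s1 : 0 <= s - d / 2 by lra.
have := IH _ s1 t; rewrite lerBlDr => /(_ sn) h1.
have := step (t + (s - d / 2)) (t + s); rewrite lerD2l => h2.
have : c (t + s) - c (t + (s - d / 2)) <= 1 by apply: h2; lra.
lra.
Qed.

Lemma sup_modulus_ub j a b : (0 < j)%N -> a <= b ->
  (m j `[a, b]%classic <= (sup_modulus j (b - a))%:E)%E.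
Proof.
move=> j0 ab; rewrite sup_modulusP ?subr_ge0//; apply: ereal_sup_ubound.
by exists a; rewrite addrC subrK.
Qed.

Lemma modulus_family_sup : modulus_family sup_modulus.
Proof.
move=> j j0; split.
- move=> s s0; have := sup_modulus_ub j0 s0; rewrite subr0 -lee_fin.
  exact: le_trans (measure_ge0 _ _).
- move=> s t s0 st; rewrite -lee_fin !sup_modulusP//; last exact: le_trans st.
  apply: ge_ereal_sup => _ [x ->].
  apply: (@le_trans _ _ (m j `[x, x + t]%classic)); last by apply: ereal_sup_ubound; exists x.
  by apply: le_measure_itv; rewrite lerD2l.
- move=> e e0; have [d d0 dP] := equi_itv j0 e0; exists d => // s /andP[s0 sd].
  rewrite -lee_fin sup_modulusP//; apply: ge_ereal_sup => _ [t ->].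
  by apply/ltW/dP; rewrite addrC addKr s0.
Qed.

Lemma common_m_chain_bound (nu0 : MpN R N) :
  common_m_bounds nu0 m -> m_chain_bound sup_modulus nu0.
Proof.
move=> nu0m j a s b j0 Ps; have [c cE] := equi_cum j0.
have ab := chain_le Ps.
apply: (@le_trans _ _ (c b - c a)); last by rewrite -lee_fin -cE// sup_modulus_ub.
apply: csum_le_telescope Ps => -[i v] x z _ xz _ /= vj.
rewrite -lee_fin -cE//; exact: m_bound_inc (nu0m j j0 i) vj xz.
Qed.

End AssociatedModuli.

Lemma common_l_chain_bound (R : realType) (N : nat) (nu0 : MpN R N) :
  has_bounded_l_bounds nu0 -> exists C : nat -> R,
    (forall j, 0 <= C j) /\ l_chain_bound C nu0.
Proof.
move=> [l nu0l lb].
have /choice[C CP] : forall j, exists c : R, 0 <= c /\ ((0 < j)%N ->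
    forall s, (l j `[s, (s + 1)%R]%classic <= c%:E)%E).
  move=> [|j]; first by exists 0.
  have [c c0 cP] := lb j.+1 isT; exists c; split=> [|_ s]; first exact: ltW.
  by have := cP s 0; rewrite /translate_measure translate_set0.
exists C; split=> [j|]; first by have [] := CP j.
move=> j a s b j0 Ps; have ab := chain_le Ps.
(* Without components the l-bounds say nothing about [l], but then there are no tags either and the
   chain is empty. *)
have [i0|i0] := pselect (inhabited 'I_N); last first.
  case: s Ps => [_|[? [[i ?] ?]] s] /=; last by exfalso; apply: i0.
  by rewrite mulr_ge0 ?(CP j).1// addr_ge0// subr_ge0.
have [i] := i0; have [cl [_ ndl clE]] := Mc_plus_cum (nu0l j j0 i).1.
have clC x : cl (x + 1) - cl x <= C j.
  rewrite -lee_fin -clE; last by rewrite lerDl.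
  exact: (CP j).2.
apply: (@le_trans _ _ (cl b - cl a)).
  apply: csum_le_telescope Ps => -[[k v] w] x z _ xz _ /= [vj wj].
  rewrite /l_weight/=; have [->|vw] := eqVneq v w.
    by rewrite !subrr normr0 mul0r subr_ge0 ndl.
  rewrite ler_pdivrMr ?normr_gt0 ?subr_eq0// -lee_fin EFinM -clE//.
  exact: l_bound_inc (nu0l j j0 k) vj wj xz.
have [n bn] : exists n : nat, b - a <= n%:R by exists (Num.truncn (b - a)).+1; rewrite ltW// truncnS_gt.
have {bn n} : exists n : nat, b - a <= n%:R /\ n%:R <= b - a + 1.
  exists (Num.truncn (b - a)).+1; split; first by rewrite ltW// truncnS_gt.
  by rewrite -natr1 lerD2r truncn_le// subr_ge0.
move=> [n [bn nb]].
suff H k x : cl (x + k%:R) - cl x <= C j * k%:R.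
  have h1 : cl b <= cl (a + n%:R) by apply: ndl; lra.
  have h2 : C j * n%:R <= C j * (b - a + 1) by rewrite ler_wpM2l// (CP j).1.
  have := H n a; lra.
elim: k => [|k IH]; first by rewrite addr0 subrr mulr0.
rewrite -natr1 addrA mulrDr mulr1; have := clC (x + k%:R); lra.
Qed.

(** * From convergence at dense tags to uniform convergence on [Kset] *)

Section UniformLipschitz.
Variables (R : realType) (N : nat).
Local Notation V := 'rV[R]_N.
Variables (Theta : moduli R) (th : nat -> R -> R).
Hypothesis Hth : modulus_family th.
Hypothesis ThetaE : forall j q1 q2 s, q1 < q2 -> Theta j q1 q2 s = th j s.
Variable C : nat -> R.
Hypothesis C0 : forall j, 0 <= C j.
Local Notation STh := (@sigma_Theta R N Theta).

(* Along one fine subdivision, finitely many tags taken in [D] approximate the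
   integrals of all curves of [Kset] at once. *)
Lemma cvg_Theta_of_dense (D : set V) (F : set_system (MpN R N)) (mu : MpN R N) :
  Filter F -> dense D -> F (l_chain_bound C) -> l_chain_bound C mu ->
  (forall k v q1 q2, D v -> q1 < q2 ->
    inc (Mp_cum (nu k)) v (ratr q1) (ratr q2) @[nu --> F] -->
    inc (Mp_cum (mu k)) v (ratr q1) (ratr q2)) ->
  (F : set_system (MpN_top STh)) --> (mu : MpN_top STh).
Proof.
move=> FF dD Fl mul FD; apply/(cvg_sigma_Theta Hth ThetaE mu FF).
move=> k j q1 q2 e j0 q12 e0.
pose a : R := ratr q1; pose b : R := ratr q2.
have ab : a < b by rewrite ltr_rat.
pose M := C j.+1 * (b - a + 1).
have M0 : 0 <= M by rewrite mulr_ge0// addr_ge0// subr_ge0 ltW.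
(* Each of the two integrals is approximated within [2 * eta * M], together at most [e / 2]; the
   remaining half is shared by the [n] increments, whence [r] below. *)
pose eta := Num.min 1 (e / (8 * (M + 1))).
have eta0 : 0 < eta by rewrite lt_min ltr01 divr_gt0// mulr_gt0//; lra.
have eta1 : eta <= 1 by rewrite ge_min lexx.
have etaM : 4 * (eta * M) <= e / 2.
  have : eta * M <= e / (8 * (M + 1)) * M by rewrite ler_wpM2r// ge_min lexx orbT.
  have : e / (8 * (M + 1)) * M <= e / 8.
    rewrite mulrAC ler_pdivrMr; last by rewrite mulr_gt0//; lra.
    have -> : e / 8 * (8 * (M + 1)) = e * (M + 1) by field.
    by rewrite ler_pM2l//; lra.
  lra.
have [D' [D'D D'net]] := ball_net j dD eta0 eta1.
have [_ _ /(_ _ eta0)[d d0 thd]] := Hth j0.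
pose n := (Num.truncn ((b - a) / d)).+1.
have n0 : (0 : rat) < n%:R by rewrite ltr0n.
have n0R : (0 : R) < n%:R by rewrite ltr0n.
(* The grid is rational, so that its intervals are among those of the seminorms. *)
pose q i : rat := q1 + i%:R * ((q2 - q1) / n%:R).
pose g i : R := ratr (q i).
have gE i : g i = a + i%:R * ((b - a) / n%:R).
  by rewrite /g /q rmorphD rmorphM fmorph_div rmorphB !rmorph_nat.
have qlt i : q i < q i.+1.
  by rewrite /q ltrD2l ltr_pM2r ?ltr_nat// divr_gt0// subr_gt0.
have h0 : 0 < (b - a) / n%:R by rewrite divr_gt0// subr_gt0.
have hd : (b - a) / n%:R < d by rewrite ltr_pdivrMr// mulrC -ltr_pdivrMr// truncnS_gt.
have gS i : g i.+1 = g i + (b - a) / n%:R by rewrite !gE -natr1; ring.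
have g0 : g 0%N = a by rewrite gE mul0r addr0.
have gn : g n = b by rewrite gE mulrC divfK ?gt_eqF// addrC subrK.
pose r := e / (2 * n%:R).
have r0 : 0 < r by rewrite divr_gt0// mulr_gt0.
(* The conditions are finitely many, one for each net point and grid interval, and do not mention
   the curve; they hold along the filter before [y] is chosen. *)
have near_net : \forall nu \near F, forall (v : D') (i : 'I_n),
    `|inc (Mp_cum ((nu : MpN R N) k)) (val v) (g i) (g i.+1)
      - inc (Mp_cum (mu k)) (val v) (g i) (g i.+1)| <= r.
  apply: filter_forall => v; apply: filter_forall => i.
  have /cvgrPdist_le/(_ _ r0) := FD k (val v) (q i) (q i.+1) (D'D _ (valP v)).1 (qlt i).
  by apply: filterS => nu; rewrite distrC.
apply: filterS2 near_net Fl => nu nuD nul y yK.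
have yt := Kset_tame yK.
have {}yt : tame j.+1%:R y a b by apply: tameS yt; rewrite ler_nat.
have [m [l [fb lM]]] := l_chain_field nul (isT : (0 < j.+1)%N) (C0 _).
have [m' [l' [fb' lM']]] := l_chain_field mul (isT : (0 < j.+1)%N) (C0 _).
have gab i : (i <= n)%N -> a <= g i <= b.
  move=> i_n; rewrite gE lerDl mulr_ge0 ?ler0n ?(ltW h0)//= -lerBrDl.
  apply: (@le_trans _ _ (n%:R * ((b - a) / n%:R))).
    by apply: ler_wpM2r; [exact: ltW|rewrite ler_nat].
  by rewrite mulrC divfK ?gt_eqF.
have /choice[v vP] : forall i : nat, exists v : V, (i <= n)%N -> v \in D' /\ `|v - y (g i)| < eta.
  move=> i; case: (leqP i n) => [i_n|]; last by exists 0.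
  have [_ yj _] := yK; have [|v ? ?] := D'net (y (g i)); last by exists v.
  by apply: yj; rewrite /= in_itv/=; exact: gab.
pose s := [seq (g i.+1, v i) | i <- iota 0 n].
(* One [eta] is the distance to the net point, the other the oscillation of [y] over a grid step,
   which is shorter than [d]. *)
pose P (w : V) x z := fine_tag y j.+1%:R (2 * eta) w x z /\
  `|inc (Mp_cum (nu k)) w x z - inc (Mp_cum (mu k)) w x z| <= r.
have Ps : chain P a s b.
  rewrite -g0 -gn; apply: chain_iota => i i_n; split.
    by rewrite gS lerDl ltW.
  have [vD' vy] := vP i (ltnW i_n); split; last exact: (nuD (FSetSub vD') (Ordinal i_n)).
  split; first exact: (D'D _ vD').2.
  move=> t /andP[t1 t2]; rewrite -(subrKA (y (g i))) (le_trans (ler_normD _ _))//.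
  have gi := gab i (ltnW i_n); have gi1 := gab i.+1 i_n.
  have : `|y (g i) - y t| <= eta.
    have [_ _ yth] := yK; apply: le_trans (yth (g i) t _ _) _.
    - by rewrite /= in_itv/=.
    - rewrite /= in_itv/=; case/andP: gi => h1 _; case/andP: gi1 => _ h2.
      by rewrite (le_trans h1 t1) (le_trans t2 h2).
    - rewrite ThetaE//; apply: thd; rewrite normr_ge0/= distrC ger0_norm ?subr_ge0//.
      by move: t2; rewrite gS; lra.
  lra.
have Ps1 : chain (fine_tag y j.+1%:R (2 * eta)) a s b.
  by apply: chain_sub Ps => w x z _ _ _ [].
have c1 := tame_int (cum_of_Mp (nu k)) (fb_ndl fb) (fb_l fb k) (ltW ab) yt Ps1.
have c2 := tame_int (cum_of_Mp (mu k)) (fb_ndl fb') (fb_l fb' k) (ltW ab) yt Ps1.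
have c3 : `|csum (inc (Mp_cum (nu k))) a s - csum (inc (Mp_cum (mu k))) a s| <= n%:R * r.
  rewrite -csumB (le_trans (ler_norm_csum _ _ _))//.
  have -> : n = size s by rewrite size_map size_iota.
  apply: (csum_le_size (b := b)); apply: chain_sub Ps => w x z _ _ _ [_]; exact.
have nr : n%:R * r = e / 2 by rewrite /r; field; rewrite gt_eqF.
have b1 : 2 * eta * (l b - l a) <= 2 * (eta * M).
  by rewrite -mulrA ler_pM2l// ler_pM2l// lM// ltW.
have b2 : 2 * eta * (l' b - l' a) <= 2 * (eta * M).
  by rewrite -mulrA ler_pM2l// ler_pM2l// lM'// ltW.
rewrite -/a -/b; move: c1 c2 c3; rewrite nr !ler_norml.
move=> /andP[? ?] /andP[? ?] /andP[? ?]; apply/andP; split; lra.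
Qed.

End UniformLipschitz.

(** * Dynamics on the hull *)

Section HullDynamics.
Variables (R : realType) (N : nat).
Local Notation V := 'rV[R]_N.
Variables (Theta : moduli R) (th : nat -> R -> R).
Hypothesis Hth : modulus_family th.
Hypothesis ThetaE : forall j q1 q2 s, q1 < q2 -> Theta j q1 q2 s = th j s.
Local Notation STh := (@sigma_Theta R N Theta).
Implicit Types (mu nu : MpN R N) (y f g : R -> V) (v : V) (a b c e s t : R) (q : rat).

Lemma int_cat_any mu j k y (p q : R) a b c : (0 < j)%N -> tame j%:R y p q ->
  p <= a <= q -> p <= b <= q -> p <= c <= q ->
  integral_Mp (mu k) y a c = integral_Mp (mu k) y a b + integral_Mp (mu k) y b c.
Proof.
move=> j0 yt pa pb pc; have [m [l fb]] := Mp_field mu j0.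
by have := vint_cat fb yt pa pb pc; move/rowP/(_ k); rewrite !mxE.
Qed.

Lemma m_chain_int_any mu j k y (p q : R) a b : (0 < j)%N -> m_chain_bound th mu ->
  tame j%:R y p q -> p <= a <= q -> p <= b <= q ->
  `|integral_Mp (mu k) y a b| <= th j `|a - b|.
Proof.
move=> j0 mmu yt pa pb; have [m [l fb]] := Mp_field mu j0.
have [ab|/ltW ba] := leP a b.
  rewrite [X in th j X]distrC [X in th j X]ger0_norm ?subr_ge0//.
  by apply: m_chain_int => //; apply: tame_sub yt; [case/andP: pa|case/andP: pb].
have := vint_rev fb yt pa pb; move/rowP/(_ k); rewrite !mxE => ->.
rewrite normrN [X in th j X]ger0_norm ?subr_ge0//.
by apply: m_chain_int => //; apply: tame_sub yt; [case/andP: pb|case/andP: pa].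
Qed.

Lemma m_chain_int_near mu j k y (p q : R) a a' b b' : (0 < j)%N -> m_chain_bound th mu ->
  tame j%:R y p q -> p <= a <= q -> p <= b <= q -> p <= a' <= q -> p <= b' <= q ->
  `|integral_Mp (mu k) y a b - integral_Mp (mu k) y a' b'| <= th j `|a - a'| + th j `|b - b'|.
Proof.
move=> j0 mmu yt pa pb pa' pb'.
rewrite (int_cat_any mu k j0 yt pa pa' pb) (int_cat_any mu k j0 yt pa' pb' pb).
have h1 := m_chain_int_any k j0 mmu yt pa pa'.
have := m_chain_int_any k j0 mmu yt pb' pb; rewrite [X in th j X]distrC => h2.
apply: le_trans (lerD h1 h2); apply: le_trans (ler_normD _ _).
by rewrite le_eqVlt; apply/orP; left; apply/eqP; congr (`|_|); ring.
Qed.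

Lemma closure_cvg (T : topologicalType) (A : set T) (x : T) : closure A x ->
  exists F : set_system T, [/\ ProperFilter F, F --> x & F A].
Proof.
move=> Ax; exists (within A (nbhs x)); split; last exact: withinT.
- exact: within_nbhs_proper.
- exact: cvg_within.
Qed.

Lemma cvg_closure (T : topologicalType) (F : set_system T) (A : set T) (x : T) :
  ProperFilter F -> F --> x -> F A -> closure A x.
Proof. by move=> FF Fx FA B /Fx FB; exact: filter_ex (filterI FA FB). Qed.

Lemma Theta_lim_inc (F : set_system (MpN R N)) mu : ProperFilter F ->
  F (m_chain_bound th) -> (F : set_system (MpN_top STh)) --> (mu : MpN_top STh) ->
  forall i v x z, x <= z ->
  inc (Mp_cum ((nu : MpN R N) i)) v x z @[nu --> F] --> inc (Mp_cum (mu i)) v x z.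
Proof.
move=> FF Fm Fmu i v x z xz; apply: (cvg_real_itv Hth FF Fm) => // q1 q2 q12.
exact: (cvg_Theta_cvg_inc Hth ThetaE FF Fmu).
Qed.

Lemma D_lim_inc (D : set V) (C : nat -> R) (F : set_system (MpN R N)) mu : ProperFilter F ->
  dense D -> (forall j, 0 <= C j) -> F (m_chain_bound th) -> F (l_chain_bound C) ->
  (F : set_system (MpN_top (sigma_D D))) --> (mu : MpN_top (sigma_D D)) ->
  forall i v x z, x <= z ->
  inc (Mp_cum ((nu : MpN R N) i)) v x z @[nu --> F] --> inc (Mp_cum (mu i)) v x z.
Proof.
move=> FF dD C0 Fm Fl /(cvg_sigma_D D mu FF) FD i v x z xz.
apply: (cvg_real_itv Hth FF Fm) => // q1 q2 q12.
apply: (cvg_dense_tag FF dD C0 Fl) => [|w Dw]; last exact: FD.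
by rewrite ler_rat ltW.
Qed.

Lemma Hull_m_chain nu0 mu : m_chain_bound th nu0 -> Hull STh nu0 mu ->
  m_chain_bound th mu.
Proof.
move=> m0 /closure_cvg[F [FF Fmu Fr]].
have Fm : F (m_chain_bound th).
  by apply: filterS Fr => _ [t _ <-]; exact: m_chain_translate.
exact: (m_chain_lim FF (Theta_lim_inc FF Fm Fmu) Fm).
Qed.

Lemma Hull_l_chain C nu0 mu : m_chain_bound th nu0 -> l_chain_bound C nu0 ->
  Hull STh nu0 mu -> l_chain_bound C mu.
Proof.
move=> m0 l0 /closure_cvg[F [FF Fmu Fr]].
have Fm : F (m_chain_bound th).
  by apply: filterS Fr => _ [t _ <-]; exact: m_chain_translate.
have Fl : F (l_chain_bound C).
  by apply: filterS Fr => _ [t _ <-]; exact: l_chain_translate.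
exact: (l_chain_lim FF (Theta_lim_inc FF Fm Fmu) Fl).
Qed.

(** A filter on the orbit converging in one topology converges to the same point in the other.
    Starting from [sigma_D], the l-chain bound of the limit has to be established before
    [cvg_Theta_of_dense] can be used. *)
Lemma Hull_DE (D : set V) (C : nat -> R) nu0 : dense D -> (forall j, 0 <= C j) ->
  m_chain_bound th nu0 -> l_chain_bound C nu0 ->
  (Hull (sigma_D D) nu0 : set (MpN R N)) = (Hull STh nu0 : set (MpN R N)).
Proof.
move=> dD C0 m0 l0; apply/seteqP; split=> mu.
- move=> /closure_cvg[F [FF Fmu Fr]].
  have Fm : F (m_chain_bound th).
    by apply: filterS Fr => _ [t _ <-]; exact: m_chain_translate.
  have Fl : F (l_chain_bound C).
    by apply: filterS Fr => _ [t _ <-]; exact: l_chain_translate.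
  have Finc := D_lim_inc FF dD C0 Fm Fl Fmu.
  have lmu := l_chain_lim FF Finc Fl.
  suff Fmu' : (F : set_system (MpN_top STh)) --> (mu : MpN_top STh).
    exact: (@cvg_closure (MpN_top STh) F (range (translateN nu0)) mu FF Fmu' Fr).
  apply: (cvg_Theta_of_dense Hth ThetaE C0 FF dD Fl lmu) => k v q1 q2 _ q12.
  by apply: Finc; rewrite ler_rat ltW.
- move=> /closure_cvg[F [FF Fmu Fr]].
  suff Fmu' : (F : set_system (MpN_top (sigma_D D))) --> (mu : MpN_top (sigma_D D)).
    exact: (@cvg_closure (MpN_top (sigma_D D)) F (range (translateN nu0)) mu FF Fmu' Fr).
  apply/(cvg_sigma_D D mu FF) => k v q1 q2 _ q12.
  exact: (cvg_Theta_cvg_inc Hth ThetaE FF Fmu).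
Qed.

Definition clamp a b t := Num.max a (Num.min b t).

Lemma clamp_in a b t : a <= b -> a <= clamp a b t <= b.
Proof. by move=> ab; rewrite le_max lexx /= ge_max ab ge_min lexx. Qed.

Lemma clamp_id a b t : a <= t <= b -> clamp a b t = t.
Proof. by move=> /andP[h1 h2]; rewrite /clamp min_r// max_r. Qed.

Lemma clamp_nd a b s t : a <= b -> s <= t ->
  clamp a b s <= clamp a b t /\ clamp a b t - clamp a b s <= t - s.
Proof.
rewrite /clamp => ab st; case: (leP b s) => bs; case: (leP b t) => bt.
- by rewrite max_r//; split; lra.
- by split; lra.
- rewrite (max_r ab); case: (leP a s) => ?; split; lra.
- case: (leP a s) => ?; case: (leP a t) => ?; split; lra.
Qed.

Lemma tame_modulus J f : (exists2 j, (0 < j)%N & J = j%:R /\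
    forall s t, s <= t -> `|f t - f s| <= th j (t - s)) ->
  (forall t, `|f t| <= J) -> forall a b, tame J f a b.
Proof.
move=> [j j0 [-> fth]] fJ a b; split=> [e e0|t _]; last exact: fJ.
have [_ _ /(_ e e0)[d d0 dP]] := Hth j0; exists d => // s t _ _ st.
have [s_t|/ltW ts] := leP s t.
  rewrite distrC; apply: le_trans (fth _ _ s_t) (dP _ _).
  by rewrite subr_ge0 s_t/=; move: st; rewrite distrC ger0_norm// subr_ge0.
apply: le_trans (fth _ _ ts) (dP _ _).
by rewrite subr_ge0 ts/=; move: st; rewrite ger0_norm// subr_ge0.
Qed.

(** Clamping time is nondecreasing and does not increase distances, so the extension by constants
    keeps the modulus [th] on the whole line. Its shifts can then be integrated over any
    interval. *)
Lemma extend_Kset j q1 q2 y : (0 < j)%N -> q1 < q2 -> Kset Theta j q1 q2 y ->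
  let f := fun t => y (clamp (ratr q1) (ratr q2) t) in
  [/\ forall t, `|f t| <= j%:R, forall s t, s <= t -> `|f t - f s| <= th j (t - s) &
      forall t, ratr q1 <= t <= ratr q2 -> f t = y t].
Proof.
move=> j0 q12 [_ yj yth] f.
have q12R : ratr q1 <= ratr q2 :> R by rewrite ler_rat ltW.
have cin t : `[ratr q1, ratr q2]%classic (clamp (ratr q1) (ratr q2) t).
  by rewrite /= in_itv/= clamp_in.
split=> [t|s t st|t tq]; [exact: yj| |by rewrite /f clamp_id].
have := yth _ _ (cin t) (cin s); rewrite ThetaE// => /le_trans; apply.
have [c1 c2] := clamp_nd q12R st.
have [_ mono _] := Hth j0; rewrite ger0_norm ?subr_ge0//.
by apply: mono => //; rewrite subr_ge0.
Qed.

Lemma shift_modulus j f c : (forall s t, s <= t -> `|f t - f s| <= th j (t - s)) ->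
  forall s t, s <= t -> `|f (t - c) - f (s - c)| <= th j (t - s).
Proof.
move=> fth s t st; have := fth (s - c) (t - c); rewrite lerD2r => /(_ st).
by have -> : t - c - (s - c) = t - s by ring.
Qed.

(** Integrating against a translate is integrating a shifted curve over a shifted interval, whose
    endpoints are real. Rational [p1], [p2] close to them bring the seminorms into play, and the
    shifted curve is still in [Kset] because the modulus does not depend on the interval. Only the
    limit field needs a Lipschitz estimate, when the shift [t] is replaced by [t0]. *)
Lemma cvg_translate (X : Type) (G : set_system X) (u : X -> R) (w : X -> MpN R N) t0 nu :
  Filter G -> u @ G --> t0 ->
  ((fun x => w x : MpN_top STh) @ G --> (nu : MpN_top STh)) ->
  m_chain_bound th nu -> (\forall x \near G, m_chain_bound th (w x)) ->
  (fun x => translateN (w x) (u x) : MpN_top STh) @ G --> (translateN nu t0 : MpN_top STh).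
Proof.
move=> GG Gu Gw mnu Gm.
have GwF : Filter (w @ G) by exact: fmap_filter.
have GtF : Filter ((fun x => translateN (w x) (u x)) @ G) by exact: fmap_filter.
apply/(cvg_sigma_Theta Hth ThetaE (translateN nu t0) GtF) => k j q1 q2 e j0 q12 e0.
have e80 : 0 < e / 8 by lra.
have [m [l fb]] := Mp_field nu j0.
have [th0 thm ths] := Hth j0.
have [d1 d10 dP1] := ths _ e80.
pose a : R := ratr q1; pose b : R := ratr q2.
have ab : a < b by rewrite ltr_rat.
have [|p1] := @rat_in_itvoo R (a + t0 - d1 / 2) (a + t0); first lra.
rewrite in_itv/= => /andP[p1a p1b].
have [|p2] := @rat_in_itvoo R (b + t0) (b + t0 + d1 / 2); first lra.
rewrite in_itv/= => /andP[p2a p2b].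
have p12R : ratr p1 < ratr p2 :> R by lra.
have p12 : p1 < p2 by rewrite -(ltr_rat R).
pose M := l (ratr p2) - l (ratr p1).
have M0 : 0 <= M by rewrite subr_ge0 (fb_ndl fb)// ltW.
have eM0 : 0 < e / (4 * (M + 1)) by rewrite divr_gt0// mulr_gt0//; lra.
have [d2 d20 dP2] := ths _ eM0.
pose d := Num.min (d1 / 2) d2.
have d0 : 0 < d by rewrite lt_min d20 divr_gt0.
have e40 : 0 < e / 4 by lra.
have Gw1 := (cvg_sigma_Theta Hth ThetaE nu GwF).1 Gw k j p1 p2 (e / 4) j0 p12 e40.
have Gu1 : \forall x \near G, `|t0 - u x| < d by move/cvgrPdist_lt: Gu => /(_ d d0).
suff : \forall x \near G, forall y, Kset Theta j q1 q2 y ->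
    `|integral_Mp (translateN (w x) (u x) k) y a b
      - integral_Mp (translateN nu t0 k) y a b| <= e by [].
near=> x; move=> y yK.
have mwx : m_chain_bound th (w x) by near: x.
have ux : `|t0 - u x| < d by near: x.
have wx : forall y, Kset Theta j p1 p2 y ->
      `|integral_Mp (w x k) y (ratr p1) (ratr p2)
        - integral_Mp (nu k) y (ratr p1) (ratr p2)| <= e / 4 by near: x; exact: Gw1.
set t := u x in ux *; set mu := w x in mwx wx *.
pose f s := y (clamp (ratr q1) (ratr q2) s).
have [fj fth fE] : [/\ forall s, `|f s| <= j%:R,
    forall s s', s <= s' -> `|f s' - f s| <= th j (s' - s) &
    forall s, a <= s <= b -> f s = y s] := extend_Kset j0 q12 yK.
have ft c a' b' : tame j%:R (fun s => f (s - c)) a' b'.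
  by apply: tame_modulus => [|s]; [exists j => //; split=> //; exact: shift_modulus|exact: fj].
have shiftE (la : MpN R N) c : integral_Mp (translateN la c k) y a b =
    integral_Mp (la k) (fun s => f (s - c)) (a + c) (b + c).
  have -> : integral_Mp (translateN la c k) y a b = integral_Mp (translateN la c k) f a b.
    have [m' [l' fb']] := Mp_field (translateN la c) j0.
    apply: (int_eq (cum_of_Mp (translateN la c k)) (fb_ndl fb') (fb_l fb' k) (ltW ab)).
    - exact: Kset_tame yK.
    - by have := ft 0 a b; have -> : (fun s => f (s - 0)) = f by apply/funext => s; rewrite subr0.
    - by move=> s sab; rewrite fE.
  exact: integral_Mp_shift.
rewrite !shiftE.
have /andP[ud1 ud2] : - d < t0 - t < d by rewrite -ltr_norml.
have dd1 : d <= d1 / 2 by rewrite ge_min lexx.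
have dd2 : d <= d2 by rewrite ge_min lexx orbT.
pose A := Num.min (ratr p1) (a + t) : R; pose B := Num.max (ratr p2) (b + t) : R.
have Ap : A <= ratr p1 by rewrite ge_min lexx.
have At : A <= a + t by rewrite ge_min lexx orbT.
have Bp : ratr p2 <= B by rewrite le_max lexx.
have Bt : b + t <= B by rewrite le_max lexx orbT.
have in1 : A <= a + t <= B by clear - At Bt ab; apply/andP; split; lra.
have in2 : A <= b + t <= B by clear - At Bt ab; apply/andP; split; lra.
have in3 : A <= ratr p1 <= B by clear - Ap Bp p12R; apply/andP; split; lra.
have in4 : A <= ratr p2 <= B by clear - Ap Bp p12R; apply/andP; split; lra.
have in5 : A <= a + t0 <= B by clear - Ap Bp p1b p2a ab; apply/andP; split; lra.
have in6 : A <= b + t0 <= B by clear - Ap Bp p1b p2a ab; apply/andP; split; lra.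
have small r : `|r| < d1 -> th j `|r| <= e / 8 by move=> rd; apply: dP1; rewrite normr_ge0.
(* Four changes, each costing at most [e / 4]: endpoints for [mu], then the field, then the shift,
   then endpoints for [nu]. *)
have s1 := m_chain_int_near k j0 mwx (ft t A B) in1 in2 in3 in4.
have s11 : th j `|a + t - ratr p1| <= e / 8.
  by apply: small; rewrite ltr_norml; clear - p1a p1b ud1 ud2 dd1; apply/andP; split; lra.
have s12 : th j `|b + t - ratr p2| <= e / 8.
  by apply: small; rewrite ltr_norml; clear - p2a p2b ud1 ud2 dd1; apply/andP; split; lra.
have s2 : `|integral_Mp (mu k) (fun s => f (s - t)) (ratr p1) (ratr p2) -
   integral_Mp (nu k) (fun s => f (s - t)) (ratr p1) (ratr p2)| <= e / 4.
  apply: wx; apply: (tame_Kset ThetaE p12); first exact: ft.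
  by move=> s s' _ ss' _; exact: shift_modulus.
have s3 : `|integral_Mp (nu k) (fun s => f (s - t)) (ratr p1) (ratr p2) -
   integral_Mp (nu k) (fun s => f (s - t0)) (ratr p1) (ratr p2)| <= e / (4 * (M + 1)) * M.
  apply: (int_diff_unif (cum_of_Mp (nu k)) (fb_ndl fb) (fb_l fb k)).
  - exact: ltW.
  - exact: ft.
  - exact: ft.
  move=> s _; have [tt0|/ltW t0t] := leP t t0.
    apply: le_trans (fth (s - t0) (s - t) _) _; first by rewrite lerD2l lerN2.
    by apply: dP2; clear - ud1 ud2 dd2 tt0; apply/andP; split; lra.
  rewrite distrC; apply: le_trans (fth (s - t) (s - t0) _) _; first by rewrite lerD2l lerN2.
  by apply: dP2; clear - ud1 ud2 dd2 t0t; apply/andP; split; lra.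
have s3' : e / (4 * (M + 1)) * M <= e / 4.
  clear - M0 e0; rewrite mulrAC ler_pdivrMr; last by rewrite mulr_gt0//; lra.
  have -> : e / 4 * (4 * (M + 1)) = e * (M + 1) by field.
  by rewrite ler_pM2l//; lra.
have s4 := m_chain_int_near k j0 mnu (ft t0 A B) in3 in4 in5 in6.
have s41 : th j `|ratr p1 - (a + t0)| <= e / 8.
  by apply: small; rewrite ltr_norml; clear - p1a p1b d10; apply/andP; split; lra.
have s42 : th j `|ratr p2 - (b + t0)| <= e / 8.
  by apply: small; rewrite ltr_norml; clear - p2a p2b d10; apply/andP; split; lra.
move: s1 s2 s3 s4; rewrite !ler_norml.
clear - s11 s12 s3' s41 s42; move=> /andP[? ?] /andP[? ?] /andP[? ?] /andP[? ?].
by apply/andP; split; lra.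
Unshelve. all: by end_near. Qed.

Lemma Hull_translate nu0 mu t : m_chain_bound th nu0 -> Hull STh nu0 mu ->
  Hull STh nu0 (translateN mu t).
Proof.
move=> m0 Hmu; have mmu := Hull_m_chain m0 Hmu.
have [F [FF Fmu Fr]] := closure_cvg Hmu.
have Fm : F (m_chain_bound th).
  by apply: filterS Fr => _ [s _ <-]; exact: m_chain_translate.
have Fc : (fun _ : MpN R N => t) @ F --> t by exact: cvg_cst.
have FF0 : Filter F by exact: filter_filter.
have Ft := cvg_translate (w := id) FF0 Fc Fmu mmu Fm.
have Ftr : F [set nu | range (translateN nu0) (translateN nu t)].
  by apply: filterS Fr => _ [s _ <-]; exists (s + t) => //; rewrite translateND.
have FtF : ProperFilter ((fun nu : MpN R N => translateN nu t) @ F).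
  exact: fmap_proper_filter.
exact: (@cvg_closure (MpN_top STh) _ (range (translateN nu0)) (translateN mu t) FtF Ft Ftr).
Qed.

End HullDynamics.

Lemma clip_lt_id (R : realType) (N : nat) (J : R) (v : 'rV[R]_N) :
  `|clip J v| < J -> clip J v = v.
Proof.
move=> vJ; apply/rowP => i.
have := le_lt_trans (rV_coord_le (clip J v) i) vJ; rewrite mxE ltr_norml.
by case: (leP J (v 0 i)) => h1; case: (leP (- J) _) => h2 /andP[]; lra.
Qed.

(** * Continuous dependence on the field, the initial value and the time *)

Section ContinuousDependence.
Variables (R : realType) (N : nat).
Local Notation V := 'rV[R]_N.
Variables (Theta : moduli R) (th : nat -> R -> R).
Hypothesis Hth : modulus_family th.
Hypothesis ThetaE : forall j q1 q2 s, q1 < q2 -> Theta j q1 q2 s = th j s.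
Local Notation STh := (@sigma_Theta R N Theta).
Implicit Types (mu nu : MpN R N) (y f g : R -> V) (v : V) (e s t : R) (q : rat).

(** A seminorm controls the integral over one fixed rational interval. Uniformity in the upper limit
    [t] comes from finitely many rational grid points and the common modulus between them. *)
Lemma cvg_primitive (F : set_system (MpN R N)) nu j (q1 q2 : rat) e k : Filter F ->
  (F : set_system (MpN_top STh)) --> (nu : MpN_top STh) ->
  m_chain_bound th nu -> F (m_chain_bound th) -> (0 < j)%N -> q1 < q2 -> 0 < e ->
  \forall mu \near F, forall f, Kset Theta j q1 q2 f -> forall t, ratr q1 <= t <= ratr q2 ->
    `|integral_Mp ((mu : MpN R N) k) f (ratr q1) t - integral_Mp (nu k) f (ratr q1) t| <= e.
Proof.
move=> FF Fnu mnu Fm j0 q12 e0.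
pose a : R := ratr q1; pose b : R := ratr q2.
have ab : a < b by rewrite ltr_rat.
have e30 : 0 < e / 3 by lra.
have [_ _ /(_ _ e30)[d d0 dP]] := Hth j0.
pose n := (Num.truncn ((b - a) / d)).+1.
have n0 : (0 : rat) < n%:R by rewrite ltr0n.
have n0R : (0 : R) < n%:R by rewrite ltr0n.
pose q i : rat := q1 + i%:R * ((q2 - q1) / n%:R).
pose h : R := (b - a) / n%:R.
have h0 : 0 < h by rewrite divr_gt0// subr_gt0.
have hd : h < d by rewrite ltr_pdivrMr// mulrC -ltr_pdivrMr// truncnS_gt.
have qE i : ratr (q i) = a + i%:R * h :> R.
  by rewrite /q rmorphD rmorphM fmorph_div rmorphB !rmorph_nat.
have q1i i : (0 < i)%N -> q1 < q i.
  by move=> i0; rewrite ltrDl mulr_gt0 ?ltr0n// divr_gt0// subr_gt0.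
have nE : n%:R * h = b - a by rewrite mulrC divfK ?gt_eqF.
have ih i : (i <= n)%N -> i%:R * h <= b - a by rewrite -nE ler_pM2r// ler_nat.
have near_grid : \forall mu \near F, forall i : 'I_n.+1, (0 < i)%N ->
    forall f, Kset Theta j q1 (q i) f ->
    `|integral_Mp ((mu : MpN R N) k) f a (ratr (q i))
      - integral_Mp (nu k) f a (ratr (q i))| <= e / 3.
  apply: filter_forall => i; have [i0|] := posnP i.
    by apply: filterE => mu; rewrite i0.
  move=> i0; have := (cvg_sigma_Theta Hth ThetaE nu FF).1 Fnu k j q1 (q i) _ j0 (q1i i i0) e30.
  by apply: filterS => mu H _.
apply: filterS2 near_grid Fm => mu muG mmu f fK t /andP[at_ tb].
pose i := Num.truncn ((t - a) / h).
have ta0 : 0 <= (t - a) / h by rewrite divr_ge0 ?subr_ge0// ltW.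
have i1 : i%:R * h <= t - a by rewrite -ler_pdivlMr// truncn_le.
have i2 : t - a < i%:R * h + h.
  by have := truncnS_gt ((t - a) / h); rewrite -/i -natr1 ltr_pdivrMr// mulrDl mul1r.
have i_n : (i < n.+1)%N.
  rewrite ltnS -(ler_nat R) -(ler_pM2r h0) nE; apply: le_trans i1 _.
  by rewrite lerB.
have ft := Kset_tame fK.
have gi : a <= ratr (q i) <= b.
  by rewrite qE lerDl mulr_ge0 ?ler0n ?(ltW h0)//= -lerBrDl ih.
have aa : a <= a <= b by rewrite lexx ltW.
have tt : a <= t <= b by rewrite at_.
rewrite -/a (int_cat_any mu k j0 ft aa gi tt) (int_cat_any nu k j0 ft aa gi tt).
have thd : th j `|ratr (q i) - t| <= e / 3.
  by apply: dP; rewrite normr_ge0 /= qE ltr_norml; clear - i1 i2 hd; apply/andP; split; lra.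
have s1 := le_trans (m_chain_int_any k j0 mmu ft gi tt) thd.
have s2 := le_trans (m_chain_int_any k j0 mnu ft gi tt) thd.
have s3 : `|integral_Mp (mu k) f a (ratr (q i)) - integral_Mp (nu k) f a (ratr (q i))| <= e / 3.
  (* The grid point [i = 0] would need a seminorm on an interval of length zero; there both
     integrals vanish. *)
  have [iz|i0] := posnP i.
    have qa : ratr (q i) = a by rewrite qE iz mul0r addr0.
    rewrite qa.
    have z (la : MpN R N) : integral_Mp (la k) f a a = 0.
      have [m [l fb]] := Mp_field la j0.
      apply: (int_refl (cum_of_Mp (la k)) (fb_ndl fb) (fb_l fb k)).
      by apply: ft.2.
    by rewrite !z subrr normr0 ltW.
  apply: (muG (Ordinal i_n)) => //; apply: (tame_Kset ThetaE (q1i i i0)).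
    by case/andP: gi => _ gb; exact: tame_sub gb ft.
  move=> s s' as_ ss' s'q; have [_ _ fth] := fK.
  have := fth s' s; rewrite ThetaE// ger0_norm ?subr_ge0//; apply.
  - by rewrite /= in_itv/=; case/andP: gi => _ gb; rewrite (le_trans as_ ss') (le_trans s'q gb).
  - by rewrite /= in_itv/=; case/andP: gi => _ gb; rewrite as_ (le_trans ss') ?(le_trans s'q gb).
clear - s1 s2 s3; move: s1 s2 s3; rewrite !ler_norml.
move=> /andP[? ?] /andP[? ?] /andP[? ?]; apply/andP; split; lra.
Qed.

(** The clipped nearby equation has a global solution [psi], and [f], its clip, is in [Kset] by the
    common modulus. Gronwall's inequality for the limit field brings [f] close to [phi], hence
    strictly inside the ball; so the clip was inactive and [psi] is a true solution up to [u x].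
    Existence and closeness come out together, giving both the openness of [U1] and the continuity
    of [Pi]. *)
Lemma cvg_solution (X : Type) (G : set_system X) (u : X -> R) (w : X -> MpN R N)
    (z : X -> V) t0 nu v0 : Filter G -> u @ G --> t0 -> z @ G --> v0 ->
  (fun x => w x : MpN_top STh) @ G --> (nu : MpN_top STh) ->
  m_chain_bound th nu -> (\forall x \near G, m_chain_bound th (w x)) ->
  existence_interval nu v0 t0 -> forall e, 0 < e ->
  \forall x \near G, existence_interval (w x) (z x) (u x) /\
    `|solution (u x) (w x) (z x) - solution t0 nu v0| <= e.
Proof.
move=> GG Gu Gz Gw mnu Gm It0 e e0.
have sp := solutionP nu v0; have [ip op p0 cp pE] := sp.
set I := existence_interval nu v0 in It0 sp ip op p0 cp pE.
pose phi t := solution t nu v0.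
have Ineigh s : I s -> exists2 d, 0 < d & forall t, `|s - t| < d -> I t.
  move=> Is; have : nbhs s I by apply: open_nbhs_nbhs; split.
  by move=> /nbhs_normP[d d0 dP]; exists d.
have Imin : I (Num.min 0 t0) by case: (leP 0 t0).
have Imax : I (Num.max 0 t0) by case: (leP 0 t0).
have [da da0 daP] := Ineigh _ Imin; have [db db0 dbP] := Ineigh _ Imax.
have [|q1] := @rat_in_itvoo R (Num.min 0 t0 - da) (Num.min 0 t0); first by rewrite gtrBl.
rewrite in_itv/= => /andP[q1a q1b].
have [|q2] := @rat_in_itvoo R (Num.max 0 t0) (Num.max 0 t0 + db); first by rewrite ltrDl.
rewrite in_itv/= => /andP[q2a q2b].
pose a : R := ratr q1; pose b : R := ratr q2.
have Ia : I a by apply: daP; rewrite ltr_norml; clear - q1a q1b da0; apply/andP; split; rewrite /a; lra.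
have Ib : I b by apply: dbP; rewrite ltr_norml; clear - q2a q2b db0; apply/andP; split; rewrite /b; lra.
have [a0 at0] : a < 0 /\ a < t0 by move: q1b; rewrite lt_min => /andP[].
have [b0 bt0] : 0 < b /\ t0 < b by move: q2a; rewrite gt_max => /andP[].
have ab : a < b := lt_trans a0 b0.
have q12 : q1 < q2 by rewrite -(ltr_rat R).
have [j1 [j10 phit1]] := sol_tame sp Ia Ib.
(* [phi] stays in the ball of radius [j1]; the extra unit leaves room for curves near [phi] to avoid
   the clip. *)
pose j := j1.+1; have j0 : (0 < j)%N by [].
have jE : j%:R = j1%:R + 1 :> R by rewrite natr1.
have phit : tame j%:R phi a b by apply: tameS phit1; rewrite ler_nat.
have [m [l fb]] := Mp_field nu j0.
pose W := gweight l a + gweight l b.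
have gW t : a <= t <= b -> gweight l t <= W.
  move=> /andP[at_ tb]; rewrite /W /gweight.
  have nda := fb_ndl fb at_; have ndb := fb_ndl fb tb.
  have nda0 := fb_ndl fb (ltW a0); have ndb0 := fb_ndl fb (ltW b0).
  have [tz|/ltW tz] := leP 0 t; have ndt := fb_ndl fb tz.
    apply: le_trans (_ : expR (2 * `|l b - l 0|) <= _); last by rewrite lerDr expR_ge0.
    by rewrite ler_expR ler_pM2l// !ger0_norm ?subr_ge0//; lra.
  apply: le_trans (_ : expR (2 * `|l a - l 0|) <= _); last by rewrite lerDl expR_ge0.
  by rewrite ler_expR ler_pM2l// !(distrC _ (l 0)) !ger0_norm ?subr_ge0//; lra.
have W0 : 0 < W by rewrite addr_gt0// expR_gt0.
(* Gronwall's constant will be [2 * K]: one [K] for the initial value and one for the fields. The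
   latter is twice [K / 2], since the primitives start at [a] instead of 0. The minimum with 1 keeps
   [f] inside the ball of radius [j]. *)
pose K := Num.min 1 e / (8 * W).
have K0 : 0 < K by rewrite divr_gt0 ?lt_min ?ltr01// mulr_gt0.
have KW : 2 * (2 * K) * W <= Num.min 1 e / 2.
  by rewrite /K le_eqVlt; apply/orP; left; apply/eqP; field; rewrite gt_eqF.
have K20 : 0 < K / 2 by lra.
have phic : phi x @[x --> t0] --> phi t0.
  by move: cp; rewrite continuous_open_subspace// => /(_ _ (mem_set It0)).
have e20 : 0 < e / 2 by lra.
have [dphi dphi0 dphiP] : exists2 d, 0 < d & forall t, `|t0 - t| < d -> `|phi t0 - phi t| <= e / 2.
  by move/cvgrPdist_le: phic => /(_ _ e20)/nbhs_normP[d d0 dP]; exists d.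
pose du := Num.min dphi (Num.min (t0 - a) (b - t0)).
have du0 : 0 < du by rewrite !lt_min dphi0 !subr_gt0 at0.
have GwF : Filter (w @ G) by exact: fmap_filter.
have Gprim : \forall x \near G, forall k f, Kset Theta j q1 q2 f -> forall t, a <= t <= b ->
    `|integral_Mp (w x k) f a t - integral_Mp (nu k) f a t| <= K / 2.
  apply: filter_forall => k.
  exact: (@cvg_primitive (w @ G) nu j q1 q2 (K / 2) k GwF Gw mnu Gm j0 q12 K20).
have Gz1 : \forall x \near G, `|v0 - z x| < K by move/cvgrPdist_lt: Gz => /(_ _ K0).
have Gu1 : \forall x \near G, `|t0 - u x| < du by move/cvgrPdist_lt: Gu => /(_ _ du0).
near=> x.
have mwx : m_chain_bound th (w x) by near: x.
have ux : `|t0 - u x| < du by near: x.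
have zx : `|v0 - z x| < K by near: x.
have prim : forall k f, Kset Theta j q1 q2 f -> forall t, a <= t <= b ->
    `|integral_Mp (w x k) f a t - integral_Mp (nu k) f a t| <= K / 2 by near: x.
have [m' [l' fb']] := Mp_field (w x) j0.
have [psi [psim psi0 psiE]] := exists_clipped_solution fb' (ler0n _ j) (z x).
pose f := clip j%:R \o psi.
have psiu c d : ucont psi c d by exact: modulus_ucont fb' _ _ _ psim.
have ft c d : tame j%:R f c d by apply: clip_tame.
have [th0 _ _] := Hth j0.
have psith s t : s <= t -> `|psi t - psi s| <= th j (t - s).
  move=> st; rewrite !psiE opprD addrACA subrr add0r.
  have sin : Num.min 0 s <= 0 <= Num.max 0 t by rewrite ge_min le_max lexx.
  rewrite (vint_cat0 fb' (ft (Num.min 0 s) (Num.max 0 t)))//; last 2 first.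
  - by rewrite ge_min lexx orbT.
  - by rewrite le_max lexx orbT.
  apply: rV_norm_le => [|k]; first by rewrite th0// subr_ge0.
  by rewrite mxE; apply: m_chain_int => //; exact: ft.
have fK : Kset Theta j q1 q2 f.
  apply: (tame_Kset ThetaE q12); first exact: ft.
  move=> s t _ st _; apply: le_trans (clip_lip _ _ _) _; exact: psith.
have aa : a <= a <= b by rewrite lexx ltW.
have zz : a <= 0 <= b by rewrite !ltW.
have diff t : a <= t <= b ->
    `|integral_MpN (w x) f 0 t - integral_MpN nu f 0 t| <= K.
  move=> tab; apply: rV_norm_le => [|k]; first exact: ltW.
  rewrite !mxE.
  have h1 := prim k f fK t tab; have h2 := prim k f fK 0 zz.
  have c1 := int_cat_any (w x) k j0 (ft a b) aa zz tab.
  have c2 := int_cat_any nu k j0 (ft a b) aa zz tab.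
  move: h1 h2; rewrite c1 c2; clear; rewrite !ler_norml.
  by move=> /andP[? ?] /andP[? ?]; apply/andP; split; lra.
have phiE t : a <= t <= b -> phi t = v0 + integral_MpN nu phi 0 t.
  by move=> /andP[h1 h2]; apply: pE; apply: (ip a b) => //; rewrite h1.
have base t : a <= t <= b -> `|psi t - phi t| <=
    2 * K + `|integral_MpN nu f 0 t - integral_MpN nu phi 0 t|.
  move=> tab; rewrite psiE phiE// -/f.
  have -> : z x + integral_MpN (w x) f 0 t - (v0 + integral_MpN nu phi 0 t) =
     (z x - v0) + (integral_MpN (w x) f 0 t - integral_MpN nu f 0 t)
     + (integral_MpN nu f 0 t - integral_MpN nu phi 0 t).
    by rewrite opprD addrACA -[in RHS]addrA subrKA.
  apply: le_trans (ler_normD _ _) _; rewrite lerD2r.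
  apply: le_trans (ler_normD _ _) _; rewrite distrC.
  by have := diff t tab; lra.
(* The clip fixes [phi], so the estimate for [psi] passes to [f], the bounded curve to which
   Gronwall's inequality applies. *)
have fphi t : a <= t <= b -> `|f t - phi t| <= `|psi t - phi t|.
  move=> tab; have E := clip_id (phit.2 t tab).
  by rewrite -{1}E; exact: clip_lip.
have gron t : a <= t <= b -> `|f t - phi t| <= Num.min 1 e / 2.
  move=> tab; apply: le_trans KW.
  apply: (@le_trans _ _ (2 * (2 * K) * gweight l t)); last first.
    by apply: ler_wpM2l (gW t tab); lra.
  apply: (vint_gronwall fb zz (ler0n _ j) _ (ft a b) phit) => //; first lra.
  by move=> s sab; apply: le_trans (fphi s sab) (base s sab).
have min1 : Num.min 1 e / 2 <= 1 / 2 by rewrite ler_pM2r ?invr_gt0// ge_min lexx.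
have mine : Num.min 1 e / 2 <= e / 2 by rewrite ler_pM2r ?invr_gt0// ge_min lexx orbT.
have fj t : a <= t <= b -> `|f t| < j%:R.
  move=> tab; rewrite jE -(subrK (phi t) (f t)).
  apply: le_lt_trans (ler_normD _ _) _.
  by have := gron t tab; have := phit1.2 t tab; rewrite -/(phi t); lra.
have fpsi t : a <= t <= b -> f t = psi t by move=> tab; exact: clip_lt_id (fj t tab).
have [||d d0 solx] := clipped_is_solution (y0 := z x) fb' (ler0n _ j) psiu zz.
- by move=> t tab; rewrite -fpsi//; exact: fj.
- by move=> t _; exact: psiE.
have uab : a <= u x <= b.
  move: ux; rewrite !lt_min ltr_norml => /and3P[_].
  rewrite !ltr_norml => /andP[h1 h2] /andP[h3 h4].
  by clear - h1 h2 h3 h4; apply/andP; split; lra.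
have uI : (`]a - d, b + d[%classic : set R) (u x).
  by rewrite /= in_itv/=; clear - uab d0; case/andP: uab => ? ?; apply/andP; split; lra.
split; first exact: existence_interval_sub solx _ uI.
rewrite (solution_eq solx uI)/= -(fpsi _ uab) -(subrKA (phi (u x))).
apply: le_trans (ler_normD _ _) _.
have h1 := le_trans (gron _ uab) mine.
have h2 : `|phi t0 - phi (u x)| <= e / 2.
  by apply: dphiP; apply: lt_le_trans ux _; rewrite ge_min lexx.
by move: h2; rewrite distrC => h2; clear - h1 h2; rewrite -/(phi t0); lra.
Unshelve. all: by end_near. Qed.

End ContinuousDependence.

(** * Measures from continuous increments *)

Section StieltjesMeasures.
Variable R : realType.
Local Notation measR := {measure set (measurableTypeR R) -> \bar R}.
Implicit Types (m : measR) (g : R -> R) (a b e : R).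

(** Outer approximation is obtained while the covers defining the outer measure are at hand:
    half-open intervals with excess [e / 2] are opened at the right end, at a total cost of another
    [e / 2]. Regularity is later derived from this clause and local finiteness. *)
Lemma exists_stieltjes g : continuous g -> {homo g : x z / x <= z} ->
  exists m : measR, (forall a b, a <= b -> m `]a, b]%classic = (g b - g a)%:E) /\
   forall (A : set R) e, measurable (A : set (measurableTypeR R)) -> (m A < +oo)%E -> 0 < e ->
     exists U, [/\ open U, A `<=` U & (m U <= m A + e%:E)%E].
Proof.
move=> gc gnd.
have grc : right_continuous g by move=> x; apply: cvg_within_filter; exact: gc.
pose f : cumulative R R := HB.pack g (isCumulative.Build R _ R g gnd grc).
have fE a b : a <= b -> lebesgue_stieltjes_measure f `]a, b]%classic = (g b - g a)%:E.
  move=> ab; rewrite /lebesgue_stieltjes_measure /measure_extension measurable_mu_extE//=.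
    by rewrite wlength_itv_bnd.
  exact: is_ocitv.
exists (lebesgue_stieltjes_measure f); split => //.
move=> A e mA Afin e0.
have Afn : lebesgue_stieltjes_measure f A \is a fin_num by rewrite ge0_fin_numE.
have e20 : 0 < e / 2 by lra.
have /ereal_inf_lt[_ [M covM <-] Me] :
    (lebesgue_stieltjes_measure f A < lebesgue_stieltjes_measure f A + (e / 2)%:E)%E.
  by rewrite lteDl// lte_fin.
have /choice[W WP] : forall n, exists W : set R, [/\ open W, M n `<=` W &
   (lebesgue_stieltjes_measure f W <= wlength f (M n) + (e / 2 / (2 ^ n.+1)%:R)%:E)%E].
  move=> n; have d0 : 0 < e / 2 / (2 ^ n.+1)%:R by rewrite divr_gt0// ltr0n expn_gt0.
  have /ocitvP[->|[[a b] /= ab ->]] := covM.1 n.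
    exists set0; split; [exact: open0|by []|].
    by rewrite !measure0 add0e lee_fin ltW.
  have [d bd] := nondecreasing_right_continuousP b f d0.
  exists `]a, b + d%:num[%classic; split.
  - exact: interval_open.
  - by move=> x /=; rewrite !in_itv/= => /andP[->/= xb]; rewrite (le_lt_trans xb)// ltrDl.
  rewrite wlength_itv_bnd ?(ltW ab)// -EFinD.
  apply: (@le_trans _ _ (lebesgue_stieltjes_measure f `]a, b + d%:num]%classic)).
    apply: le_measure; rewrite ?inE.
    + exact: mem_set (measurable_itvR `]a, b + d%:num[).
    + exact: mem_set (measurable_itvR `]a, b + d%:num]).
    + by move=> x /=; rewrite !in_itv/= => /andP[->/= /ltW].
  rewrite fE; last by rewrite (le_trans (ltW ab))// lerDl.
  by rewrite lee_fin; move: bd => /=; lra.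
exists (\bigcup_n W n); split.
- by apply: bigcup_open => n _; have [] := WP n.
- move=> x Ax; have [n _ Mx] := covM.2 x Ax; exists n => //.
  by have [_ + _] := WP n; exact.
apply: (@le_trans _ _ (\sum_(n <oo) lebesgue_stieltjes_measure f (W n))%E).
  exact: outer_measure_sigma_subadditive.
apply: (@le_trans _ _ (\sum_(n <oo) (wlength f (M n) + (e / 2 / (2 ^ n.+1)%:R)%:E))%E).
  by apply: lee_nneseries => // n _; have [_ _ +] := WP n; exact.
apply: le_trans (epsilon_trick _ _ _) _ => //; first exact: ltW.
rewrite [e in leRHS]splitr EFinD addeA leeD2r//.
exact: ltW.
Qed.

Section regular.
Variable m : measR.
Hypothesis mfin : forall a b, (m `[a, b]%classic < +oo)%E.
Hypothesis m_outer : forall (A : set R) e, measurable (A : set (measurableTypeR R)) ->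
  (m A < +oo)%E -> 0 < e ->
  exists U, [/\ open U, A `<=` U & (m U <= m A + e%:E)%E].

Let le_m (A B : set R) : measurable (A : set (measurableTypeR R)) ->
  measurable (B : set (measurableTypeR R)) -> A `<=` B -> (m A <= m B)%E.
Proof. by move=> mA mB AB; apply: le_measure => //; exact: mem_set. Qed.

(** Outer approximation of the complement: with [U] open around [I \ A] and little larger in
    measure, [I \ U] is compact and fills almost all of [A]. *)
Lemma inner_bounded (A : set R) a b e : measurable (A : set (measurableTypeR R)) ->
  A `<=` `[a, b]%classic -> 0 < e ->
  exists K, [/\ compact K, K `<=` A & (m A <= m K + e%:E)%E].
Proof.
move=> mA Aab e0; pose I : set R := `[a, b]%classic.
have mI : measurable (I : set (measurableTypeR R)) by exact: measurable_itvR.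
have mIA : measurable (I `\` A : set (measurableTypeR R)) by exact: measurableD.
have IAfin : (m (I `\` A) < +oo)%E.
  by apply: le_lt_trans (mfin a b); apply: le_m => //; exact: subDsetl.
have [U [oU IAU mU]] := m_outer mIA IAfin e0.
have mUm : measurable (U : set (measurableTypeR R)) by exact: open_measurableR.
pose K := I `\` U.
have mK : measurable (K : set (measurableTypeR R)) by exact: measurableD.
have KA : K `<=` A.
  by move=> x [Ix nU]; apply: contrapT => nA; apply: nU; apply: IAU.
exists K; split => //.
  apply: (@subclosed_compact _ _ I); last exact: subDsetl.
    by apply: closedI; [exact: interval_closed|exact: open_closedC].
  exact: segment_compact.
have IE : (m I = m A + m (I `\` A))%E.
  by rewrite -measureU ?setDIK// setDUK.
have IU : (m I <= m K + m U)%E.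
  apply: (@le_trans _ _ (m (K `|` U))).
    by apply: le_m => //; [exact: measurableU|move=> x Ix; have [Ux|nU] := pselect (U x); [right|left]].
  by rewrite measureU2.
have fK : m K \is a fin_num.
  by rewrite ge0_fin_numE// (le_lt_trans _ (mfin a b))//; apply: le_m => //; exact: subDsetl.
have fA : m A \is a fin_num by rewrite ge0_fin_numE// (le_lt_trans _ (mfin a b))//; exact: le_m.
have fIA : m (I `\` A) \is a fin_num by rewrite ge0_fin_numE.
have : (m A + m (I `\` A) <= m K + (m (I `\` A) + e%:E))%E.
  by rewrite -IE; apply: le_trans IU _; rewrite leeD2l.
rewrite -(fineK fA) -(fineK fIA) -(fineK fK) -!EFinD !lee_fin; lra.
Qed.

Lemma stieltjes_regular : regular_measure m.
Proof.
move=> A mA; split.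
- apply/eqP; rewrite eq_le; apply/andP; split.
    apply: le_ereal_inf_tmp => _ [U [oU AU] <-].
    by apply: le_m => //; exact: open_measurableR.
  have [Afin|] := ltP (m A) +oo%E; last by rewrite leye_eq => /eqP ->; rewrite leey.
  apply/lee_addgt0Pr => e e0; have [U [oU AU mU]] := m_outer mA Afin e0.
  by apply: le_trans mU; apply: ereal_inf_lbound; exists U.
- apply/eqP; rewrite eq_le; apply/andP; split; last first.
    apply: ge_ereal_sup => _ [K [cK KA] <-].
    apply: le_m => //; exact: compact_measurable.
  pose An n := A `&` `[- n%:R, n%:R]%classic.
  have mAn n : measurable (An n : set (measurableTypeR R)).
    by apply: measurableI => //; exact: measurable_itvR.
  have AE : \bigcup_n An n = A by rewrite -setI_bigcupr bigcup_itvT setIT.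
  have : m \o An @ \oo --> m (\bigcup_n An n).
    apply: nondecreasing_cvg_mu => //.
    - by rewrite AE.
    - move=> n k nk; apply/subsetPset => x [Ax]; rewrite /An /= !in_itv/= => /andP[h1 h2].
      have nk' : n%:R <= k%:R :> R by rewrite ler_nat.
      by split => //; rewrite (le_trans _ h1) ?lerN2// (le_trans h2).
  rewrite AE => /cvg_lim <-//; apply: lime_le.
    by apply: ereal_nondecreasing_is_cvgn => n k nk; apply: le_m => // x [Ax];
      rewrite /An /= !in_itv/= => /andP[h1 h2]; split => //;
      rewrite (le_trans _ h1) ?lerN2 ?ler_nat// (le_trans h2)// ler_nat.
  apply: nearW => n; apply/lee_addgt0Pr => e e0.
  have [K [cK KA mK]] := inner_bounded (mAn n) (@subIsetr _ _ _) e0.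
  apply: le_trans mK _; rewrite leeD2r//.
  by apply: ereal_sup_ubound; exists K => //; split => // x /KA[].
Qed.

End regular.

Lemma stieltjes_Mc_plus g : continuous g -> {homo g : x z / x <= z} ->
  exists m : measR, Mc_plus m /\
    forall a b, a <= b -> m `]a, b]%classic = (g b - g a)%:E.
Proof.
move=> gc gnd; have [m [mE m_outer]] := exists_stieltjes gc gnd.
have mfin a b : (m `[a, b]%classic < +oo)%E.
  have [ab|ba] := leP a b; last by rewrite set_itv_ge ?measure0 ?ltry// bnd_simp -ltNge.
  apply: (@le_lt_trans _ _ (m `]a - 1, b]%classic)).
    apply: le_measure; rewrite ?inE.
    + exact: mem_set (measurable_itvR `[a, b]).
    + exact: mem_set (measurable_itvR `]a - 1, b]).
    + by move=> x /=; rewrite !in_itv/= => /andP[ax ->]; rewrite andbT; lra.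
  by rewrite mE ?ltry//; lra.
exists m; split => //; split.
- move=> x; exists `]x - 1, x + 1[%classic.
    by split; [exact: interval_open|rewrite /= in_itv/=; apply/andP; split; lra].
  apply: le_lt_trans (mfin (x - 1) (x + 1)); apply: le_measure; rewrite ?inE.
  + exact: mem_set (measurable_itvR `]x - 1, x + 1[).
  + exact: mem_set (measurable_itvR `[x - 1, x + 1]).
  + by move=> t /=; rewrite !in_itv/= => /andP[/ltW -> /ltW ->].
- exact: stieltjes_regular.
- move=> t; apply/eqP; rewrite eq_le measure_ge0 andbT; apply/lee_addgt0Pr => e e0.
  rewrite add0e; have /cvgrPdist_le/(_ _ e0)/nbhs_normP[d /= d0 dP] := gc t.
  apply: (@le_trans _ _ (m `]t - d / 2, t]%classic)).
    rewrite -set_itv1; apply: le_measure; rewrite ?inE.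
    + exact: mem_set (measurable_itvR `[t, t]).
    + exact: mem_set (measurable_itvR `]t - d / 2, t]).
    + by move=> x /=; rewrite !in_itv/= => /andP[tx ->]; rewrite andbT; lra.
  rewrite mE; last lra.
  rewrite lee_fin; apply: le_trans (ler_norm _) _; apply: dP => /=.
  by rewrite opprB addrC subrK gtr0_norm; lra.
Qed.

Lemma measure_eq_oc (m m' : measR) :
  (forall a b, a <= b -> m `]a, b]%classic = m' `]a, b]%classic) ->
  (forall a b, (m `]a, b]%classic < +oo)%E) ->
  forall A, measurable (A : set (measurableTypeR R)) -> m A = m' A.
Proof.
move=> mm' mfin A mA.
apply: (@g_sigma_algebra_measure_unique _ R (measurableTypeR R) (@ocitv R) _
   (fun k => `]- k%:R, k%:R]%classic)) => //.
- by move=> X oX; apply: sub_sigma_algebra.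
- by move=> i; exact: is_ocitv.
- rewrite -subTset => /= x _ /=; exists (Num.truncn `|x|).+1 => //=.
  have := truncnS_gt `|x|; rewrite ltr_norml in_itv/= => /andP[h1 h2].
  by rewrite h1 ltW.
- exact: ocitvI.
- by move=> X /ocitvP[->|[[a b] /= ab ->]]; rewrite ?measure0// mm'// ltW.
Qed.

End StieltjesMeasures.

Section StieltjesCalculus.
Variable R : realType.
Local Notation measR := {measure set (measurableTypeR R) -> \bar R}.
Implicit Types (m : measR) (g : R -> R) (a b c x z : R) (A : set R).

Definition stieltjes_of m g := Mc_plus m /\
  forall a b, a <= b -> m `]a, b]%classic = (g b - g a)%:E.

Lemma Mc_plus_fin m A : Mc_plus m -> bounded_borel A -> m A \is a fin_num.
Proof.
move=> [lf _ _] [mA [M [Mr bA]]]; rewrite ge0_fin_numE//.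
apply: le_lt_trans (Mc_plus_itv_fin (- (M + 1)) (M + 1) lf).
apply: le_measure; [exact: mem_set|exact: mem_set (measurable_itvR _)|].
move=> x Ax; rewrite /= in_itv/= -ler_norml; apply: (bA (M + 1)) => //.
by rewrite ltrDl.
Qed.

Lemma stieltjes_itv m g a b : stieltjes_of m g -> a <= b ->
  m `[a, b]%classic = (g b - g a)%:E.
Proof.
move=> [[lf rm m0] mE] ab; rewrite -mE//.
have -> : `[a, b]%classic = [set a] `|` `]a, b]%classic.
  apply/seteqP; split=> x /=; rewrite !in_itv/=.
    by rewrite le_eqVlt => /andP[/predU1P[->|-> ->]]; [left|right].
  by move=> [->|/andP[/ltW -> ->//]]; rewrite lexx ab.
rewrite measureU.
- by have /= -> := m0 a; rewrite add0e.
- by rewrite -set_itv1; exact: measurable_itvR.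
- exact: measurable_itvR.
- by apply/seteqP; split=> x//= [->]; rewrite in_itv/= ltxx.
Qed.

Let oc_fin m g a b : stieltjes_of m g -> (m `]a, b]%classic < +oo)%E.
Proof.
move=> [_ mE]; have [ab|ba] := leP a b; first by rewrite mE// ltry.
by rewrite set_itv_ge ?measure0 ?ltry// bnd_simp -leNgt ltW.
Qed.

Lemma stieltjes_add m1 m2 m3 g1 g2 g3 A :
  stieltjes_of m1 g1 -> stieltjes_of m2 g2 -> stieltjes_of m3 g3 ->
  (forall x z, x <= z -> g3 z - g3 x = (g1 z - g1 x) + (g2 z - g2 x)) ->
  measurable (A : set (measurableTypeR R)) -> m3 A = (m1 A + m2 A)%E.
Proof.
move=> s1 s2 s3 gD mA; rewrite -(measure_addE m1 m2 A).
apply: measure_eq_oc mA => [a b ab|a b]; last exact: oc_fin s3.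
rewrite [RHS](measure_addE m1 m2).
by rewrite s3.2// s1.2// s2.2// -EFinD gD.
Qed.

Lemma stieltjes_scale m1 m2 g c A : 0 <= c ->
  stieltjes_of m1 g -> stieltjes_of m2 (fun x => c * g x) ->
  measurable (A : set (measurableTypeR R)) -> m2 A = (c%:E * m1 A)%E.
Proof.
move=> c0 s1 s2 mA; rewrite -[c]/((NngNum c0)%:num).
rewrite -[RHS]/(mscale (NngNum c0) m1 A).
apply: measure_eq_oc mA => [a b ab|a b]; last exact: oc_fin s2.
by rewrite [RHS]/(mscale _ _ _) /= s2.2// s1.2// -EFinM mulrBr.
Qed.

(** [g2 - g1] is continuous and nondecreasing, so it has a Stieltjes measure [m3] and [m2] is
    [m1 + m3]. *)
Lemma stieltjes_le m1 m2 g1 g2 A : continuous g1 -> continuous g2 ->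
  stieltjes_of m1 g1 -> stieltjes_of m2 g2 ->
  (forall x z, x <= z -> g1 z - g1 x <= g2 z - g2 x) ->
  measurable (A : set (measurableTypeR R)) -> (m1 A <= m2 A)%E.
Proof.
move=> c1 c2 s1 s2 gle mA.
have [||m3 s3] := @stieltjes_Mc_plus R (fun x => g2 x - g1 x).
- by move=> x; apply: cvgB; [exact: c2|exact: c1].
- by move=> x z xz; have := gle x z xz; lra.
rewrite (stieltjes_add s1 s3 s2) => [|x z xz|//]; last by ring.
by rewrite leeDl.
Qed.

(** The factor [c] is 1 for an m-bound and the distance of the two parameters for an l-bound. *)
Lemma total_variation_le (mu : set R -> R) m c A : Mc_plus m ->
  (forall B, bounded_borel B -> `|mu B| <= fine (m B) * c) ->
  bounded_borel A -> (Defs.total_variation mu A <= m A * c%:E)%E.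
Proof.
move=> mMc mule bA; apply: ge_ereal_sup => _ [n [P [[bP tP UP] ->]]].
have -> : m A = (\sum_(i < n) m (P i))%E.
  rewrite -UP -measure_bigsetU_ord//; last by move=> i; case: (bP i).
  by congr (m _); rewrite -bigcup_seq; apply/seteqP; split=> x [i _ Px]; exists i => //=; rewrite mem_index_enum.
have -> : (\sum_(i < n) m (P i))%E = (\sum_(i < n) fine (m (P i)))%:E.
  by rewrite -sumEFin; apply: eq_bigr => i _; rewrite fineK// Mc_plus_fin.
rewrite -EFinM lee_fin mulr_suml; apply: ler_sum => i _; exact: mule.
Qed.

End StieltjesCalculus.

(** * Parametric b-measures from their increments *)

Section Reconstruction.
Variables (R : realType) (N : nat).
Local Notation V := 'rV[R]_N.
Local Notation measR := {measure set (measurableTypeR R) -> \bar R}.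
Variables (g : V -> R -> R) (M L : nat -> R -> R).
Hypotheses (Mc : forall j, (0 < j)%N -> continuous (M j))
  (Mnd : forall j, (0 < j)%N -> {homo M j : x z / x <= z})
  (Lc : forall j, (0 < j)%N -> continuous (L j))
  (Lnd : forall j, (0 < j)%N -> {homo L j : x z / x <= z}).
Hypothesis gM : forall j v x z, (0 < j)%N -> `|v| <= j%:R -> x <= z ->
  `|inc g v x z| <= M j z - M j x.
Hypothesis gL : forall j, (0 < j)%N -> lip_inc g j%:R (L j).
Implicit Types (x z a b c : R) (v w : V).

(* Both [M j + g v] and [M j] are nondecreasing and continuous, and the signed
   measure with increments those of [g v] is the difference of their
   Stieltjes measures; it does not depend on [j >= |v|]. *)
Lemma exists_Mp_of_increments : exists nu : Mp R N,
  forall v x z, x <= z -> inc (Mp_cum nu) v x z = inc g v x z.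
Proof.
pose lev v := (Num.truncn `|v|).+1.
have vlev v : `|v| <= (lev v)%:R by exact/ltW/truncnS_gt.
have gc v : continuous (g v).
  move=> x; apply/cvgrPdist_le => e e0.
  have /cvgrPdist_le/(_ _ e0) := Mc (isT : (0 < lev v)%N) (x := x).
  apply: filterS => t; apply: le_trans; have [xt|/ltW tx] := leP x t.
    rewrite distrC [leRHS]distrC; apply: le_trans (ler_norm _).
    exact: gM (vlev v) xt.
  by apply: le_trans (ler_norm _); exact: gM (vlev v) tx.
have Mgc j v : (0 < j)%N -> continuous (fun x => M j x + g v x).
  by move=> j0 x; apply: cvgD; [exact: Mc|exact: gc].
have Mgnd j v : (0 < j)%N -> `|v| <= j%:R -> {homo (fun x => M j x + g v x) : x z / x <= z}.
  move=> j0 vj x z xz; have := gM j0 vj xz; rewrite /inc ler_norml => /andP[]; lra.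
have /choice[mM mMP] : forall j, exists m : measR, (0 < j)%N -> stieltjes_of m (M j).
  move=> [|j]; first by exists [the measR of mzero].
  by have [m ?] := stieltjes_Mc_plus (Mc (isT : (0 < j.+1)%N)) (Mnd (isT : (0 < j.+1)%N)); exists m.
have /choice[mL mLP] : forall j, exists m : measR, (0 < j)%N -> stieltjes_of m (L j).
  move=> [|j]; first by exists [the measR of mzero].
  by have [m ?] := stieltjes_Mc_plus (Lc (isT : (0 < j.+1)%N)) (Lnd (isT : (0 < j.+1)%N)); exists m.
have /choice[mP mPP] : forall v, exists m : measR,
    stieltjes_of m (fun x => M (lev v) x + g v x).
  move=> v.
  by have [m ?] := stieltjes_Mc_plus (Mgc (lev v) v isT) (Mgnd (lev v) v isT (vlev v)); exists m.
pose nu v (A : set R) := if `[< bounded_borel A >] then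
  fine (mP v A) - fine (mM (lev v) A) else 0.
have nuE v A : bounded_borel A -> nu v A = fine (mP v A) - fine (mM (lev v) A).
  by move=> bA; rewrite /nu; case: asboolP.
have mMfin j A : (0 < j)%N -> bounded_borel A -> mM j A \is a fin_num.
  by move=> j0; apply: Mc_plus_fin; exact: (mMP j j0).1.
have mPfin v A : bounded_borel A -> mP v A \is a fin_num.
  by apply: Mc_plus_fin; exact: (mPP v).1.
have level j v : (0 < j)%N -> `|v| <= j%:R -> exists2 mv : measR,
    stieltjes_of mv (fun x => M j x + g v x) &
    forall A, bounded_borel A -> nu v A = fine (mv A) - fine (mM j A).
  move=> j0 vj; have [mv mvP] := stieltjes_Mc_plus (Mgc j v j0) (Mgnd j v j0 vj).
  exists mv => // A bA; rewrite nuE//.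
  have mvfin : mv A \is a fin_num by apply: Mc_plus_fin => //; exact: mvP.1.
  (* [ms] is split in two ways, with [g v] attached either to [M j] or to [M (lev v)]. Equating them
     shows that the difference of measures does not depend on the level. *)
  have [||ms msP] := @stieltjes_Mc_plus R (fun x => M (lev v) x + (M j x + g v x)).
  - by move=> x; apply: cvgD; [exact: Mc|exact: Mgc].
  - by move=> x z xz; apply: lerD; [exact: Mnd|exact: Mgnd].
  have mA := bA.1.
  have e1 : ms A = (mM (lev v) A + mv A)%E.
    by apply: (stieltjes_add (mMP (lev v) isT) mvP msP) => // x z _; ring.
  have e2 : ms A = (mP v A + mM j A)%E.
    by apply: (stieltjes_add (mPP v) (mMP j j0) msP) => // x z _; ring.
  have : (mM (lev v) A + mv A = mP v A + mM j A)%E by rewrite -e1.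
  rewrite -(fineK mvfin) -(fineK (mPfin v A bA)) -(fineK (mMfin j A j0 bA)).
  rewrite -(fineK (mMfin (lev v) A isT bA)) -!EFinD => -[]; lra.
have nuM j v A : (0 < j)%N -> `|v| <= j%:R -> bounded_borel A ->
    `|nu v A| <= fine (mM j A).
  move=> j0 vj bA; have [mv mvP ->//] := level j v j0 vj.
  have mvfin : mv A \is a fin_num by apply: Mc_plus_fin => //; exact: mvP.1.
  (* The increments of [M j + g v] are at most those of [2 * M j], which bounds [nu v] above by
     [mM j]; the bound below is the positivity of [mv]. *)
  have [||m2 m2P] := @stieltjes_Mc_plus R (fun x => M j x + M j x).
  - by move=> x; apply: cvgD; exact: Mc.
  - by move=> x z xz; apply: lerD; exact: Mnd.
  have h : (mv A <= mM j A + mM j A)%E.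
    rewrite -(stieltjes_add (mMP j j0) (mMP j j0) m2P (A := A)) => [|x z _|]; [|ring|exact: bA.1].
    apply: (stieltjes_le (Mgc j v j0) _ mvP m2P) bA.1.
      by move=> x; apply: cvgD; exact: Mc.
    by move=> x z xz; have := gM j0 vj xz; rewrite /inc ler_norml => /andP[]; lra.
  have mv0 : 0 <= fine (mv A) by rewrite fine_ge0.
  move: h; rewrite -(fineK mvfin) -(fineK (mMfin j A j0 bA)) -EFinD lee_fin => h.
  by rewrite ler_norml; apply/andP; split; lra.
have nuL j v w A : (0 < j)%N -> `|v| <= j%:R -> `|w| <= j%:R -> bounded_borel A ->
    `|nu v A - nu w A| <= fine (mL j A) * `|v - w|.
  (* Exchanging [v] and [w] reduces the absolute value to a one-sided estimate. *)
  suff H v' w' : (0 < j)%N -> `|v'| <= j%:R -> `|w'| <= j%:R -> bounded_borel A ->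
      nu v' A - nu w' A <= fine (mL j A) * `|v' - w'|.
    move=> j0 vj wj bA; rewrite ler_norml; apply/andP; split; last exact: H.
    by rewrite lerNl opprB distrC; exact: H.
  move=> j0 vj wj bA; have [mv mvP ->//] := level j v' j0 vj.
  have [mw mwP ->//] := level j w' j0 wj.
  have mvfin : mv A \is a fin_num by apply: Mc_plus_fin => //; exact: mvP.1.
  have mwfin : mw A \is a fin_num by apply: Mc_plus_fin => //; exact: mwP.1.
  have mLfin : mL j A \is a fin_num by apply: Mc_plus_fin => //; exact: (mLP j j0).1.
  have cLc : continuous (fun x => `|v' - w'| * L j x).
    by move=> x; apply: cvgMl_tmp; exact: Lc.
  have cLnd : {homo (fun x => `|v' - w'| * L j x) : x z / x <= z}.
    by move=> x z xz; apply: ler_wpM2l => //; exact: Lnd.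
  have [mc mcP] := stieltjes_Mc_plus cLc cLnd.
  (* By [gL] this function dominates [M j + g v'] in increments; the inequality of measures follows
     by [stieltjes_le]. *)
  have [||m2 m2P] := @stieltjes_Mc_plus R (fun x => (M j x + g w' x) + `|v' - w'| * L j x).
  - by move=> x; apply: cvgD; [exact: Mgc|exact: cLc].
  - by move=> x z xz; apply: lerD; [exact: Mgnd|exact: cLnd].
  have : (mv A <= mw A + `|v' - w'|%:E * mL j A)%E.
    rewrite -(stieltjes_scale (normr_ge0 _) (mLP j j0) mcP); last exact: bA.1.
    rewrite -(stieltjes_add mwP mcP m2P (A := A)) => [|x z _|]; [|ring|exact: bA.1].
    apply: (stieltjes_le (Mgc j v' j0) _ mvP m2P) bA.1.
      by move=> x; apply: cvgD; [exact: Mgc|exact: cLc].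
    move=> x z xz; have := gL j0 vj wj xz; rewrite /inc ler_norml => /andP[_].
    by rewrite mulrC mulrBr; lra.
  rewrite -(fineK mvfin) -(fineK mwfin) -(fineK mLfin) -EFinM -EFinD lee_fin mulrC; lra.
have nu_itv v a b : a <= b -> nu v `[a, b]%classic = inc g v a b.
  move=> ab; rewrite nuE; last exact: (bounded_borel_itv (fun=> id)).
  rewrite (stieltjes_itv (mPP v) ab) (stieltjes_itv (mMP (lev v) isT) ab) /=.
  by rewrite /inc; ring.
have nuP : is_Mp nu.
  split=> [v|j j0]; last split.
  - split.
    + by move=> A nA; rewrite /nu; case: asboolP.
    + by rewrite nuE ?measure0 ?subrr//; exact: bounded_borel0.
    + by move=> t; rewrite -set_itv1 nu_itv// /inc subrr.
    + move=> A bA tA bUA; rewrite nuE//.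
      have cvgm (m : measR) : Mc_plus m ->
          \sum_(0 <= k < n) fine (m (A k)) @[n --> \oo] --> fine (m (\bigcup_n A n)).
        move=> mMc.
        have : (fun n => \sum_(0 <= k < n) m (A k))%E @ \oo --> m (\bigcup_n A n).
          apply: measure_semi_sigma_additive => //; last by case: bUA.
          by move=> n; case: (bA n).
        rewrite -[X in _ --> X](fineK (Mc_plus_fin mMc bUA)) => /fine_cvgP[_].
        apply: cvg_trans; apply: near_eq_cvg; apply: nearW => n /=.
        under eq_bigr => k _ do rewrite -(fineK (Mc_plus_fin mMc (bA k))).
        by rewrite sumEFin.
      have -> : series (fun n => nu v (A n)) =
          (fun n => \sum_(0 <= k < n) fine (mP v (A k)) - \sum_(0 <= k < n) fine (mM (lev v) (A k))).
        apply/funext => n; rewrite /series/= -sumrB; apply: eq_bigr => k _.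
        by rewrite nuE.
      by apply: cvgB; apply: cvgm; [exact: (mPP v).1|exact: (mMP (lev v) isT).1].
  - exists (mM j); split; first exact: (mMP j j0).1.
    move=> A v bA vj; rewrite -[leRHS]mule1.
    apply: total_variation_le => //; first exact: (mMP j j0).1.
    by move=> B bB; rewrite mulr1; exact: nuM.
  - exists (mL j); split; first exact: (mLP j j0).1.
    move=> A v w bA vj wj; apply: total_variation_le => //; first exact: (mLP j j0).1.
    by move=> B bB; exact: nuL.
exists (MkMp nuP) => v x z xz.
by rewrite inc_Mp//= nu_itv.
Qed.

End Reconstruction.

(** * Compactness of the hull *)

Lemma ultra_bounded_cvg (R : realType) (T : Type) (U : set_system T) (f : T -> R) (B : R) :
  UltraFilter U -> (\forall t \near U, `|f t| <= B) -> exists l : R, f @ U --> l.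
Proof.
move=> UU fB; have UP : ProperFilter U by exact: ultra_proper.
have [|l [_ Ul]] := @segment_compact R (- B) B (f @ U) _.
  by move: fB; apply: filterS => t; rewrite /= in_itv/= ler_norml.
exists l => W Wl; have [//|UW] := in_ultra_setVsetC (f @^-1` W) UU.
by have [y [nWy Wy]] := Ul (~` W) W UW Wl.
Qed.

Section Compactness.
Variables (R : realType) (N : nat).
Local Notation V := 'rV[R]_N.
Variables (Theta : moduli R) (th : nat -> R -> R).
Hypothesis Hth : modulus_family th.
Hypothesis ThetaE : forall j q1 q2 s, q1 < q2 -> Theta j q1 q2 s = th j s.
Variable C : nat -> R.
Hypothesis C0 : forall j, 0 <= C j.
Local Notation STh := (@sigma_Theta R N Theta).
Implicit Types (mu nu : MpN R N) (v w : V) (a b e x z : R).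

Lemma ultra_limit_increments (U : set_system (MpN R N)) : UltraFilter U ->
  U (m_chain_bound th) -> exists g : 'I_N -> V -> R -> R,
  forall i v x z, inc (Mp_cum ((mu : MpN R N) i)) v x z @[mu --> U] --> inc (g i) v x z.
Proof.
move=> UU Um.
(* Taking limits of increments based at 0 gives one function of [x] whose differences are all the
   limit increments. *)
have /choice[g gP] (t : 'I_N * V * R) : exists l : R,
    inc (Mp_cum ((mu : MpN R N) t.1.1)) t.1.2 0 t.2 @[mu --> U] --> l.
  case: t => -[i v] x /=; pose j := (Num.truncn `|v|).+1.
  have vj : `|v| <= j%:R by exact/ltW/truncnS_gt.
  apply: (@ultra_bounded_cvg _ _ _ _ (th j `|x|) UU).
  apply: filterS Um => mu mum; have [x0|/ltW x0] := leP 0 x.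
    by have := m_chain_single (j := j) i mum isT vj x0; rewrite subr0 (ger0_norm x0).
  have := m_chain_single (j := j) i mum isT vj x0; rewrite sub0r (ler0_norm x0).
  by rewrite /inc distrC.
exists (fun i v x => g (i, v, x)) => i v x z; rewrite /inc.
have -> : (fun mu : MpN R N => Mp_cum (mu i) v z - Mp_cum (mu i) v x) =
    (fun mu => inc (Mp_cum (mu i)) v 0 z - inc (Mp_cum (mu i)) v 0 x).
  by apply/funext => mu; rewrite /inc; ring.
have UP : ProperFilter U by exact: ultra_proper.
by apply: cvgB; [exact: (gP (i, v, z))|exact: (gP (i, v, x))].
Qed.

(** The limit increments inherit both chain bounds, and the variations of the two limit weights
    provide [M j] and [L j]. These are functions of time alone, one pair for each ball, because the
    tags of a chain range over the whole ball. *)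
Lemma bounded_ultra_cvg (U : set_system (MpN R N)) : UltraFilter U ->
  U (m_chain_bound th) -> U (l_chain_bound C) ->
  exists nu, (U : set_system (MpN_top STh)) --> (nu : MpN_top STh).
Proof.
move=> UU Um Ul; have UP : ProperFilter U by exact: ultra_proper.
have [g gP] := ultra_limit_increments UU Um.
pose wm (t : 'I_N * V) x z := `|inc (g t.1) t.2 x z|.
pose wl (t : 'I_N * V * V) x z :=
  `|inc (g t.1.1) t.1.2 x z - inc (g t.1.1) t.2 x z| / `|t.1.2 - t.2|.
have mg j a s b : (0 < j)%N -> chain (fun t _ _ => `|t.2| <= j%:R) a s b ->
    csum wm a s <= th j (b - a).
  move=> j0 sP; apply: (@csum_le_lim _ _ _ U _ (@m_weight R N) wm _ _ _ _ _ sP).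
    by move=> t x z _; apply: cvg_norm; exact: gP.
  by apply: filterS Um => mu; apply.
have lg j a s b : (0 < j)%N ->
    chain (fun t _ _ => `|t.1.2| <= j%:R /\ `|t.2| <= j%:R) a s b ->
    csum wl a s <= C j * (b - a + 1).
  move=> j0 sP; apply: (@csum_le_lim _ _ _ U _ (@l_weight R N) wl _ _ _ _ _ sP).
    by move=> t x z _; apply: cvgMr_tmp; apply: cvg_norm; apply: cvgB; exact: gP.
  by apply: filterS Ul => mu; apply.
have mg1 j i v x z : (0 < j)%N -> `|v| <= j%:R -> x <= z ->
    `|inc (g i) v x z| <= th j (z - x).
  move=> j0 vj xz; have := mg j x [:: (z, (i, v))] z j0.
  by rewrite /= addr0; apply.
have mgc j i v x e : (0 < j)%N -> `|v| <= j%:R -> 0 < e -> exists2 d, 0 < d &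
    forall z, `|z - x| < d -> `|inc (g i) v (Num.min x z) (Num.max x z)| <= e.
  move=> j0 vj e0; have [_ _ /(_ _ e0)[d d0 dP]] := Hth j0.
  exists d => // z zx; apply: (le_trans (mg1 j _ _ _ _ j0 vj _)).
    by rewrite ge_min le_max lexx.
  apply: dP; move: zx; have [xz|zx] := leP x z.
    by rewrite ger0_norm ?subr_ge0 ?xz.
  by rewrite distrC ger0_norm ?subr_ge0 ?(ltW zx).
have /choice[M MP] : forall j, exists G : R -> R, (0 < j)%N -> 
    [/\ continuous G, {homo G : x z / x <= z} &
     forall i v x z, `|v| <= j%:R -> x <= z -> `|inc (g i) v x z| <= G z - G x].
  move=> [|j]; first by exists (fun=> 0).
  have [th0 _ _] := Hth (isT : (0 < j.+1)%N).
  have [|||||G [Gnd Gw _ Gc]] := @exists_variation R _ (fun t => `|t.2| <= j.+1%:R) wm (th j.+1) => //.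
  - by move=> t x z; exact: normr_ge0.
  - by move=> t x; rewrite /wm /inc subrr normr0.
  - move=> t x y z _ _ _; rewrite /wm; apply: le_trans (ler_normD _ _).
    by rewrite [leLHS](_ : _ = `|inc (g t.1) t.2 x y + inc (g t.1) t.2 y z|)// /inc; congr (`|_|); ring.
  - by move=> a s b; exact: mg.
  exists G => _; split=> // [|i v x z vj xz]; last exact: (Gw (i, v)).
  by apply: Gc => t x e vj e0; exact: mgc vj e0.
have /choice[L LP] : forall j, exists G : R -> R, (0 < j)%N ->
    [/\ continuous G, {homo G : x z / x <= z} & forall i, lip_inc (g i) j%:R G].
  move=> [|j]; first by exists (fun=> 0).
  have [|||||G [Gnd Gw _ Gc]] := @exists_variation R _
    (fun t => `|t.1.2| <= j.+1%:R /\ `|t.2| <= j.+1%:R) wl (fun s => C j.+1 * (s + 1)).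
  - by move=> t x z; rewrite /wl divr_ge0.
  - by move=> t x; rewrite /wl /inc !subrr normr0 mul0r.
  - move=> t x y z _ _ _; rewrite /wl -mulrDl ler_wpM2r ?invr_ge0//.
    apply: le_trans (ler_normD _ _).
    rewrite [leLHS](_ : _ = `|inc (g t.1.1) t.1.2 x y - inc (g t.1.1) t.2 x y +
      (inc (g t.1.1) t.1.2 y z - inc (g t.1.1) t.2 y z)|)// /inc; congr (`|_|); ring.
  - by move=> a s b; exact: lg.
  - by move=> s s0; rewrite mulr_ge0// addr_ge0.
  exists G => _; split=> // [|i v w x z vj wj xz].
    apply: Gc => -[[i v] w] x e /= [vj wj] e0; rewrite /wl/=.
    have [<-|vw] := eqVneq v w; first by exists 1 => // z _; rewrite !subrr normr0 mul0r ltW.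
    have nvw : 0 < `|v - w| by rewrite normr_gt0 subr_eq0.
    (* The l-majorant is continuous since, for fixed [v] and [w], the quotient is controlled by the
       m-modulus at both tags, each allowed half of [e] times the denominator. *)
    have e2 : 0 < e * `|v - w| / 2 by rewrite divr_gt0// mulr_gt0.
    have [d1 d10 h1] := mgc j.+1 i v x _ isT vj e2.
    have [d2 d20 h2] := mgc j.+1 i w x _ isT wj e2.
    exists (Num.min d1 d2) => [|z]; first by rewrite lt_min d10.
    rewrite lt_min => /andP[/h1 z1 /h2 z2]; rewrite ler_pdivrMr//.
    by apply: (le_trans (ler_normB _ _)); move: z1 z2; lra.
  have [<-|vw] := eqVneq v w; first by rewrite !subrr !normr0 mulr0.
  have nvw : 0 < `|v - w| by rewrite normr_gt0 subr_eq0.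
  have := Gw (i, v, w) x z (conj vj wj) xz.
  by rewrite /wl/= ler_pdivrMr.
have /choice[nu nuP] (i : 'I_N) : exists nu : Mp R N,
    forall v x z, x <= z -> inc (Mp_cum nu) v x z = inc (g i) v x z.
  apply: (@exists_Mp_of_increments _ _ _ M L) => [j j0|j j0|j j0|j j0|j v x z j0|j j0].
  - by have [] := MP j j0.
  - by have [] := MP j j0.
  - by have [] := LP j j0.
  - by have [] := LP j j0.
  - by have [_ _] := MP j j0; apply.
  - by have [_ _] := LP j j0; apply.
have gnu i v x z : x <= z ->
    inc (Mp_cum ((mu : MpN R N) i)) v x z @[mu --> U] --> inc (Mp_cum (nu i)) v x z.
  by move=> xz; rewrite nuP//; exact: gP.
exists (nu : MpN R N).
(* The increments converge at every tag, so the whole space serves as the dense set. *)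
apply: (cvg_Theta_of_dense Hth ThetaE C0 (D := setT)) => //.
- by move=> O [x Ox] _; exists x.
- exact: (l_chain_lim UP gnu Ul).
- by move=> k v q1 q2 _ q12; apply: gnu; rewrite ler_rat ltW.
Qed.

Lemma Hull_compact (nu0 : MpN R N) : m_chain_bound th nu0 -> l_chain_bound C nu0 ->
  compact (Hull STh nu0).
Proof.
move=> m0 l0; rewrite compact_ultra => U UU UH; have UP : ProperFilter U by exact: ultra_proper.
have Um : U (m_chain_bound th) by apply: filterS UH => mu; exact: Hull_m_chain.
have Ul : U (l_chain_bound C) by apply: filterS UH => mu; exact: (Hull_l_chain Hth ThetaE).
have [nu Unu] := bounded_ultra_cvg UU Um Ul.
have cH : closed (Hull STh nu0) by exact: closed_closure.
exists nu; split=> //; rewrite ((closure_id _).1 cH).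
exact: (@cvg_closure (MpN_top STh) U _ nu UP Unu UH).
Qed.

End Compactness.

(** * The skew-product flow *)

(** Points outside [A] are isolated in the subspace, so only points of [A] impose a condition. *)
Lemma within_open (T : topologicalType) (A V : set T) :
  (forall x, V x -> A x -> within A (nbhs x) V) -> open (V : set (subspace A)).
Proof.
move=> AV; rewrite openE => x Vx; rewrite /interior/=.
by have [Ax|_] := nbhs_subspaceP A x; [exact: AV|move=> y ->].
Qed.

Lemma open_within (T : topologicalType) (A V : set T) x :
  open (V : set (subspace A)) -> V x -> A x -> within A (nbhs x) V.
Proof.
rewrite openE => oV Vx Ax; have := oV x Vx; rewrite /interior/=.
by have [|] := nbhs_subspaceP A x.
Qed.

Lemma within_within (T : Type) (F : set_system T) (A V : set T) : Filter F ->
  within A F [set x | A x -> V x] -> within A F V.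
Proof. by move=> FF AV; apply: (@filterS _ F) AV => x h Ax; exact: h. Qed.

Section SkewProduct.
Variables (R : realType) (N : nat).
Local Notation V := 'rV[R]_N.
Variables (Theta : moduli R) (th : nat -> R -> R).
Hypothesis Hth : modulus_family th.
Hypothesis ThetaE : forall j q1 q2 s, q1 < q2 -> Theta j q1 q2 s = th j s.
Local Notation STh := (@sigma_Theta R N Theta).
Variable nu0 : MpN R N.
Hypothesis m0 : m_chain_bound th nu0.
Local Notation H := (Hull STh nu0).
Let Hm (mu : MpN R N) : H mu -> m_chain_bound th mu := Hull_m_chain Hth ThetaE m0 (mu := mu).

Let within3 (A : set (R * MpN_top STh * V)) (p : R * MpN_top STh * V) :
  A `<=` [set q | H q.1.2] -> \forall q \near within A (nbhs p), m_chain_bound th q.1.2.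
Proof. by move=> AH; apply: filterS (withinT A _) => q /AH /Hm. Qed.

Let cvg3 (A : set (R * MpN_top STh * V)) (p : R * MpN_top STh * V) :
  let G := within A (nbhs p) in
  [/\ (fun q => q.1.1) @ G --> p.1.1, (fun q => q.1.2) @ G --> p.1.2 & snd @ G --> p.2].
Proof.
case: p => -[t nu] v /=; have cp := @cvg_within _ (nbhs (t, nu, v)) _ A.
have c1 : fst @ nbhs (t, nu, v) --> (t, nu) by exact: cvg_fst.
split.
- by move=> W tW; apply: cp; apply: (c1 (fst @^-1` W)); exact: cvg_fst tW.
- by move=> W nW; apply: cp; apply: (c1 (snd @^-1` W)); exact: cvg_snd nW.
- by move=> W vW; apply: cp; exact: cvg_snd vW.
Qed.

Lemma U1_open : open (U1 H : set (subspace (setT `*` H `*` setT))).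
Proof.
apply: within_open => p [Hp Ip] _; have [c1 c2 c3] := cvg3 (setT `*` H `*` setT) p.
have GG : Filter (within (setT `*` H `*` setT) (nbhs p)) by exact: within_filter.
have Gm := @within3 (setT `*` H `*` setT) p (fun q => fun h => h.1.2).
have := cvg_solution Hth ThetaE GG c1 c3 c2 (Hm Hp) Gm Ip ltr01.
by apply: filterS2 (withinT _ _) => q [[_ Hq] _] [].
Qed.

Lemma Pi_continuous : {within U1 H, continuous (@Pi R N STh)}.
Proof.
apply/subspace_continuousP => p [Hp Ip]; have [c1 c2 c3] := cvg3 (U1 H) p.
have GG : Filter (within (U1 H) (nbhs p)) by exact: within_filter.
have Gm := @within3 (U1 H) p (fun q => fun h => h.1).
have cT := cvg_translate Hth ThetaE GG c1 c2 (Hm Hp) Gm.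
suff cS : (fun q => solution q.1.1 q.1.2 q.2) @ within (U1 H) (nbhs p) --> solution p.1.1 p.1.2 p.2.
  exact: (cvg_pair cT cS).
apply/cvgrPdist_le => e e0.
have := cvg_solution Hth ThetaE GG c1 c3 c2 (Hm Hp) Gm Ip e0.
by apply: filterS => q [_]; rewrite distrC.
Qed.

Lemma Hull_translation_flow : continuous_translation_flow H.
Proof.
split=> [t nu|nu _|s t nu _|].
- exact: (Hull_translate Hth ThetaE).
- exact: translateN0.
- exact: translateND.
apply/subspace_continuousP => p [_ Hp].
have GG : Filter (within (setT `*` H) (nbhs p)) by exact: within_filter.
apply: (cvg_translate Hth ThetaE GG _ _ (Hm Hp)).
- move=> W pW; apply: (@cvg_within _ (nbhs p)).
  by case: p pW {Hp GG} => t nu /= tW; exact: cvg_fst tW.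
- move=> W pW; apply: (@cvg_within _ (nbhs p)).
  by case: p pW {Hp GG} => t nu /= tW; exact: cvg_snd tW.
- by apply: filterS (withinT _ _) => q [_ /Hm].
Qed.

Lemma Hull_skew_product_flow : local_continuous_skew_product_flow H.
Proof.
split; [exact: Hull_translation_flow|exact: Pi_continuous| |].
- move=> nu y0 Hnu; have [_ _ I0 _ /(_ _ I0)/= s0] := solutionP nu y0.
  split; first by [].
  rewrite /Pi/= translateN0; congr (_, _); rewrite s0.
  pose j := (Num.truncn `|solution 0 nu y0|).+1.
  have [m [l fb]] := Mp_field nu (isT : (0 < j)%N).
  by rewrite (vint_refl fb) ?addr0//; exact/ltW/truncnS_gt.
- by move=> s t nu y0 _ Is It _; exact: solution_flow.
Qed.

Variable C : nat -> R.
Hypothesis C0 : forall j, 0 <= C j.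
Hypothesis l0 : l_chain_bound C nu0.

(** The neighbourhood filter of a point in one topology, restricted to the hull, converges to that
    point in the other. For the harder direction [cvg_Theta_of_dense] applies because the whole hull
    shares one l-chain bound. Both topologies sit on the same underlying type, so the filter
    instances are written out. *)
Lemma same_Hull_topology (D : set V) : dense D ->
  same_subspace_topology STh (sigma_D D) H.
Proof.
move=> dD.
have Hl (mu : MpN R N) : H mu -> l_chain_bound C mu by exact: (Hull_l_chain Hth ThetaE).
have ThD (x : MpN R N) : H x -> within H (nbhs (x : MpN_top STh))
    `=>` (nbhs (x : MpN_top (sigma_D D)) : set_system (MpN R N)).
  move=> Hx; have FF : Filter (within H (nbhs (x : MpN_top STh))) by exact: within_filter.
  have Fx : within H (nbhs (x : MpN_top STh)) --> (x : MpN_top STh) by exact: cvg_within.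
  apply/(cvg_sigma_D D x FF) => k v q1 q2 _ q12.
  exact: (cvg_Theta_cvg_inc Hth ThetaE FF Fx).
have DTh (x : MpN R N) : H x -> within H (nbhs (x : MpN_top (sigma_D D)))
    `=>` (nbhs (x : MpN_top STh) : set_system (MpN R N)).
  move=> Hx; have FF : Filter (within H (nbhs (x : MpN_top (sigma_D D)))).
    exact: (@within_filter _ _ _ (@nbhs_filter (MpN_top (sigma_D D)) x)).
  apply: (cvg_Theta_of_dense Hth ThetaE C0 FF dD _ (Hl _ Hx)).
    exact: (@filterE _ _ (@nbhs_filter (MpN_top (sigma_D D)) x) _ Hl).
  apply: (cvg_sigma_D D x FF).1.
  exact: (@cvg_within _ _ (@nbhs_filter (MpN_top (sigma_D D)) x)).
move=> W WH; split=> oW; apply: within_open => x Wx Hx.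
  apply: (within_within (@nbhs_filter (MpN_top (sigma_D D)) x)).
  exact: (DTh _ Hx _ (open_within oW Wx Hx)).
apply: (within_within (@nbhs_filter (MpN_top STh) x)).
exact: (ThD _ Hx _ (open_within oW Wx Hx)).
Qed.

End SkewProduct.

Theorem theorem5p10 (R : realType) (N : nat) (nu0 : MpN R N)
    (m : nat -> {measure set (measurableTypeR R) -> \bar R})
    (equi_m : has_equicontinuous_m_bounds nu0 m)
    (le_m : forall i j, (0 < j)%N -> (j <= i)%N ->
       forall A : set (measurableTypeR R), measurable A -> (m j A <= m i A)%E) :
  let Theta := associated_moduli m in
  let H := Hull (sigma_Theta Theta) nu0 in
  open (U1 H : set (subspace (setT `*` H `*` setT))) /\
  local_continuous_skew_product_flow H /\
  (has_bounded_l_bounds nu0 ->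
    (forall D : set 'rV[R]_N, dense D -> countable D ->
       (Hull (sigma_D D) nu0 : set (MpN R N)) = (H : set (MpN R N)) /\
       same_subspace_topology (sigma_Theta Theta) (sigma_D D) H) /\
    compact H).
Proof.
move=> Theta H; have [mb equi] := equi_m.
have Hth := modulus_family_sup equi; have m0 := common_m_chain_bound equi mb.
have ThetaE j q1 q2 s : q1 < q2 -> Theta j q1 q2 s = sup_modulus m j s.
  exact: associated_moduliE.
split; first exact: (U1_open Hth ThetaE m0).
split; first exact: (Hull_skew_product_flow Hth ThetaE m0).
move=> /common_l_chain_bound[C [C0 l0]]; split=> [D dD _|].
  split; first exact: (Hull_DE Hth ThetaE dD C0 m0 l0).
  exact: (same_Hull_topology Hth ThetaE m0 C0 l0).
exact: (Hull_compact Hth ThetaE C0).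
Qed.
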